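(* Let $\mathbf{v}^\pm(t,\xi,\sigma)$, $\rho^\pm(t,\xi,\sigma)$, $\tau(\xi)$, $\omega_k(\xi)$, $c_1(\xi)$ be as defined in the context. Let $\xi_0\in I$ and $\tilde\sigma_0\in\mathbb{R}$ be given. Then there exist analytic functions $\mathbf{B}_1,\mathbf{B}_2$ (with values in $\mathbb{R}^2$) and $b_1,b_2$ (with values in $\mathbb{R}$), defined for $(t,\xi,\tilde\sigma)$ in a neighborhood of $(\tau(\xi_0),\xi_0,\tilde\sigma_0)$, such that the following holds. For $t\ge\tau(\xi)$ and $\sigma=(t-\tau(\xi))\tilde\sigma$ one has $$\mathbf{v}^\pm(t,\xi,\sigma)-\mathbf{w}(\xi)=\mathbf{B}_1(t,\xi,\tilde\sigma)\cdot(t-\tau(\xi))\pm\mathbf{B}_2(t,\xi,\tilde\sigma)\cdot\sqrt{t-\tau(\xi)},$$ $$\rho^\pm(t,\xi,\sigma)=\frac{1}{t-\tau(\xi)}\Big[b_1(t,\xi,\tilde\sigma)\pm b_2(t,\xi,\tilde\sigma)\cdot\sqrt{t-\tau(\xi)}\Big]$$ (the second identity being meant for $t>\tau(\xi)$). Moreover, $$\mathbf{B}_2(\tau(\xi),\xi,\tilde\sigma)=\sqrt{c_1(\xi)}\,\lambda_1(\xi)\,r_1(\xi)=-\omega_1^2(\xi)\sqrt{\frac{6}{\omega_3(\xi)}}\;r_1(\xi)\ne0,$$ $$b_1(\tau(\xi),\xi,\tilde\sigma)=\frac{\bar\rho(\xi)}{2(\lambda_2(\xi)-\lambda_1(\x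i))}>0.$$
   Context: Setting. $V\subset\mathbb{R}^2$ is open and $\bar\rho:V\to\mathbb{R}$, $\mathbf{w}:V\to\mathbb{R}^2$ are real analytic (initial density and velocity of a pressureless gas). (A1) $\bar\rho>0$ on $V$ and $D\mathbf{w}(x)$ has real distinct eigenvalues $\lambda_1(x)<\lambda_2(x)$ for every $x\in V$. (A2) At some $x_0\in V$ the eigenvalue $\lambda_1$ attains a negative minimum and the Hessian $D^2\lambda_1(x_0)$ is strictly positive definite. Near $x_0$, $r_1(x),r_2(x)$ are unit right eigenvectors of $D\mathbf{w}(x)$ depending analytically on $x$, and $\tau(x)=-1/\lambda_1(x)$. Coordinates. Near $x_0$ the set $\gamma^*=\{x:\langle\nabla\lambda_1(x),r_1(x)\rangle=0\}$ is an analytic curve, transversal to $r_1$. It is parameterized by arc-length $\xi\mapsto\gamma^*(\xi)$, $\gamma^*(0)=x_0$, with $\xi$ in a sufficiently small open interval $I\ni0$. Let $x(\xi,\sigma)=\exp(\sigma r_1)(\gamma^*(\xi))$ be the value at time $\sigma$ of the solution of $\dot x=r_1(x)$, $x(0)=\gamma^*(\xi)$. For any function $g$ of $x$ write $g(\xi,\sigma)=g(x(\xi,\sigma))$ and $g(\xi)=g(\gamma^*(\xi))=g(\xi,0)$. Let $r_1^\perp(\xi)$ be $r_1(\xi)$ rotated counterclockwise by $\pi/2$. The analytic functions $\omega_k(\xi)$ are defined by $$\lambda_1(\xi,\sigma)=-\omega_1(\xi)+\sum_{k\ge3}\omega_k(\xi)\frac{\sigma^{k-1}}{(k-1)!},$$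 where $\omega_1(\xi)>0$, $\omega_3(\xi)>0$; thus $\tau(\xi)\omega_1(\xi)=1$. Put $c_1(\xi)=6\omega_1^2(\xi)/\omega_3(\xi)$. The additional characteristics. Set $$\Phi_1(t,\xi,\sigma,\xi',Z)=\big\langle r_1(\xi),\,x(\xi',Z)+t\mathbf{w}(x(\xi',Z))-x(\xi,\sigma)-t\mathbf{w}(x(\xi,\sigma))\big\rangle,$$ $$\Phi_2(t,\xi,\sigma,\xi',Z)=\big\langle r_1^\perp(\xi),\,x(\xi',Z)+t\mathbf{w}(x(\xi',Z))-x(\xi,\sigma)-t\mathbf{w}(x(\xi,\sigma))\big\rangle.$$ Since $\partial\Phi_2/\partial\xi'\ne0$ at $t=\tau(\xi)$, $\sigma=Z=0$, $\xi'=\xi$, by the implicit function theorem the equation $\Phi_2=0$ is solved near such points by an analytic function $\xi'=\phi(t,\xi,\sigma,Z)$, with $\phi(t,\xi,\sigma,\sigma)=\xi$. Consider the scalar equation $$\frac{\Phi_1\big(t,\xi,\sigma,\phi(t,\xi,\sigma,Z),Z\big)}{Z-\sigma}=0$$ (with the left side extended analytically to $Z=\sigma$). For $\sigma=(t-\tau(\xi))\tilde\sigma$, with $t\ge\tau(\xi)$ and $(t,\xi,\tilde\sigma)$ near $(\tau(\xi_0),\xi_0,\tilde\sigma_0)$, it has two solutions $Z^\pm$ near $0$, of the form $$Z^\pm=(t-\tau(\xi))\beta_0(t,\xi,\tilde\sigma)\pm\sqrt{t-\tau(\xi)}\,\beta_1(t,\xi,\tilde\sigma)$$ with $\beta_0,\beta_1$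 analytic and $\beta_1=\sqrt{c_1(\xi)}$ at $t=\tau(\xi)$; this fixes the labelling $\pm$. Set $$X^\pm(t,\xi,\sigma)=x\big(\phi(t,\xi,\sigma,Z^\pm),Z^\pm\big).$$ These are the initial points of the two additional characteristics reaching the point $x(\xi,\sigma)+t\mathbf{w}(x(\xi,\sigma))$ at time $t$. The velocities and densities of the gas carried by these characteristics are $$\mathbf{v}^\pm(t,\xi,\sigma)=\mathbf{w}\big(X^\pm(t,\xi,\sigma)\big),\qquad \rho^\pm(t,\xi,\sigma)=\frac{\bar\rho(X^\pm(t,\xi,\sigma))}{\det\big(I+tD\mathbf{w}(X^\pm(t,\xi,\sigma))\big)}.$$ *)

(* Defs.v *)
From HB Require Import structures.
From mathcomp Require Import all_boot all_order all_algebra.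
From mathcomp Require Import all_classical all_reals all_analysis.

Set Implicit Arguments.
Unset Strict Implicit.
Unset Printing Implicit Defensive.

Import Order.TTheory GRing.Theory Num.Theory.
Import numFieldNormedType.Exports.

Local Open Scope classical_set_scope.
Local Open Scope ring_scope.

Section RealAnalytic.
Context {R : realType}.

Definition monomial n (v : 'rV[R]_n) (al : {ffun 'I_n -> nat}) : R :=
  \prod_(i < n) v 0 i ^+ al i.

(* Sum over the multi-indices all of whose entries are < N. *)
Definition box_sum n (g : {ffun 'I_n -> nat} -> R) (N : nat) : R :=
  \sum_(al : {ffun 'I_n -> 'I_N}) g [ffun i => nat_of_ord (al i)].

(* On a polydisc around p, f is the sum of an absolutely convergent power
   series centered at p; absolute convergence makes the choice of the finite
   partial sums (boxes) immaterial. *)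
Definition analytic_at n (f : 'rV[R]_n -> R) (p : 'rV[R]_n) : Prop :=
  exists (a : {ffun 'I_n -> nat} -> R) (r : R), 0 < r /\
  forall x : 'rV[R]_n, (forall i, `|x 0 i - p 0 i| < r) ->
    cvgn (box_sum (fun al => `|a al * monomial (x - p) al|)) /\
    (box_sum (fun al => a al * monomial (x - p) al) @ \oo --> f x).

Definition vanalytic_at n m (f : 'rV[R]_n -> 'rV[R]_m) (p : 'rV[R]_n) : Prop :=
  forall j, analytic_at (fun x => f x 0 j) p.

Definition row_of (s : seq R) : 'rV[R]_(size s) := \row_i s`_i.

Definition of_row1 T (f : R -> T) (v : 'rV[R]_1) : T := f (v 0 0).
Definition of_row3 T (f : R -> R -> R -> T) (v : 'rV[R]_3) : T :=
  f (v 0 0) (v 0 1) (v 0 2).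
Definition of_row4 T (f : R -> R -> R -> R -> T) (v : 'rV[R]_4) : T :=
  f (v 0 0) (v 0 1) (v 0 2) (v 0 3).

Definition near3 (a b c : R) (P : R -> R -> R -> Prop) : Prop :=
  exists2 d : R, 0 < d & forall x y z,
    `|x - a| < d -> `|y - b| < d -> `|z - c| < d -> P x y z.
Definition near4 (a b c e : R) (P : R -> R -> R -> R -> Prop) : Prop :=
  exists2 d : R, 0 < d & forall x y z u,
    `|x - a| < d -> `|y - b| < d -> `|z - c| < d -> `|u - e| < d -> P x y z u.

End RealAnalytic.

Section Plane.
Context {R : realType}.
Implicit Types (u v p : 'rV[R]_2) (f : 'rV[R]_2 -> R).

Definition dot u v : R := \sum_(i < 2) u 0 i * v 0 i.

(* Counterclockwise rotation by pi/2. *)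
Definition rot90 u : 'rV[R]_2 := row_of [:: - u 0 1; u 0 0].

Definition grad f p : 'rV[R]_2 := \row_j 'D_(delta_mx 0 j) f p.

Definition hessian f p : 'M[R]_2 :=
  \matrix_(i, j) 'D_(delta_mx 0 i) (fun y => 'D_(delta_mx 0 j) f y) p.

Definition posdef (A : 'M[R]_2) : Prop :=
  forall v, v != 0 -> 0 < dot (v *m A) v.

End Plane.

(* Points and vectors of the plane are row vectors, and ['J f p] acts on rows
   from the right: it is the transpose of the usual Jacobian matrix. Hence right
   eigenvectors of Dw are the [v] such that [v *m 'J w p = a *: v], and
   [eigenvalue ('J w p)] is the library notion for exactly those. *)

Record gas_data (R : realType) := GasData {
  dom : set 'rV[R]_2;                  (* V *)
  dens : 'rV[R]_2 -> R;                (* initial density *)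
  vel : 'rV[R]_2 -> 'rV[R]_2;          (* initial velocity w *)
  lam1 : 'rV[R]_2 -> R;
  lam2 : 'rV[R]_2 -> R;
  x0 : 'rV[R]_2;
  frame_dom : set 'rV[R]_2;            (* neighborhood of x0 carrying r1, r2 *)
  r1 : 'rV[R]_2 -> 'rV[R]_2;
  r2 : 'rV[R]_2 -> 'rV[R]_2;
  itv : set R;                         (* I *)
  gam : R -> 'rV[R]_2;                 (* xi |-> gamma^*(xi) *)
  flow : R -> R -> 'rV[R]_2;           (* (xi, sigma) |-> x(xi, sigma) *)
  om : nat -> R -> R                   (* omega_k; [om 0], [om 2] are unused *)
}.

Section Setting.
Context {R : realType} (G : gas_data R).

Record gas_A1 : Prop := GasA1 {
  dom_open : open (dom G);
  dens_analytic : forall x, dom G x -> analytic_at (dens G) x;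
  vel_analytic : forall x, dom G x -> vanalytic_at (vel G) x;
  dens_gt0 : forall x, dom G x -> 0 < dens G x;
  lam1_eigen : forall x, dom G x -> eigenvalue ('J (vel G) x) (lam1 G x);
  lam2_eigen : forall x, dom G x -> eigenvalue ('J (vel G) x) (lam2 G x);
  lam1_lt_lam2 : forall x, dom G x -> lam1 G x < lam2 G x
}.

Record gas_A2 : Prop := GasA2 {
  x0_dom : dom G (x0 G);
  lam1_min : forall x, dom G x -> lam1 G (x0 G) <= lam1 G x;
  lam1_neg : lam1 G (x0 G) < 0;
  lam1_hessian : posdef (hessian (lam1 G) (x0 G))
}.

Record gas_frame : Prop := GasFrame {
  frame_open : open (frame_dom G);
  frame_x0 : frame_dom G (x0 G);
  frame_sub : frame_dom G `<=` dom G;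
  r1_analytic : forall x, frame_dom G x -> vanalytic_at (r1 G) x;
  r2_analytic : forall x, frame_dom G x -> vanalytic_at (r2 G) x;
  r1_unit : forall x, frame_dom G x -> dot (r1 G x) (r1 G x) = 1;
  r2_unit : forall x, frame_dom G x -> dot (r2 G x) (r2 G x) = 1;
  r1_eigen : forall x, frame_dom G x ->
    r1 G x *m 'J (vel G) x = lam1 G x *: r1 G x;
  r2_eigen : forall x, frame_dom G x ->
    r2 G x *m 'J (vel G) x = lam2 G x *: r2 G x
}.

Definition gam_set : set 'rV[R]_2 :=
  [set x | frame_dom G x /\ dot (grad (lam1 G) x) (r1 G x) = 0].

Record gas_curve : Prop := GasCurve {
  itv_is_open : open (itv G);
  itv_itv : is_interval (itv G);
  itv_0 : itv G 0;
  gam_0 : gam G 0 = x0 G;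
  gam_sub : forall xi, itv G xi -> gam_set (gam G xi);
  gam_onto : \forall x \near x0 G, gam_set x -> (gam G @` itv G) x;
  gam_analytic : forall xi, itv G xi ->
    vanalytic_at (of_row1 (gam G)) (row_of [:: xi]);
  gam_arclength : forall xi, itv G xi ->
    dot (derive1 (gam G) xi) (derive1 (gam G) xi) = 1;
  gam_transversal : forall xi, itv G xi ->
    ~ exists c : R, derive1 (gam G) xi = c *: r1 G (gam G xi)
}.

(* The flow of r1 started on the curve; [flow G] is a total function, and is
   constrained only on a neighborhood of I x {0}. *)
Definition gas_flow : Prop :=
  forall xi0, itv G xi0 -> exists2 e : R, 0 < e & forall xi sg : R,
    `|xi - xi0| < e -> `|sg| < e ->
    [/\ flow G xi 0 = gam G xi,
        frame_dom G (flow G xi sg) &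
        is_derive sg 1 (flow G xi) (r1 G (flow G xi sg))].

Record gas_omega : Prop := GasOmega {
  om_analytic : forall k xi, (k = 1 \/ (3 <= k))%N -> itv G xi ->
    analytic_at (of_row1 (om G k)) (row_of [:: xi]);
  om_expansion : forall xi, itv G xi -> \forall sg \near (0 : R),
    - om G 1 xi + [series om G k.+3 xi * sg ^+ k.+2 / (k.+2)`!%:R]_k n
      @[n --> \oo] --> lam1 G (flow G xi sg);
  om1_gt0 : forall xi, itv G xi -> 0 < om G 1 xi;
  om3_gt0 : forall xi, itv G xi -> 0 < om G 3 xi
}.

Definition tau (xi : R) : R := - (lam1 G (gam G xi))^-1.

Definition c1 (xi : R) : R := 6 * om G 1 xi ^+ 2 / om G 3 xi.

(* Position at time t of the particle that starts at x(xi, sigma). *)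
Definition chr (t xi sg : R) : 'rV[R]_2 :=
  flow G xi sg + t *: vel G (flow G xi sg).

Definition Phi1 (t xi sg xi' Z : R) : R :=
  dot (r1 G (gam G xi)) (chr t xi' Z - chr t xi sg).

Definition Phi2 (t xi sg xi' Z : R) : R :=
  dot (rot90 (r1 G (gam G xi))) (chr t xi' Z - chr t xi sg).

Definition phi_spec (xi0 : R) (phi : R -> R -> R -> R -> R) : Prop :=
  near4 (tau xi0) xi0 0 0 (fun t xi sg Z =>
    [/\ analytic_at (of_row4 phi) (row_of [:: t; xi; sg; Z]),
        Phi2 t xi sg (phi t xi sg Z) Z = 0 &
        phi t xi sg sg = xi]).

(* Q is the analytic extension to Z = sigma of the quotient of Phi1 by
   Z - sigma. *)
Definition quotient_spec (xi0 : R) (phi Q : R -> R -> R -> R -> R) : Prop :=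
  near4 (tau xi0) xi0 0 0 (fun t xi sg Z =>
    analytic_at (of_row4 Q) (row_of [:: t; xi; sg; Z]) /\
    (Z != sg -> Q t xi sg Z = Phi1 t xi sg (phi t xi sg Z) Z / (Z - sg))).

(* The label: [true] is +, [false] is -. *)
Definition pm (b : bool) : R := if b then 1 else - 1.

(* [Z true], [Z false] are the two roots of Q, as functions of (t, xi, sigma). *)
Definition root_spec (xi0 st0 : R) (Q : R -> R -> R -> R -> R)
    (beta0 beta1 : R -> R -> R -> R) (Z : bool -> R -> R -> R -> R) : Prop :=
  near3 (tau xi0) xi0 st0 (fun t xi st =>
    [/\ analytic_at (of_row3 beta0) (row_of [:: t; xi; st]),
        analytic_at (of_row3 beta1) (row_of [:: t; xi; st]),
        t = tau xi -> beta1 t xi st = Num.sqrt (c1 xi) &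
        tau xi <= t -> forall b, let sg := (t - tau xi) * st in
          Q t xi sg (Z b t xi sg) = 0 /\
          Z b t xi sg = (t - tau xi) * beta0 t xi st
                        + pm b * Num.sqrt (t - tau xi) * beta1 t xi st]).

Definition Xpm (phi : R -> R -> R -> R -> R) (Z : bool -> R -> R -> R -> R)
    (b : bool) (t xi sg : R) : 'rV[R]_2 :=
  flow G (phi t xi sg (Z b t xi sg)) (Z b t xi sg).

Definition vpm phi Z b t xi sg : 'rV[R]_2 := vel G (Xpm phi Z b t xi sg).

Definition rhopm phi Z b t xi sg : R :=
  dens G (Xpm phi Z b t xi sg) /
  \det (1%:M + t *: 'J (vel G) (Xpm phi Z b t xi sg)).

End Setting.

(* Main.v *)
(* With [t = tau xi + s^2] the two roots become a single analytic function of
   [(xi, st, s)], the sign of the root being the sign of [s]; so do the foot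
   points, once the flow of [r1] is known to be analytic. An analytic function of
   [s] splits as [E(s^2) + s O(s^2)], and [s^2 = t - tau xi] gives the expansions.
   For the leading terms, the motion along the integral curve of [r1] has a
   normal component of order [s^3] only, hence so has [phi - xi], by
   transversality of the curve. So to the relevant order the foot point moves
   along [r1] with speed [sqrt c1], whence [B2 = sqrt c1 lam1 r1], while
   [1 + t lam1 = s^2 (- om1 + tau c1 om3 / 2) + o(s^2) = 2 om1 s^2 + o(s^2)]
   gives [b1]. *)
Require Import Defs.
From mathcomp Require Import all_boot all_order all_algebra.
From mathcomp Require Import ring lra.
From mathcomp Require Import all_classical all_reals all_analysis.
Import Order.TTheory GRing.Theory Num.Theory.
Import numFieldNormedType.Exports.
Local Open Scope classical_set_scope.
Local Open Scope ring_scope.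
Set Implicit Arguments.
Unset Strict Implicit.
Unset Printing Implicit Defensive.

(** * Unconditional sums *)

(** The data give [flow] as a solution of the differential equation in [sg], with no prescribed
    regularity in [xi]. Its analyticity is extracted instead from that of [phi] and of the quotient
    [Q], which together express every characteristic through one that starts on the curve. The
    leading coefficients are claimed at every [(xi, st)] near [(xi0, st0)], while a limit in [s]
    concerns one base point. The limits are therefore proved at an arbitrary base point obeying the
    specifications; these persist at nearby points, where the limits are compared with coefficients
    constructed once around [(xi0, st0)]. The denominator of [b1] arises as follows: the determinant
    is [(1 + t lam1) (1 + t lam2)], the second factor tends to [tau (lam2 - lam1)], and
    [tau om1 = 1], so the determinant is [2 (lam2 - lam1) s^2] to leading order. Power series in
    several variables are handled through a weighted l^1 norm of their coefficients, which reduces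
    products, composition, division by a variable and sorting by parity to statements about
    unordered sums. *)

Section UnorderedSums.
Context {R : realType}.
Implicit Types (I J : eqType).

(* Unconditional sums over arbitrary index types: rearrangements and double
   sums need no enumeration of the indices. *)
Definition asum I (f : I -> R) (M : R) : Prop :=
  forall s : seq I, uniq s -> \sum_(i <- s) `|f i| <= M.

Definition hsum I (f : I -> R) (l : R) : Prop :=
  forall e : R, 0 < e -> exists s0 : seq I, forall s, uniq s ->
    {subset s0 <= s} -> `|\sum_(i <- s) f i - l| < e.

(** The value 0 is only a default, for families that have no sum. *)
Definition tsum I (f : I -> R) : R := xget 0 [set l | hsum f l].

Lemma asum_ge0 I (f : I -> R) M : asum f M -> 0 <= M.
Proof. by move/(_ [::] isT); rewrite big_nil. Qed.

Lemma asum_le I (f g : I -> R) M : (forall i, `|f i| <= `|g i|) ->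
  asum g M -> asum f M.
Proof. by move=> fg gM s us; apply: le_trans (gM s us); apply: ler_sum. Qed.

Lemma asum_leM I (f : I -> R) M N : M <= N -> asum f M -> asum f N.
Proof. by move=> MN fM s us; apply: le_trans (fM s us) MN. Qed.

Lemma asumZ I (f : I -> R) (c M : R) :
  asum f M -> asum (fun i => c * f i) (`|c| * M).
Proof.
move=> fM s us; under eq_bigr do rewrite normrM.
by rewrite -big_distrr /= ler_wpM2l //; exact: fM.
Qed.

Lemma hsum_near2 I (f g : I -> R) l m e : hsum f l -> hsum g m -> 0 < e ->
  exists s, [/\ uniq s, `|\sum_(i <- s) f i - l| < e &
    `|\sum_(i <- s) g i - m| < e].
Proof.
move=> hf hg e0; have [s1 h1] := hf e e0; have [s2 h2] := hg e e0.
exists (undup (s1 ++ s2)); split; first exact: undup_uniq.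
- by apply: h1; [exact: undup_uniq|move=> i; rewrite mem_undup mem_cat => ->].
- apply: h2; [exact: undup_uniq|move=> i].
  by rewrite mem_undup mem_cat => ->; rewrite orbT.
Qed.

Lemma hsum_uniq I (f : I -> R) l m : hsum f l -> hsum f m -> l = m.
Proof.
move=> hl hm; apply/eqP; rewrite -subr_eq0 -normr_le0; apply/ler_addgt0Pl.
move=> e e0; rewrite addr0.
have e2 : 0 < e / 2 by rewrite divr_gt0.
have [s [_ h1 h2]] := hsum_near2 hl hm e2.
set S := \sum_(i <- s) f i in h1 h2.
have -> : l - m = (S - m) - (S - l) by ring.
by rewrite (le_trans (ler_normB _ _)) // [leRHS](splitr e) lerD // ltW.
Qed.

Lemma tsumE I (f : I -> R) l : hsum f l -> tsum f = l.
Proof.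
move=> h; apply: hsum_uniq (h).
by apply: (@xgetI _ 0 [set l | hsum f l] l h).
Qed.

Lemma hsumD I (f g : I -> R) l m : hsum f l -> hsum g m ->
  hsum (fun i => f i + g i) (l + m).
Proof.
move=> hf hg e e0; have e2 : 0 < e / 2 by rewrite divr_gt0.
have [s1 h1] := hf _ e2; have [s2 h2] := hg _ e2.
exists (s1 ++ s2) => s us ss; rewrite big_split /= opprD addrACA.
rewrite (le_lt_trans (ler_normD _ _)) // [ltRHS](splitr e) ltrD //.
- by apply: h1 => // i i1; apply: ss; rewrite mem_cat i1.
- by apply: h2 => // i i1; apply: ss; rewrite mem_cat i1 orbT.
Qed.

Lemma hsumZ I (f : I -> R) c l : hsum f l -> hsum (fun i => c * f i) (c * l).
Proof.
move=> hf e e0; have [->|c0] := eqVneq c 0.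
  exists [::] => s _ _; rewrite mul0r big1 ?subrr ?normr0 // => i _.
  by rewrite mul0r.
have nc0 : 0 < `|c| by rewrite normr_gt0.
have [s0 h] := hf (e / `|c|) (divr_gt0 e0 nc0).
exists s0 => s us ss; rewrite -big_distrr -mulrBr normrM.
by rewrite -ltr_pdivlMl // mulrC; exact: h.
Qed.

Lemma big_uniq_sub I (f : I -> R) (t s : seq I) : uniq t -> uniq s ->
  {subset t <= s} ->
  \sum_(i <- s) f i = \sum_(i <- t) f i + \sum_(i <- s | i \notin t) f i.
Proof.
move=> ut us ts.
rewrite (perm_big (t ++ [seq i <- s | i \notin t])) /=; last first.
  apply: uniq_perm => //.
    rewrite cat_uniq ut filter_uniq // andbT; apply/hasPn => i.
    by rewrite mem_filter => /andP[].
  move=> i; rewrite mem_cat mem_filter; have := ts i.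
  by case: (i \in t) => //= ->.
by rewrite big_cat /= big_filter.
Qed.

Lemma hsum_finite I (f : I -> R) (t : seq I) : uniq t ->
  (forall i, i \notin t -> f i = 0) -> hsum f (\sum_(i <- t) f i).
Proof.
move=> ut f0 e e0; exists t => s us ts.
by rewrite (big_uniq_sub _ ut us ts) (big1 _ (fun i => i \notin t)) ?addr0
  ?subrr ?normr0.
Qed.

Lemma hsum_le I (f : I -> R) l M : asum f M -> hsum f l -> `|l| <= M.
Proof.
move=> fM hf; apply/ler_addgt0Pl => e e0; have [s0 h] := hf e e0.
have us := undup_uniq s0.
have hs := h _ us (fun i => (fun h => eq_ind_r is_true h (mem_undup s0 i))).
set S := \sum_(i <- _) _ in hs.
have -> : l = - (S - l) + S by ring.
rewrite (le_trans (ler_normD _ _)) // normrN lerD //; first exact: ltW.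
exact: le_trans (ler_norm_sum _ _ _) (fM _ us).
Qed.

(** The sum is the supremum of the finite sums: a finite set that nearly attains it can only get
    closer when enlarged. *)
Lemma hsum_ex_nonneg I (f : I -> R) M : (forall i, 0 <= f i) -> asum f M ->
  exists l, hsum f l.
Proof.
move=> f0 fM.
pose E := [set x | exists s : seq I, uniq s /\ x = \sum_(i <- s) f i].
have Esup : has_sup E.
  split; first by exists 0, [::]; rewrite big_nil.
  exists M => _ [s [us ->]]; apply: le_trans (fM s us).
  by apply: ler_sum => i _; exact: ler_norm.
exists (sup E) => e e0.
have [_ [s0 [us0 ->]] hs0] := sup_adherent e0 Esup.
exists s0 => s us ss.
have h1 : \sum_(i <- s) f i <= sup E by apply: ub_le_sup; [case: Esup|exists s].
have h2 : \sum_(i <- s0) f i <= \sum_(i <- s) f i.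
  by rewrite (big_uniq_sub _ us0 us ss) lerDl sumr_ge0.
by rewrite ltr_norml; apply/andP; split; lra.
Qed.

(** [f] is the difference of the nonnegative families [|f|] and [|f| - f], whose sums exist as
    suprema. *)
Lemma asum_hsum I (f : I -> R) M : asum f M -> hsum f (tsum f).
Proof.
move=> fM.
have aM : asum (fun i => `|f i|) M.
  by move=> s us; under eq_bigr do rewrite normr_id; exact: fM.
have bM : asum (fun i => `|f i| - f i) (M + M).
  move=> s us; apply: (@le_trans _ _ (\sum_(i <- s) (`|f i| + `|f i|))).
    by apply: ler_sum => i _; rewrite (le_trans (ler_normB _ _)) // normr_id.
  by rewrite big_split lerD //; exact: fM.
have [a ha] := hsum_ex_nonneg (fun i => normr_ge0 (f i)) aM.
have b0 i : 0 <= `|f i| - f i by rewrite subr_ge0 ler_norm.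
have [b hb] := hsum_ex_nonneg b0 bM.
have hf : hsum f (a + (-1) * b).
  have := hsumD ha (hsumZ (-1) hb); congr hsum.
  by apply/funext => i; ring.
by rewrite (tsumE hf).
Qed.

(** A finite set of pairs is cut into slices along its first components; [N] bounds each slice, and
    [M] bounds the slices together. *)
Lemma asum_pair I J (f : I * J -> R) (N : I -> R) (M : R) :
  (forall i, asum (fun j => f (i, j)) (N i)) -> asum N M -> asum f M.
Proof.
move=> fN NM s us; pose t := undup [seq p.1 | p <- s].
have ut : uniq t by exact: undup_uniq.
have -> : \sum_(p <- s) `|f p| = \sum_(i <- t) \sum_(p <- s | p.1 == i) `|f p|.
  rewrite (exchange_big_dep xpredT) //= big_seq [RHS]big_seq; apply: eq_bigr.
  move=> p ps; rewrite -big_filter.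
  have -> : [seq i <- t | p.1 == i] = [:: p.1]; last by rewrite big_seq1.
  rewrite (eq_filter (a2 := pred1 p.1)) => [|i]; last by rewrite /= eq_sym.
  by rewrite filter_pred1_uniq // mem_undup map_f.
apply: le_trans (NM t ut); apply: ler_sum => i _.
apply: le_trans (ler_norm _).
rewrite (_ : \sum_(p <- s | _) _ =
    \sum_(j <- [seq p.2 | p <- s & p.1 == i]) `|f (i, j)|).
  apply: fN; rewrite map_inj_in_uniq ?filter_uniq //.
  move=> [a b] [c d]; rewrite !mem_filter /= => /andP[/eqP-> _] /andP[/eqP-> _].
  by move=> ->.
by rewrite big_map big_filter; apply: eq_bigr => -[a b] /= /eqP->.
Qed.

(** One half of Fubini: a finite set of rows is thickened to a finite set of pairs whose sum is
    close both to [l] and to the sum of the row sums. *)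
Lemma hsum_pair I J (f : I * J -> R) (g : I -> R) l : hsum f l ->
  (forall i, hsum (fun j => f (i, j)) (g i)) -> hsum g l.
Proof.
move=> hf hg e e0; have e2 : 0 < e / 2 by rewrite divr_gt0.
have [s0 h0] := hf _ e2; exists [seq p.1 | p <- s0] => t ut st.
(* The tolerance is shared equally among the rows of [t]; the successor keeps it positive when [t]
   is empty. *)
pose d := e / 2 / (size t).+1%:R.
have d0 : 0 < d by rewrite divr_gt0.
have /choice[S hS] : forall i, exists si : seq J, [/\ uniq si,
    {subset [seq p.2 | p <- s0 & p.1 == i] <= si} &
    `|\sum_(j <- si) f (i, j) - g i| < d].
  move=> i; have [si hi] := hg i d d0.
  exists (undup (si ++ [seq p.2 | p <- s0 & p.1 == i])); split.
  - exact: undup_uniq.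
  - by move=> j jj; rewrite mem_undup mem_cat jj orbT.
  - apply: hi; first exact: undup_uniq.
    by move=> j jj; rewrite mem_undup mem_cat jj.
pose s := [seq (i, j) | i <- t, j <- S i].
have us : uniq s.
  apply: allpairs_uniq_dep => //; first by move=> i _; have [] := hS i.
  by move=> [a b] [c d'] _ _ /= [-> ->].
have ss : {subset s0 <= s}.
  move=> [i j] ij; apply/allpairsPdep; exists i, j; split => //.
    by apply: st; apply/mapP; exists (i, j).
  have [_ + _] := hS i; apply; apply/mapP; exists (i, j) => //.
  by rewrite mem_filter /= eqxx.
have := h0 s us ss; rewrite big_allpairs_dep /= => h.
set A := \sum_(i <- t) _ in h.
have -> : \sum_(i <- t) g i - l = (A - l) - (A - \sum_(i <- t) g i) by ring.
rewrite (le_lt_trans (ler_normB _ _)) // [ltRHS](splitr e) ltr_leD //.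
rewrite /A -sumrB (le_trans (ler_norm_sum _ _ _)) //.
apply: (@le_trans _ _ (\sum_(i <- t) d)).
  by apply: ler_sum => i _; have [_ _ /ltW] := hS i.
rewrite big_const_seq count_predT iter_addr_0 -[leLHS]mulr_natr /d.
by rewrite [leLHS]mulrAC ler_pdivrMr ?ltr0n // ler_wpM2l ?ler_nat // ltW.
Qed.

Lemma asum_row I J (f : I * J -> R) M i : asum f M ->
  asum (fun j => f (i, j)) M.
Proof.
move=> fM s us; rewrite -(big_map (pair i) xpredT (fun p => `|f p|)).
by apply: fM; rewrite map_inj_uniq // => a b [].
Qed.

(** A row sum is at most the row sum [T i] of the absolute values, and by Fubini the [T i] add up to
    the total of [|f|], itself at most [M]. *)
Lemma asum_abs_tsum I J (f : I * J -> R) M : asum f M ->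
  asum (fun i => tsum (fun j => f (i, j))) M.
Proof.
move=> fM.
have aM : asum (fun p => `|f p|) M.
  by move=> s us; under eq_bigr do rewrite normr_id; exact: fM.
have hT := hsum_pair (asum_hsum aM) (fun i => asum_hsum (asum_row i aM)).
set T := fun i => tsum _ in hT.
have fT i : `|tsum (fun j => f (i, j))| <= T i.
  apply: hsum_le (asum_hsum (asum_row i fM)) => s us.
  apply/ler_addgt0Pl => e e0; have [s1 h1] := asum_hsum (asum_row i aM) e0.
  pose s2 := undup (s ++ s1).
  have us2 : uniq s2 by exact: undup_uniq.
  have : `|\sum_(j <- s2) `|f (i, j)| - T i| < e.
    by apply: h1 => // j jj; rewrite mem_undup mem_cat jj orbT.
  have ss2 : {subset s <= s2} by move=> j jj; rewrite mem_undup mem_cat jj.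
  rewrite (big_uniq_sub (fun j => `|f (i, j)|) us us2 ss2) ltr_norml => /andP[_].
  have : 0 <= \sum_(j <- s2 | j \notin s) `|f (i, j)| by rewrite sumr_ge0.
  set a := \sum_(j <- s2 | _) _; set b := \sum_(j <- s) _; lra.
have TM : `|tsum (fun p => `|f p|)| <= M by apply: hsum_le (asum_hsum aM).
have T0 i : 0 <= T i by apply: le_trans (fT i).
move=> s us; apply/ler_addgt0Pl => e e0; have [s1 h1] := hT e e0.
pose s2 := undup (s ++ s1).
have us2 : uniq s2 by exact: undup_uniq.
have : `|\sum_(j <- s2) T j - tsum (fun p => `|f p|)| < e.
  by apply: h1 => // j jj; rewrite mem_undup mem_cat jj orbT.
have ss2 : {subset s <= s2} by move=> j jj; rewrite mem_undup mem_cat jj.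
rewrite (big_uniq_sub T us us2 ss2) ltr_norml => /andP[_].
have : 0 <= \sum_(j <- s2 | j \notin s) T j by rewrite sumr_ge0.
have : \sum_(j <- s) `|tsum (fun j0 => f (j, j0))| <= \sum_(j <- s) T j.
  by apply: ler_sum.
move: TM; rewrite ler_norml => /andP[_].
set a := \sum_(j <- s2 | _) _; set b := \sum_(j <- s) T _; set c := tsum _.
set d := \sum_(j <- s) _; lra.
Qed.

Lemma hsum_fin (I : finType) (f : I -> R) : hsum f (\sum_i f i).
Proof.
apply: hsum_finite; first exact: index_enum_uniq.
by move=> i; rewrite mem_index_enum.
Qed.

Lemma asum_fin (I : finType) (f : I -> R) : asum f (\sum_i `|f i|).
Proof.
move=> s us; rewrite (big_uniq_sub (fun i => `|f i|) us (index_enum_uniq I)).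
  by rewrite lerDl sumr_ge0.
by move=> i _; rewrite mem_index_enum.
Qed.

(* Summing [fiber e f] over [I] first regroups the terms of [f] by their value
   under [e]. *)
Definition fiber I J (e : I -> J) (f : I -> R) (p : J * I) : R :=
  if e p.2 == p.1 then f p.2 else 0.

Lemma big_fiber I J (e : I -> J) (f : I -> R) (s : seq (J * I)) :
  \sum_(p <- s) fiber e f p = \sum_(i <- [seq p.2 | p <- s & e p.2 == p.1]) f i.
Proof. by rewrite big_map big_filter [LHS]big_mkcond /= [RHS]big_mkcond. Qed.

Lemma uniq_fiber I J (e : I -> J) (s : seq (J * I)) : uniq s ->
  uniq [seq p.2 | p <- s & e p.2 == p.1].
Proof.
move=> us; rewrite map_inj_in_uniq ?filter_uniq //.
move=> [a b] [c d]; rewrite !mem_filter /= => /andP[/eqP<- _] /andP[/eqP<- _].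
by move=> ->.
Qed.

Lemma asum_fiber I J (e : I -> J) (f : I -> R) M : asum f M ->
  asum (fiber e f) M.
Proof.
move=> fM s us; apply: le_trans (fM _ (uniq_fiber e us)).
rewrite -(big_fiber e (fun i => `|f i|)); apply: ler_sum => p _.
by rewrite /fiber; case: ifP => //; rewrite normr0.
Qed.

Lemma hsum_fiber I J (e : I -> J) (f : I -> R) l : hsum f l ->
  hsum (fiber e f) l.
Proof.
move=> fl d d0; have [s0 h0] := fl d d0.
exists [seq (e i, i) | i <- s0] => s us ss.
rewrite big_fiber; apply: h0; first exact: uniq_fiber.
move=> i is0; apply/mapP; exists (e i, i) => //.
by rewrite mem_filter /= eqxx ss //; apply: map_f.
Qed.

End UnorderedSums.

(** * Power series with summable coefficients *)

Section Wiener.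
Context {R : realType}.
Implicit Types (n m : nat).
Local Notation mi n := {ffun 'I_n -> nat}.

Definition polydisc n (r : R) (p x : 'rV[R]_n) : Prop :=
  forall i, `|x 0 i - p 0 i| <= r.

(** For positive [r], this is [r] to the total degree of [al], the largest modulus of the monomial
    on the polydisc of radius [r]. *)
Definition weight n (r : R) (al : mi n) : R := monomial (const_mx r) al.

Lemma weight_gt0 n r (al : mi n) : 0 < r -> 0 < weight r al.
Proof. by move=> r0; apply: prodr_gt0 => i _; rewrite mxE exprn_gt0. Qed.

Lemma norm_monomial_le n r (v : 'rV[R]_n) al : (forall i, `|v 0 i| <= r) ->
  `|monomial v al| <= weight r al.
Proof.
move=> vr; rewrite /monomial normr_prod; apply: ler_prod => i _.
by rewrite mxE normr_ge0 normrX lerXn2r ?nnegrE //; apply: le_trans (vr i).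
Qed.

Lemma monomialD n (v : 'rV[R]_n) (a b : mi n) :
  monomial v [ffun i => (a i + b i)%N] = monomial v a * monomial v b.
Proof. by rewrite -big_split; apply: eq_bigr => i _; rewrite ffunE exprD. Qed.

(* The weighted l^1 norm of the coefficients is submultiplicative and complete,
   so that stability under products, series and composition is formal. *)
Definition wiener n (r : R) (p : 'rV[R]_n) (f : 'rV[R]_n -> R) (M : R) : Prop :=
  exists a : mi n -> R, asum (fun al => a al * weight r al) M /\
  forall x, polydisc r p x -> hsum (fun al => a al * monomial (x - p) al) (f x).

Lemma polydisc_sub n r (p x : 'rV[R]_n) : polydisc r p x ->
  forall i, `|(x - p) 0 i| <= r.
Proof. by move=> h i; rewrite !mxE. Qed.

(** The exponents [e i] may repeat. Collecting equal ones by [fiber] produces genuine coefficients,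
    so sums, products and compositions only need a summable family of monomials over some index
    type. *)
Lemma wiener_family n r (p : 'rV[R]_n) f M (I : eqType) (c : I -> R)
    (e : I -> mi n) : 0 < r ->
  asum (fun i => c i * weight r (e i)) M ->
  (forall x, polydisc r p x ->
    hsum (fun i => c i * monomial (x - p) (e i)) (f x)) ->
  wiener r p f M.
Proof.
move=> r0 cM hf; pose F i := c i * weight r (e i).
(* Summability is known for the weighted terms, so these are summed over a fibre and the weight,
   constant there, is divided out. *)
pose b al := tsum (fun i => fiber e F (al, i)) / weight r al.
have FM := asum_fiber e cM.
exists b; split.
  apply: asum_le (asum_abs_tsum FM) => al.
  by rewrite /b mulfVK // gt_eqF // weight_gt0.
move=> x px; apply: hsum_pair (hsum_fiber e (hf x px)) _ => al.
have := hsumZ (monomial (x - p) al / weight r al) (asum_hsum (asum_row al FM)).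
congr hsum; last by rewrite /b mulrC mulrA mulrAC.
apply/funext => i; rewrite /fiber /=; case: eqP => [E|]; last by rewrite mulr0.
by rewrite /F E; field; rewrite gt_eqF // weight_gt0.
Qed.

Lemma wiener_ge0 n r (p : 'rV[R]_n) f M : wiener r p f M -> 0 <= M.
Proof. by case=> a [/asum_ge0]. Qed.

Lemma wiener_bound n r (p : 'rV[R]_n) f M x : wiener r p f M ->
  polydisc r p x -> `|f x| <= M.
Proof.
move=> [a [aM hf]] px; apply: hsum_le (hf x px); apply: asum_le aM => al.
rewrite !normrM ler_wpM2l //.
by apply: le_trans (ler_norm _); apply/norm_monomial_le/polydisc_sub.
Qed.

Lemma wiener_ext n r (p : 'rV[R]_n) f g M :
  (forall x, polydisc r p x -> f x = g x) -> wiener r p f M -> wiener r p g M.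
Proof. by move=> fg [a [aM hf]]; exists a; split=> // x px; rewrite -fg //; exact: hf. Qed.

Lemma wiener_leM n r (p : 'rV[R]_n) f M N : M <= N ->
  wiener r p f M -> wiener r p f N.
Proof. by move=> MN [a [aM hf]]; exists a; split=> //; apply: asum_leM MN aM. Qed.

(** Completeness of the norm: the coefficients of all the [f i] form one summable family indexed by
    pairs. *)
Lemma wiener_sum n r (p : 'rV[R]_n) (I : eqType) (f : I -> 'rV[R]_n -> R) F
    (N : I -> R) M : 0 < r ->
  (forall i, wiener r p (f i) (N i)) -> asum N M ->
  (forall x, polydisc r p x -> hsum (fun i => f i x) (F x)) ->
  wiener r p F M.
Proof.
move=> r0 /choice[a ha] NM hF.
apply: (@wiener_family _ _ _ _ _ _ (fun q => a q.1 q.2) snd) => //.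
  by apply: asum_pair NM => i; have [] := ha i.
move=> x px; set G := fun _ => _.
have GM : asum G M.
  apply: asum_pair NM => i; have [aN _] := ha i; apply: asum_le aN => al.
  rewrite /G !normrM ler_wpM2l //.
  by apply: le_trans (ler_norm _); apply/norm_monomial_le/polydisc_sub.
have hG := asum_hsum GM.
rewrite -(hsum_uniq (hsum_pair hG (fun i => (ha i).2 x px)) (hF x px)).
exact: hG.
Qed.

Lemma wiener_monomial n r (p : 'rV[R]_n) c al : 0 < r ->
  wiener r p (fun x => c * monomial (x - p) al) (`|c| * weight r al).
Proof.
move=> r0; apply: (@wiener_family _ _ _ _ _ _ (fun=> c) (fun _ : 'I_1 => al)) => //.
  have := asum_fin (fun _ : 'I_1 => c * weight r al).
  by rewrite big_ord1 normrM (gtr0_norm (weight_gt0 _ r0)).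
by move=> x _; have := hsum_fin (fun _ : 'I_1 => c * monomial (x - p) al); rewrite big_ord1.
Qed.

Lemma wiener_cst n r (p : 'rV[R]_n) c : 0 < r -> wiener r p (fun=> c) `|c|.
Proof.
move=> r0; have m1 (v : 'rV[R]_n) : monomial v [ffun=> 0%N] = 1.
  by rewrite /monomial big1 // => i _; rewrite ffunE expr0.
have := wiener_monomial p c [ffun=> 0%N] r0.
rewrite /weight m1 mulr1; apply: wiener_ext => x _.
by rewrite m1 mulr1.
Qed.

Lemma wiener_coord n r (p : 'rV[R]_n) i : 0 < r ->
  wiener r p (fun x => x 0 i - p 0 i) r.
Proof.
move=> r0; have m1 (v : 'rV[R]_n) : monomial v [ffun j => nat_of_bool (j == i)] = v 0 i.
  rewrite /monomial (bigD1 i) //= ffunE eqxx big1 ?mulr1 // => j /negbTE ji.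
  by rewrite ffunE ji expr0.
have := wiener_monomial p 1 [ffun j => nat_of_bool (j == i)] r0.
rewrite /weight m1 mxE normr1 mul1r; apply: wiener_ext => x _.
by rewrite m1 mul1r !mxE.
Qed.

Lemma wienerD n r (p : 'rV[R]_n) f g M N : 0 < r -> wiener r p f M ->
  wiener r p g N -> wiener r p (fun x => f x + g x) (M + N).
Proof.
move=> r0 hf hg; have M0 := wiener_ge0 hf; have N0 := wiener_ge0 hg.
have bigb (F : bool -> R) : \sum_b F b = F true + F false by rewrite big_bool.
apply: (@wiener_sum _ _ _ _ (fun b : bool => if b then f else g) _
  (fun b : bool => if b then M else N)) => //.
- by case.
- have := asum_fin (fun b : bool => if b then M else N).
  by rewrite bigb !ger0_norm.
- move=> x px; have := hsum_fin (fun b : bool => (if b then f else g) x).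
  by rewrite bigb.
Qed.

Lemma wienerZ n r (p : 'rV[R]_n) c f M : wiener r p f M ->
  wiener r p (fun x => c * f x) (`|c| * M).
Proof.
move=> [a [aM hf]]; exists (fun al => c * a al); split.
  by have := asumZ c aM; congr asum; apply/funext => al; rewrite mulrA.
move=> x px; have := hsumZ c (hf x px).
by congr hsum; apply/funext => al; rewrite mulrA.
Qed.

Lemma wiener_monomialM n r (p : 'rV[R]_n) al f M : 0 < r -> wiener r p f M ->
  wiener r p (fun x => monomial (x - p) al * f x) (weight r al * M).
Proof.
move=> r0 [a [aM hf]].
apply: (@wiener_family _ _ _ _ _ _ a (fun be => [ffun i => (al i + be i)%N])) => //.
  have := asumZ (weight r al) aM.
  rewrite gtr0_norm ?weight_gt0 //; congr asum; apply/funext => be.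
  by rewrite /weight monomialD mulrCA.
move=> x px; have := hsumZ (monomial (x - p) al) (hf x px).
by congr hsum; apply/funext => be; rewrite monomialD mulrCA.
Qed.

(** Submultiplicativity: [f] is expanded into monomials, and multiplying [g] by a monomial merely
    shifts its exponents. *)
Lemma wienerM n r (p : 'rV[R]_n) f g M N : 0 < r -> wiener r p f M ->
  wiener r p g N -> wiener r p (fun x => f x * g x) (M * N).
Proof.
move=> r0 [a [aM hf]] hg.
apply: (@wiener_sum _ _ _ _ (fun al x => a al * (monomial (x - p) al * g x)) _
  (fun al => `|a al| * (weight r al * N))) => //.
- by move=> al; apply: wienerZ; exact: wiener_monomialM.
- have := asumZ N aM; rewrite mulrC ger0_norm ?(wiener_ge0 hg) //.
  apply: asum_le => al; rewrite !normrM normr_id.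
  by rewrite [X in _ <= X]mulrC mulrA.
- move=> x px; have := hsumZ (g x) (hf x px); rewrite mulrC; congr hsum.
  by apply/funext => al; rewrite mulrC mulrA.
Qed.

Lemma wienerX n r (p : 'rV[R]_n) f M k : 0 < r -> wiener r p f M ->
  wiener r p (fun x => f x ^+ k) (M ^+ k).
Proof.
move=> r0 hf; elim: k => [|k IH].
  by have := wiener_cst p 1 r0; rewrite normr1.
rewrite exprS; apply: wiener_ext (wienerM r0 hf IH) => x _.
by rewrite exprS.
Qed.

Lemma wiener_prod n r (p : 'rV[R]_n) (I : Type) (s : seq I)
    (f : I -> 'rV[R]_n -> R) (M : I -> R) : 0 < r ->
  (forall i, wiener r p (f i) (M i)) ->
  wiener r p (fun x => \prod_(i <- s) f i x) (\prod_(i <- s) M i).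
Proof.
move=> r0 hf; elim: s => [|i s IH].
  rewrite big_nil; have := wiener_cst p 1 r0; rewrite normr1.
  by apply: wiener_ext => x _; rewrite big_nil.
rewrite big_cons; apply: wiener_ext (wienerM r0 (hf i) IH) => x _.
by rewrite big_cons.
Qed.

(** Each monomial of [f] becomes a product of powers of the components of [g], of norm at most the
    weight of that monomial because [N i <= r]; the resulting series of functions converges in
    norm. *)
Lemma wiener_comp n m r r' (p : 'rV[R]_n) (q : 'rV[R]_m) f
    (g : 'rV[R]_m -> 'rV[R]_n) M (N : 'I_n -> R) : 0 < r' -> wiener r p f M ->
  (forall i, wiener r' q (fun y => g y 0 i - p 0 i) (N i)) ->
  (forall i, N i <= r) -> wiener r' q (f \o g) M.
Proof.
move=> r'0 [a [aM hf]] hg Nr.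
have N0 i : 0 <= N i := wiener_ge0 (hg i).
apply: (@wiener_sum _ _ _ _
  (fun al y => a al * \prod_i (g y 0 i - p 0 i) ^+ al i) _
  (fun al => `|a al| * \prod_i N i ^+ al i)) => //.
- move=> al; apply: wienerZ; apply: wiener_prod => // i.
  exact: wienerX.
- apply: asum_le aM => al; rewrite !normrM normr_id ler_wpM2l //.
  rewrite ger0_norm ?prodr_ge0 // => [|i _]; last exact: exprn_ge0.
  apply: le_trans (ler_norm _); apply: ler_prod => i _.
  rewrite mxE exprn_ge0 // lerXn2r // nnegrE //.
  exact: le_trans (Nr i).
- move=> y qy; have pg : polydisc r p (g y).
    by move=> i; apply: le_trans (Nr i); exact: wiener_bound (hg i) qy.
  have := hf _ pg; congr hsum; apply/funext => al.
  by congr (_ * _); apply: eq_bigr => i _; rewrite !mxE.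
Qed.

(** Once the constant term is removed all degrees are at least 1, and a term of degree [j] has its
    weight multiplied by [k ^+ j <= k]. *)
Lemma wiener_shrink n r (p : 'rV[R]_n) f M k : 0 < r -> 0 < k <= 1 ->
  wiener r p f M -> wiener (k * r) p (fun x => f x - f p) (k * M).
Proof.
move=> r0 /andP[k0 k1] [a [aM hf]].
pose z : mi n := [ffun=> 0%N].
have kwt al : weight (k * r) al = k ^+ (\sum_i al i) * weight r al.
  rewrite /weight /monomial -prodrXr -big_split; apply: eq_bigr => i _.
  by rewrite !mxE exprMn.
have nz al : al != z -> (0 < \sum_i al i)%N.
  apply: contraNT; rewrite -leqNgt leqn0 sum_nat_eq0 => /forallP h.
  by apply/eqP/ffunP => i; rewrite ffunE; exact/eqP/(h i).
have mz : monomial (p - p) z = 1.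
  by rewrite /monomial big1 // => i _; rewrite ffunE expr0.
have mnz al : al != z -> monomial (p - p) al = 0.
  move=> /nz; rewrite lt0n sum_nat_eq0 negb_forall => /existsP[i /= hi].
  by rewrite /monomial (bigD1 i) //= !mxE subrr expr0n (negbTE hi) mul0r.
have fp : f p = a z.
  have pp : polydisc r p p by move=> i; rewrite subrr normr0 ltW.
  apply: hsum_uniq (hf p pp) _.
  have := @hsum_finite _ _ (fun al => a al * monomial (p - p) al) [:: z] isT.
  rewrite big_seq1 mz mulr1; apply=> al; rewrite mem_seq1 => /mnz->.
  by rewrite mulr0.
exists (fun al => if al == z then 0 else a al); split.
  have := asumZ k aM; rewrite gtr0_norm //; apply: asum_le => al.
  case: eqP => [_|/eqP/nz h]; first by rewrite mul0r normr0.
  rewrite kwt mulrCA !normrM ler_wpM2r ?mulr_ge0 //.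
  rewrite !ger0_norm ?exprn_ge0 ?(ltW k0) //.
  by case: (\sum_i al i)%N h => // j _; rewrite exprS ler_piMr ?exprn_ile1 // ltW.
move=> x px; have px' : polydisc r p x.
  by move=> i; apply: le_trans (px i) _; rewrite ler_piMl // ltW.
have h1 := hf x px'.
have h2 := @hsum_finite _ _ (fun al => if al == z then a z else 0) [:: z] isT.
rewrite big_seq1 eqxx in h2.
have {}h2 : hsum (fun al => if al == z then a z else 0) (a z).
  by apply: h2 => al; rewrite mem_seq1 => /negbTE->.
have := hsumD h1 (hsumZ (-1) h2); rewrite mulN1r fp; congr hsum.
apply/funext => al; case: eqP => [->|_]; last by rewrite mulr0 addr0.
rewrite mul0r {1}/monomial big1 => [|i _]; last by rewrite ffunE expr0.
by rewrite mulr1 mulN1r subrr.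
Qed.

End Wiener.

(** * Analytic functions *)

Section Analytic.
Context {R : realType}.
Implicit Types (n m : nat).
Local Notation mi n := {ffun 'I_n -> nat}.

Definition box n (N : nat) : seq (mi n) :=
  [seq [ffun i => nat_of_ord (al i)] | al : {ffun 'I_n -> 'I_N}].

Lemma uniq_box n N : uniq (box n N).
Proof.
rewrite map_inj_uniq ?enum_uniq // => a b /ffunP ab.
by apply/ffunP => i; apply: val_inj; have := ab i; rewrite !ffunE.
Qed.

Lemma mem_box n N (al : mi n) : (forall i, al i < N)%N -> al \in box n N.
Proof.
move=> h; apply/mapP; exists [ffun i => Ordinal (h i)]; rewrite ?mem_enum //.
by apply/ffunP => i; rewrite !ffunE.
Qed.

Lemma box_sumE n (g : mi n -> R) N : box_sum g N = \sum_(al <- box n N) g al.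
Proof. by rewrite big_map big_enum. Qed.

Lemma le_bigmax_mem (I : eqType) (s : seq I) (F : I -> nat) i : i \in s ->
  (F i <= \max_(j <- s) F j)%N.
Proof. by move=> si; apply: leq_bigmax_seq. Qed.

Lemma sub_box n (s : seq (mi n)) :
  exists N0, forall N, (N0 <= N)%N -> {subset s <= box n N}.
Proof.
exists (\max_(al <- s) \max_i (al i)).+1 => N N0 al als; apply: mem_box => i.
apply: leq_trans N0; rewrite ltnS.
apply: leq_trans (le_bigmax_mem (fun al : mi n => \max_i al i)%N als).
exact: leq_bigmax.
Qed.

Lemma hsum_box n (g : mi n -> R) l : hsum g l -> box_sum g @ \oo --> l.
Proof.
move=> h; apply/cvgrPdist_lt => e e0; have [s0 h0] := h e e0.
have [N0 hN] := sub_box s0.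
exists N0 => // N /= N0N; rewrite distrC box_sumE.
by apply: h0; [exact: uniq_box|exact: hN].
Qed.

(** Large boxes contain any given finite set of multi-indices, so the finite sums stay below the
    limit of the box sums. *)
Lemma cvg_box_asum n (g : mi n -> R) : cvgn (box_sum (fun al => `|g al|)) ->
  asum g (limn (box_sum (fun al => `|g al|))).
Proof.
move=> cg s us; have [N0 hN] := sub_box s.
apply: limr_ge cg _; exists N0 => // N /= N0N.
rewrite box_sumE (big_uniq_sub _ us (uniq_box n N) (hN N N0N)) lerDl.
by rewrite sumr_ge0.
Qed.

Lemma near_polydisc n (p : 'rV[R]_n) (P : 'rV[R]_n -> Prop) :
  (\forall x \near p, P x) <-> exists2 r, 0 < r & forall x, polydisc r p x -> P x.
Proof.
split.
  move=> /nbhs_ballP[e /= e0 h]; exists (e / 2); first by rewrite divr_gt0.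
  move=> x px; apply: h; split => // i j; rewrite ord1 /ball /= distrC.
  by rewrite (le_lt_trans (px j)) // ltr_pdivrMr // mulr_natr mulr2n ltrDl.
move=> [r r0 h]; apply/nbhs_ballP; exists r => //= x [_ px]; apply: h => i.
by have := px 0 i; rewrite /ball /= distrC => /ltW.
Qed.

Lemma wiener_radius n r r' (p : 'rV[R]_n) f M : 0 < r' <= r ->
  wiener r p f M -> wiener r' p f M.
Proof.
move=> /andP[r'0 r'r] [a [aM hf]]; exists a; split.
  apply: asum_le aM => al; rewrite !normrM ler_wpM2l //.
  have h : forall i, `|(const_mx r' : 'rV[R]_n) 0 i| <= r.
    by move=> i; rewrite mxE ger0_norm // ltW.
  by apply: le_trans (ler_norm _); exact: (norm_monomial_le al h).
by move=> x px; apply: hf => i; exact: le_trans (px i) r'r.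
Qed.

(** At the corner [p + const_mx (r / 2)] the monomials are exactly the weights of radius [r / 2], so
    convergence at this single point bounds the coefficients. Conversely, every finite set lies in a
    box, so an unordered sum is a limit of box sums. *)
Lemma analytic_wiener n f (p : 'rV[R]_n) :
  analytic_at f p <-> exists r M, 0 < r /\ wiener r p f M.
Proof.
split.
  move=> [a [r [r0 h]]].
  have r2 : 0 < r / 2 by rewrite divr_gt0.
  have r2r : r / 2 < r by rewrite ltr_pdivrMr // mulr_natr mulr2n ltrDl.
  have px : forall i, `|(p + const_mx (r / 2)) 0 i - p 0 i| < r.
    by move=> i; rewrite !mxE addrAC subrr add0r gtr0_norm.
  have [ca _] := h _ px; have aM := cvg_box_asum ca.
  exists (r / 2); eexists; split => //; exists a; split.
    by rewrite addrAC subrr add0r in aM; exact: aM.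
  move=> x pr.
  have /h[cx hx] : forall i, `|x 0 i - p 0 i| < r.
    by move=> i; exact: le_lt_trans (pr i) r2r.
  have hs := asum_hsum (cvg_box_asum cx).
  by rewrite -(cvg_unique _ (hsum_box hs) hx).
move=> [r [M [r0 [a [aM hf]]]]]; exists a, r; split => // x px.
have px' : polydisc r p x by move=> i; exact: ltW.
split; last exact/hsum_box/hf.
apply/cvg_ex; eexists; apply/hsum_box/(@asum_hsum _ _ _ M) => s us.
apply: le_trans (aM s us); apply: ler_sum => al _.
rewrite normr_id !normrM ler_wpM2l //.
by apply: le_trans (ler_norm _); apply/norm_monomial_le/polydisc_sub.
Qed.

Lemma analytic_near_eq n f g (p : 'rV[R]_n) :
  (\forall x \near p, f x = g x) -> analytic_at f p -> analytic_at g p.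
Proof.
move=> /near_polydisc[r r0 fg] /analytic_wiener[r' [M [r'0 hf]]].
apply/analytic_wiener; exists (Num.min r r'), M.
have m0 : 0 < Num.min r r' by rewrite lt_min r0.
split=> //; apply: (@wiener_ext _ _ _ _ f) => [x px|].
  by apply: fg => i; rewrite (le_trans (px i)) // ge_min lexx.
by apply: wiener_radius hf; rewrite m0 ge_min lexx orbT.
Qed.

(** Shrinking the polydisc by a factor [k] brings in a factor [k] in the norm of [f - f p].
    Smallness in norm, rather than pointwise, is what composition and inversion require. *)
Lemma analytic_small n f (p : 'rV[R]_n) e : analytic_at f p -> 0 < e ->
  exists2 r, 0 < r & forall r', 0 < r' <= r ->
    wiener r' p (fun x => f x - f p) e.
Proof.
move=> /analytic_wiener[r [M [r0 hf]]] e0; have M0 := wiener_ge0 hf.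
pose k := Num.min 1 (e / (M + 1)).
have M1 : 0 < M + 1 by lra.
have k0 : 0 < k by rewrite lt_min ltr01 divr_gt0.
have k1 : 0 < k <= 1 by rewrite k0 ge_min lexx.
exists (k * r); first exact: mulr_gt0.
move=> r' /wiener_radius; apply; apply: wiener_leM (wiener_shrink r0 k1 hf).
apply: (@le_trans _ _ (e / (M + 1) * M)).
  by rewrite ler_wpM2r // ge_min lexx orbT.
by rewrite mulrAC ler_pdivrMr // ler_wpM2l ?(ltW e0) //; lra.
Qed.

Lemma analytic_continuous n f (p : 'rV[R]_n) : analytic_at f p ->
  {for p, continuous f}.
Proof.
move=> hf; apply/(@cvgrPdist_le _ _ _ (nbhs p) (nbhs_filter p)) => e e0.
have [r r0 h] := analytic_small hf e0.
apply/near_polydisc; exists r => // x px; rewrite distrC.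
by apply: wiener_bound (h r _) px; rewrite r0 lexx.
Qed.

(** Recentring is composition with the identity: seen from [q], the increments differ from those at
    [p] by a constant, for which half of the radius is reserved. *)
Lemma analytic_near n f (p : 'rV[R]_n) : analytic_at f p ->
  \forall q \near p, analytic_at f q.
Proof.
move=> /analytic_wiener[r [M [r0 hf]]].
have r2 : 0 < r / 2 by rewrite divr_gt0.
apply/near_polydisc; exists (r / 2) => // q pq.
apply/analytic_wiener; exists (r / 2), M; split=> //.
apply: (@wiener_comp _ _ _ _ _ _ _ _ id _ (fun i => r / 2 + `|q 0 i - p 0 i|)) hf _ _ => //.
  move=> i; apply: wiener_ext (wienerD r2 (wiener_coord q i r2) (wiener_cst q (q 0 i - p 0 i) r2)).
  by move=> x _ /=; ring.
by move=> i; rewrite [leRHS](splitr r) lerD2l; exact: pq.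
Qed.

(** The radius is so small that every component of [g] varies, in norm, by at most the radius [r] of
    [f]. *)
Lemma analytic_comp n m f (g : 'rV[R]_m -> 'rV[R]_n) q :
  analytic_at f (g q) -> vanalytic_at g q -> analytic_at (fun y => f (g y)) q.
Proof.
move=> /analytic_wiener[r [M [r0 hf]]] hg.
have /choice[d hd] : forall i, exists d, 0 < d /\ forall r', 0 < r' <= d ->
    wiener r' q (fun y => g y 0 i - g q 0 i) r.
  by move=> i; have [d d0 h] := analytic_small (hg i) r0; exists d.
pose r' := \big[Order.min/1]_i d i.
have r'0 : 0 < r' by apply: lt_bigmin => // i _; exact: (hd i).1.
apply/analytic_wiener; exists r', M; split=> //.
apply: (@wiener_comp _ _ _ _ _ _ _ _ g _ (fun=> r)) hf _ _ => // i.
by apply: (hd i).2; rewrite r'0 /r' bigmin_le_cond.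
Qed.

Lemma analytic_cst n c (p : 'rV[R]_n) : analytic_at (fun=> c) p.
Proof. by apply/analytic_wiener; exists 1, `|c|; split => //; exact: wiener_cst. Qed.

Lemma analytic_coord n i (p : 'rV[R]_n) : analytic_at (fun x => x 0 i) p.
Proof.
apply/analytic_wiener; exists 1, (1 + `|p 0 i|); split => //.
apply: wiener_ext (wienerD ltr01 (wiener_coord p i ltr01) (wiener_cst p (p 0 i) ltr01)).
by move=> x _; ring.
Qed.

Lemma analytic_wiener2 n f g (p : 'rV[R]_n) : analytic_at f p -> analytic_at g p ->
  exists r M N, [/\ 0 < r, wiener r p f M & wiener r p g N].
Proof.
move=> /analytic_wiener[r [M [r0 hf]]] /analytic_wiener[s [N [s0 hg]]].
have m0 : 0 < Num.min r s by rewrite lt_min r0.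
exists (Num.min r s), M, N; split=> //.
  by apply: wiener_radius hf; rewrite m0 ge_min lexx.
by apply: wiener_radius hg; rewrite m0 ge_min lexx orbT.
Qed.

Lemma analyticD n f g (p : 'rV[R]_n) : analytic_at f p -> analytic_at g p ->
  analytic_at (fun x => f x + g x) p.
Proof.
move=> hf hg; have [r [M [N [r0 wf wg]]]] := analytic_wiener2 hf hg.
by apply/analytic_wiener; exists r, (M + N); split=> //; exact: wienerD.
Qed.

Lemma analyticM n f g (p : 'rV[R]_n) : analytic_at f p -> analytic_at g p ->
  analytic_at (fun x => f x * g x) p.
Proof.
move=> hf hg; have [r [M [N [r0 wf wg]]]] := analytic_wiener2 hf hg.
by apply/analytic_wiener; exists r, (M * N); split=> //; exact: wienerM.
Qed.

Lemma analyticN n f (p : 'rV[R]_n) : analytic_at f p ->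
  analytic_at (fun x => - f x) p.
Proof.
move=> hf; have := analyticM (analytic_cst (-1) p) hf.
by apply: analytic_near_eq; near=> x; rewrite mulN1r.
Unshelve. all: by end_near. Qed.

Lemma analyticB n f g (p : 'rV[R]_n) : analytic_at f p -> analytic_at g p ->
  analytic_at (fun x => f x - g x) p.
Proof. by move=> hf hg; exact: analyticD hf (analyticN hg). Qed.

Lemma analyticX n f k (p : 'rV[R]_n) : analytic_at f p ->
  analytic_at (fun x => f x ^+ k) p.
Proof.
move=> /analytic_wiener[r [M [r0 hf]]]; apply/analytic_wiener.
by exists r, (M ^+ k); split=> //; exact: wienerX.
Qed.

Lemma analytic_sum n (I : Type) (s : seq I) (f : I -> 'rV[R]_n -> R) p :
  (forall i, analytic_at (f i) p) ->
  analytic_at (fun x => \sum_(i <- s) f i x) p.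
Proof.
move=> hf; elim: s => [|i s IH].
  by have := analytic_cst 0 p; congr analytic_at; apply/funext => x; rewrite big_nil.
have := analyticD (hf i) IH; congr analytic_at.
by apply/funext => x; rewrite big_cons.
Qed.

Lemma series_geometric_half : series (geometric (1 : R) 2^-1) @ \oo --> (2 : R).
Proof.
have h : `|2^-1 : R| < 1 by rewrite ger0_norm // invf_lt1 // ltr1n.
have := @cvg_geometric_series R 1 2^-1 h; rewrite mul1r.
by have -> : (1 - 2^-1)^-1 = 2 :> R by field.
Qed.

Lemma asum_geometric (c : R) : asum (fun k : nat => c * (2^-1) ^+ k) (`|c| * 2).
Proof.
apply: asumZ => s us.
pose N := (\max_(k <- s) k).+1.
have sN : {subset s <= index_iota 0 N}.
  move=> k ks; rewrite mem_index_iota ltnS.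
  exact: (le_bigmax_mem id ks).
have uN : uniq (index_iota 0 N) by exact: iota_uniq.
have h : \sum_(k <- s) `|(2^-1 : R) ^+ k| <= series (geometric (1 : R) 2^-1) N.
  have -> : series (geometric (1 : R) 2^-1) N =
      \sum_(k <- index_iota 0 N) `|(2^-1 : R) ^+ k|.
    by apply: eq_bigr => k _; rewrite /geometric /= mul1r ger0_norm // exprn_ge0.
  by rewrite (big_uniq_sub _ us uN sN) lerDl sumr_ge0.
apply: le_trans h _.
have nd : nondecreasing_seq (series (geometric (1 : R) 2^-1)).
  by apply: nondecreasing_series => k _ _; rewrite /geometric /= mul1r exprn_ge0.
have := nondecreasing_cvgn_le nd (cvgP _ series_geometric_half) N.
by rewrite (cvg_lim _ series_geometric_half).
Qed.

Lemma hsum_series (f : nat -> R) l : hsum f l -> series f @ \oo --> l.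
Proof.
move=> h; apply/cvgrPdist_lt => e e0; have [s0 h0] := h e e0.
exists (\max_(k <- s0) k).+1 => // N /= hN; rewrite distrC.
apply: h0 => [|k ks]; first exact: iota_uniq.
rewrite mem_index_iota; apply: leq_trans hN; rewrite ltnS.
exact: (le_bigmax_mem id ks).
Qed.

Lemma hsum_geometric (z : R) : `|z| < 1 -> (exists M, asum (fun k : nat => z ^+ k) M) ->
  hsum (fun k : nat => z ^+ k) (1 - z)^-1.
Proof.
move=> z1 [M /asum_hsum h].
have c1 : series (geometric (1 : R) z) @ \oo --> tsum (fun k : nat => z ^+ k).
  have -> : geometric (1 : R) z = (fun k : nat => z ^+ k).
    by apply/funext => k; rewrite /geometric /= mul1r.
  exact: hsum_series.
have c2 := @cvg_geometric_series R 1 z z1; rewrite mul1r in c2.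
by rewrite -(cvg_unique _ c1 c2).
Qed.

(** With [c = f p], the inverse is [c^-1] times the geometric series in [z = - (f x - c) / c], whose
    norm is at most 1/2 on a small polydisc. *)
Lemma analyticV n f (p : 'rV[R]_n) : analytic_at f p -> f p != 0 ->
  analytic_at (fun x => (f x)^-1) p.
Proof.
move=> hf fp0; set c := f p in fp0.
have c0 : 0 < `|c| / 2 by rewrite divr_gt0 // normr_gt0.
have [r r0 h] := analytic_small hf c0.
have {h} := h r; rewrite r0 lexx => /(_ isT) h.
have hz : wiener r p (fun x => - c^-1 * (f x - c)) (2^-1).
  have := wienerZ (- c^-1) h; rewrite normrN normfV.
  suff -> : `|c|^-1 * (`|c| / 2) = 2^-1 by [].
  by rewrite mulrA mulVf ?normr_eq0 // mul1r.
apply/analytic_wiener; exists r, (`|c^-1| * 2); split => //.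
apply: (@wiener_sum _ _ _ _ _ (fun k x => c^-1 * (- c^-1 * (f x - c)) ^+ k) _
  (fun k => `|c^-1| * 2^-1 ^+ k)) => //.
- by move=> k; apply: wienerZ; exact: wienerX.
- by have := asum_geometric `|c^-1|; rewrite normr_id.
move=> x px; have zx := wiener_bound hz px; set z := - c^-1 * _ in zx.
have -> : (f x)^-1 = c^-1 * (1 - z)^-1.
  by rewrite -invfM; congr (_^-1); rewrite /z; field.
apply: hsumZ; apply: hsum_geometric.
  by apply: le_lt_trans zx _; rewrite invf_lt1 // ltr1n.
exists (`|1| * 2); apply: asum_le (asum_geometric 1) => k.
rewrite mul1r !normrX lerXn2r ?nnegrE //.
by rewrite [leRHS]ger0_norm.
Qed.

End Analytic.

(** * Divided differences and parity splitting of power series *)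

Section Calculus.
Context {R : realType}.
Implicit Types (n m : nat).
Local Notation mi n := {ffun 'I_n -> nat}.

Lemma le_mx_norm m n (A : 'M[R]_(m, n)) i j : `|A i j| <= `|A|.
Proof.
by rewrite [leRHS]/Num.Def.normr/= mx_normrE; exact: (le_bigmax _ _ (i, j)).
Qed.

Lemma mx_norm_le m n (A : 'M[R]_(m, n)) e : 0 <= e ->
  (forall i j, `|A i j| <= e) -> `|A| <= e.
Proof.
by move=> e0 h; rewrite /Num.Def.normr/= mx_normrE (bigmax_le _ e0) => // -[i j] _ /=.
Qed.

Lemma cvg_mx (T : Type) (F : set_system T) (FF : Filter F) m n
    (f : T -> 'M[R]_(m, n)) (l : 'M[R]_(m, n)) :
  (forall i j, f x i j @[x --> F] --> l i j) -> f @ F --> l.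
Proof.
move=> h; apply/cvgrPdist_le => e e0.
have : \forall x \near F, forall ij : 'I_m * 'I_n, `|l ij.1 ij.2 - f x ij.1 ij.2| <= e.
  by apply: filter_forall => ij; exact: ((cvgrPdist_le _ _).1 (h _ _)).
apply: filterS => x hx; apply: mx_norm_le (ltW e0) _ => i j.
by rewrite !mxE; exact: (hx (i, j)).
Qed.

Lemma vanalytic_continuous n m (f : 'rV[R]_n -> 'rV[R]_m) p :
  vanalytic_at f p -> {for p, continuous f}.
Proof.
move=> hf; apply: (@cvg_mx _ (nbhs p) (nbhs_filter p)) => i j.
by rewrite ord1; exact: analytic_continuous (hf j).
Qed.

Lemma vanalytic_comp n m k (f : 'rV[R]_n -> 'rV[R]_k) (g : 'rV[R]_m -> 'rV[R]_n) q :
  vanalytic_at f (g q) -> vanalytic_at g q -> vanalytic_at (fun y => f (g y)) q.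
Proof. by move=> hf hg j; exact: analytic_comp (hf j) hg. Qed.

Lemma vanalytic_near_eq n m (f g : 'rV[R]_n -> 'rV[R]_m) p :
  (\forall x \near p, f x = g x) -> vanalytic_at f p -> vanalytic_at g p.
Proof.
by move=> fg hf j; apply: analytic_near_eq (hf j); near=> x; rewrite (near fg x).
Unshelve. all: by end_near. Qed.

Lemma vanalytic_near n m (f : 'rV[R]_n -> 'rV[R]_m) p : vanalytic_at f p ->
  \forall q \near p, vanalytic_at f q.
Proof. move=> hf; apply: (@filter_forall _ _ (fun j q => analytic_at (fun x => f x 0 j) q)
  (nbhs p)) => j; exact: analytic_near (hf j). Qed.

Lemma vanalyticD n m (f g : 'rV[R]_n -> 'rV[R]_m) p : vanalytic_at f p ->
  vanalytic_at g p -> vanalytic_at (fun x => f x + g x) p.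
Proof.
move=> hf hg j; have := analyticD (hf j) (hg j); congr analytic_at.
by apply/funext => x; rewrite mxE.
Qed.

Lemma vanalyticZ n m (a : 'rV[R]_n -> R) (f : 'rV[R]_n -> 'rV[R]_m) p :
  analytic_at a p -> vanalytic_at f p -> vanalytic_at (fun x => a x *: f x) p.
Proof.
move=> ha hf j; have := analyticM ha (hf j); congr analytic_at.
by apply/funext => x; rewrite mxE.
Qed.

Definition setc n (x : 'rV[R]_n) (k : 'I_n) (c : R) : 'rV[R]_n :=
  \row_i if i == k then c else x 0 i.

Lemma setc_id n (x : 'rV[R]_n) k : setc x k (x 0 k) = x.
Proof. by apply/rowP => i; rewrite mxE; case: eqP => [->|]. Qed.

Lemma setc_setc n (v : 'rV[R]_n) k a b :
  setc (setc v k a) k b = setc v k b.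
Proof. by apply/rowP => i; rewrite !mxE; case: eqP. Qed.

Lemma setc2E (v : 'rV[R]_3) s :
  setc v 2 s = row_of [:: v 0 0; v 0 1; s].
Proof.
apply/rowP => -[[|[|[|//]]] h]; rewrite !mxE //=; congr (v 0 _); exact/val_inj.
Qed.

Lemma vanalytic_setc n k (c : 'rV[R]_n -> R) p : analytic_at c p ->
  vanalytic_at (fun x => setc x k (c x)) p.
Proof.
move=> hc j; have [jk|/negbTE jk] := eqVneq j k.
  by have := hc; congr analytic_at; apply/funext => x; rewrite mxE jk eqxx.
by have := analytic_coord j p; congr analytic_at; apply/funext => x; rewrite mxE jk.
Qed.

Definition set_mi n (al : mi n) (k : 'I_n) (c : nat) : mi n :=
  [ffun i => if i == k then c else al i].

Lemma monomial_set_mi n (v : 'rV[R]_n) (al : mi n) k c :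
  monomial v (set_mi al k c) = v 0 k ^+ c * \prod_(i < n | i != k) v 0 i ^+ al i.
Proof.
rewrite /monomial (bigD1 k) //= ffunE eqxx; congr (_ * _).
by apply: eq_bigr => i /negbTE ik; rewrite ffunE ik.
Qed.

Lemma set_mi_id n (al : mi n) k : set_mi al k (al k) = al.
Proof. by apply/ffunP => i; rewrite ffunE; case: eqP => [->|]. Qed.

Lemma monomialD1 n (v : 'rV[R]_n) (al : mi n) k :
  monomial v al = v 0 k ^+ al k * \prod_(i < n | i != k) v 0 i ^+ al i.
Proof. by rewrite -{1}(set_mi_id al k) monomial_set_mi. Qed.

Lemma prod_setc n (x p : 'rV[R]_n) k c (al : mi n) :
  \prod_(i < n | i != k) (setc x k c - p) 0 i ^+ al i =
  \prod_(i < n | i != k) (x - p) 0 i ^+ al i.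
Proof. by apply: eq_bigr => i /negbTE ik; rewrite !mxE ik. Qed.

Lemma wiener_tsum n r (p : 'rV[R]_n) M (c : mi n -> R) (e : mi n -> mi n) :
  0 < r -> asum (fun al => c al * weight r (e al)) M ->
  wiener r p (fun x => tsum (fun al => c al * monomial (x - p) (e al))) M /\
  forall x, polydisc r p x -> hsum (fun al => c al * monomial (x - p) (e al))
    (tsum (fun al => c al * monomial (x - p) (e al))).
Proof.
move=> r0 cM.
have h x : polydisc r p x -> hsum (fun al => c al * monomial (x - p) (e al))
    (tsum (fun al => c al * monomial (x - p) (e al))).
  move=> px; apply: (@asum_hsum _ _ _ M); apply: asum_le cM => al.
  rewrite !normrM ler_wpM2l //.
  by apply: le_trans (ler_norm _); apply/norm_monomial_le/polydisc_sub.
by split => //; apply: (@wiener_family _ _ _ _ _ _ _ c e).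
Qed.

(** The factor [x 0 k - p 0 k] is divided out of every monomial that contains it, at the cost of a
    factor [1 / r] in the norm. The analytic quotient [h] serves below as a divided difference whose
    value at [p] is a partial derivative. *)
Lemma analytic_hadamard n (k : 'I_n) f (p : 'rV[R]_n) : analytic_at f p ->
  exists2 h, analytic_at h p &
    \forall x \near p, f x = f (setc x k (p 0 k)) + (x 0 k - p 0 k) * h x.
Proof.
move=> /analytic_wiener[r [M [r0 [a [aM hf]]]]].
(* Terms free of the [k]-th variable are discarded, so the truncation [0.-1 = 0] in [e] has no
   effect. *)
pose c (al : mi n) := if al k == 0%N then 0 else a al.
pose e (al : mi n) := set_mi al k (al k).-1.
have cM : asum (fun al => c al * weight r (e al)) (`|r^-1| * M).
  apply: asum_le (asumZ r^-1 aM) => al; rewrite /c.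
  case: eqP => [_|/eqP]; first by rewrite mul0r normr0.
  rewrite /weight (monomialD1 _ al k) monomial_set_mi mxE.
  case: (al k) => // j _; rewrite /= [X in _ <= `|X|](_ : _ =
    a al * (r ^+ j * \prod_(i < n | i != k) (const_mx r : 'rV[R]_n) 0 i ^+ al i)) //.
  by rewrite exprS; field; rewrite gt_eqF.
have [wh hh] := @wiener_tsum _ _ p _ _ _ r0 cM.
exists (fun x => tsum (fun al => c al * monomial (x - p) (e al))).
  by apply/analytic_wiener; exists r, (`|r^-1| * M).
apply/near_polydisc; exists r => // x px.
have pkx : polydisc r p (setc x k (p 0 k)).
  by move=> i; rewrite mxE; case: eqP => [->|_ //]; rewrite subrr normr0 ltW.
apply: hsum_uniq (hf x px) _.
have := hsumD (hf _ pkx) (hsumZ (x 0 k - p 0 k) (hh x px)).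
congr hsum; apply/funext => al; rewrite /c.
rewrite monomial_set_mi !(monomialD1 _ al k) prod_setc !mxE eqxx subrr.
case: (al k) => [|j] /=; first by rewrite mul0r mulr0 addr0.
by rewrite expr0n /= mul0r mulr0 add0r exprS; ring.
Qed.

(** Monomials are sorted by the parity of the exponent of the [k]-th variable, and that exponent is
    halved. *)
Lemma analytic_even_odd n (k : 'I_n) f (p : 'rV[R]_n) : p 0 k = 0 ->
  analytic_at f p ->
  exists E O, [/\ analytic_at E p, analytic_at O p &
    \forall x \near p, f x = E (setc x k (x 0 k ^+ 2))
      + x 0 k * O (setc x k (x 0 k ^+ 2))].
Proof.
move=> pk0 /analytic_wiener[r [M [r0 [a [aM hf]]]]].
(* In [E] and [O] the [k]-th variable stands for a square, which asks for a radius at most [r ^+ 2];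
   the others ask for at most [r]. *)
pose r' := Num.min r (r ^+ 2).
have r'0 : 0 < r' by rewrite lt_min r0 exprn_gt0.
pose c (b : bool) (al : mi n) := if odd (al k) == b then a al else 0.
pose e (al : mi n) := set_mi al k (al k)./2.
have halves (v : 'rV[R]_n) (al : mi n) : monomial v al =
    v 0 k ^+ odd (al k) * ((v 0 k ^+ 2) ^+ (al k)./2 *
      \prod_(i < n | i != k) v 0 i ^+ al i).
  rewrite (monomialD1 _ al k) mulrA; congr (_ * _).
  by rewrite -exprM -exprD mul2n odd_double_half.
have wle al : weight r' (e al) <= (r ^+ 2) ^+ (al k)./2 *
      \prod_(i < n | i != k) (const_mx r : 'rV[R]_n) 0 i ^+ al i.
  rewrite /weight monomial_set_mi; apply: ler_pM.
  - by rewrite mxE exprn_ge0 ?ltW.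
  - by apply: prodr_ge0 => i _; rewrite mxE exprn_ge0 ?ltW.
  - by rewrite mxE lerXn2r ?nnegrE ?exprn_ge0 ?(ltW r0) ?(ltW r'0) // ge_min lexx orbT.
  - apply: ler_prod => i _; rewrite !mxE exprn_ge0 ?(ltW r'0) //.
    by rewrite lerXn2r ?nnegrE ?(ltW r0) ?(ltW r'0) // ge_min lexx.
have cM b : asum (fun al => c b al * weight r' (e al)) (`|r^-1 ^+ b| * M).
  apply: asum_le (asumZ (r^-1 ^+ b) aM) => al; rewrite /c.
  case: eqP => [ob|_]; last by rewrite mul0r normr0.
  rewrite {2}/weight halves ob mxE [X in _ <= `|X|](_ : _ = a al *
    ((r ^+ 2) ^+ (al k)./2 *
      \prod_(i < n | i != k) (const_mx r : 'rV[R]_n) 0 i ^+ al i)); last first.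
    by case: b {ob} => /=; rewrite ?expr0 ?expr1; field; rewrite ?gt_eqF.
  rewrite !normrM ler_wpM2l // gtr0_norm ?weight_gt0 //.
  by rewrite -normrM; apply: le_trans (ler_norm _); exact: wle.
have wt b := @wiener_tsum _ _ p _ _ _ r'0 (cM b).
exists (fun x => tsum (fun al => c false al * monomial (x - p) (e al))).
exists (fun x => tsum (fun al => c true al * monomial (x - p) (e al))).
split; first by apply/analytic_wiener; do 2 eexists; split; last exact: (wt false).1.
  by apply/analytic_wiener; do 2 eexists; split; last exact: (wt true).1.
(* The bound 1 gives [x 0 k ^+ 2 <= |x 0 k|], which keeps the point with the squared coordinate
   inside the polydisc. *)
have m0 : 0 < Num.min 1 r' by rewrite lt_min ltr01.
apply/near_polydisc; exists (Num.min 1 r') => // x px.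
have px' : polydisc r' p x.
  by move=> i; apply: le_trans (px i) _; rewrite ge_min lexx orbT.
have pxr : polydisc r p x.
  by move=> i; apply: le_trans (px' i) _; rewrite ge_min lexx.
have psx : polydisc r' p (setc x k (x 0 k ^+ 2)).
  move=> i; rewrite mxE; case: eqP => [->|_ //]; rewrite pk0 subr0.
  have := px' k; have := px k; rewrite pk0 subr0 le_min => /andP[h1 _] h2.
  by rewrite normrX expr2 (le_trans _ h2) // ler_piMl.
apply: hsum_uniq (hf x pxr) _.
have := hsumD ((wt false).2 _ psx) (hsumZ (x 0 k) ((wt true).2 _ psx)).
congr hsum; apply/funext => al; rewrite /c.
rewrite monomial_set_mi prod_setc halves !mxE eqxx pk0 !subr0.
by case: odd => /=; rewrite ?expr0 ?expr1; ring.
Qed.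

(** Hadamard's lemma is applied to one coordinate after the other; [g s] has the coordinates in [s]
    already frozen at those of [p]. *)
Lemma analytic_expand n f (p : 'rV[R]_n) : analytic_at f p ->
  exists2 h : 'I_n -> 'rV[R]_n -> R, (forall i, analytic_at (h i) p) &
    \forall x \near p, f x = f p + \sum_i (x 0 i - p 0 i) * h i x.
Proof.
move=> hf; pose g (s : seq 'I_n) (x : 'rV[R]_n) : 'rV[R]_n :=
  \row_i if i \in s then p 0 i else x 0 i.
have gp s : g s p = p by apply/rowP => i; rewrite mxE if_same.
have ag s : vanalytic_at (g s) p.
  move=> i; case: (boolP (i \in s)) => is_.
    by have := analytic_cst (p 0 i) p; congr analytic_at; apply/funext => x; rewrite mxE is_.
  by have := analytic_coord i p; congr analytic_at; apply/funext => x; rewrite mxE (negbTE is_).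
have [h ha hE] : exists2 h : 'I_n -> 'rV[R]_n -> R, (forall i, analytic_at (h i) p) &
    \forall x \near p, f x = f (g (enum 'I_n) x)
      + \sum_(i <- enum 'I_n) (x 0 i - p 0 i) * h i x.
  elim: (enum 'I_n) (enum_uniq 'I_n) => [_|k s IH /= /andP[ks us]].
    exists (fun _ => cst 0) => [i|]; first exact: analytic_cst.
    near=> x; rewrite big_nil addr0; congr f.
    by apply/rowP => i; rewrite mxE.
  have [h ha hE] := IH us; have [H aH HE] := analytic_hadamard k hf.
  exists (fun i => if i == k then fun x => H (g s x) else h i).
    move=> i; case: eqP => // _; apply: analytic_comp (ag s).
    by rewrite gp.
  have cg : g s @ p --> p by rewrite -[X in _ --> X](gp s); exact: vanalytic_continuous.
  have HE' : \forall x \near p, f (g s x) = f (setc (g s x) k (p 0 k))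
      + (g s x 0 k - p 0 k) * H (g s x) := cg _ HE.
  near=> x.
  rewrite big_cons eqxx (near hE x) // (near HE' x) //.
  have -> : setc (g s x) k (p 0 k) = g (k :: s) x.
    by apply/rowP => i; rewrite !mxE inE; case: eqP => [->|].
  rewrite [g s x 0 k]mxE (negbTE ks) -addrA; congr (_ + (_ + _)).
  rewrite big_seq [RHS]big_seq; apply: eq_bigr => i is_.
  by case: eqP => // ik; rewrite -ik is_ in ks.
exists h => //; near=> x; rewrite (near hE x) // big_enum /=.
by congr (f _ + _); apply/rowP => i; rewrite mxE mem_enum.
Unshelve. all: by end_near. Qed.

End Calculus.

(** * Differentiation *)

Section Jacobian.
Context {R : realType}.
Implicit Types (n m : nat).

Lemma cvg_dnbhs (T U : topologicalType) (f : T -> U) x (l : U) :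
  f @ x --> l -> f @ x^' --> l.
Proof. by move=> h A /h; exact: nbhs_dnbhs. Qed.

(** Hadamard quotients enter here as [g]: a secant formula with a convergent factor yields the
    directional derivative. *)
Lemma is_derive_secant (V W : normedModType R) (f : V -> W) (x v : V)
    (g : R -> W) (l : W) :
  (\forall t \near (0 : R), f (t *: v + x) = f x + t *: g t) ->
  g @ 0^' --> l -> is_derive x v f l.
Proof.
move=> fg gl.
have h : (fun t : R => t^-1 *: ((f \o shift x) (t *: v) - f x)) @ 0^' --> l.
  apply: cvg_trans gl; apply: near_eq_cvg; near=> t.
  have t0 : t != 0 by near: t; exact: nbhs_dnbhs_neq.
  rewrite /= (near (nbhs_dnbhs fg) t) // addrAC subrr add0r scalerA mulVf //.
  by rewrite scale1r.
apply: DeriveDef; first by apply/cvg_ex; exists l.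
exact: cvg_lim h.
Unshelve. all: by end_near. Qed.

(* The divided difference of [f (x + t e_k)] is analytic in [(t, x)]; the partial
   derivative is its value at [t = 0]. *)
Lemma analytic_partial n (k : 'I_n) f (p : 'rV[R]_n) : analytic_at f p ->
  exists2 H, analytic_at H p &
    \forall x \near p, is_derive x (delta_mx 0 k) f (H x).
Proof.
move=> hf; pose k0 : 'I_(1 + n) := lshift n 0.
pose lin (y : 'rV[R]_(1 + n)) : 'rV[R]_n := rsubmx y + y 0 k0 *: delta_mx 0 k.
pose q : 'rV[R]_(1 + n) := row_mx 0 p.
have linq : lin q = p by rewrite /lin row_mxKr row_mxEl mxE scale0r addr0.
have alin y : vanalytic_at lin y.
  apply: vanalyticD; last first.
    apply: vanalyticZ; first exact: analytic_coord.
    by move=> j; exact: analytic_cst.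
  move=> j; have := analytic_coord (rshift 1 j) y; congr analytic_at.
  by apply/funext => z; rewrite mxE.
have aF : analytic_at (fun y => f (lin y)) q.
  by apply: analytic_comp (alin q); rewrite linq.
have [h ah hE] := analytic_hadamard k0 aF.
pose pt (t : R) (x : 'rV[R]_n) : 'rV[R]_(1 + n) := row_mx (const_mx t) x.
have apt t x : vanalytic_at (pt t) x.
  move=> j; rewrite -(fintype.splitK j); case: (fintype.split j) => i /=.
    have := analytic_cst t x; congr analytic_at; apply/funext => z.
    by rewrite row_mxEl mxE.
  have := analytic_coord i x; congr analytic_at; apply/funext => z.
  by rewrite row_mxEr.
have pt0 : pt 0 p = q by congr row_mx; apply/rowP => i; rewrite !mxE.
have cpt : pt 0 @ p --> q by rewrite -pt0; exact: vanalytic_continuous.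
exists (fun x => h (pt 0 x)).
  by apply: analytic_comp (apt 0 p); rewrite pt0.
have nh : \forall x \near p, analytic_at h (pt 0 x) := cpt _ (analytic_near ah).
pose P z := f (lin z) = f (lin (setc z k0 (q 0 k0))) + (z 0 k0 - q 0 k0) * h z.
have nE : \forall x \near p, \forall z \near pt 0 x, P z.
  exact: (cpt _ (near_join hE)).
near=> x.
have cx : (fun t => pt t x) @ (0 : R) --> pt 0 x.
  apply: cvg_mx => i j; rewrite ord1 -(fintype.splitK j); case: (fintype.split j) => j' /=.
    rewrite [X in _ --> X]row_mxEl mxE.
    by under eq_fun do rewrite row_mxEl mxE; exact: cvg_id.
  rewrite [X in _ --> X]row_mxEr.
  by under eq_fun do rewrite row_mxEr; exact: cvg_cst.
apply: (@is_derive_secant _ _ _ _ _ (fun t => h (pt t x))).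
  have nEx : \forall z \near pt 0 x, P z by near: x; exact: nE.
  have nt : \forall t \near (0 : R), P (pt t x) := cx _ nEx.
  apply: filterS nt => t; rewrite /P.
  rewrite /lin /pt row_mxKr !row_mxEl !mxE subr0 [X in f X]addrC => ->.
  have -> : rsubmx (setc (row_mx (const_mx t) x) k0 (0 : R)) = x.
    by apply/rowP => j; rewrite [LHS]mxE [LHS]mxE eq_rlshift row_mxEr.
  by rewrite scale0r addr0.
apply: cvg_dnbhs; apply: (@cvg_comp _ _ _ (fun t => pt t x) h) cx _.
by apply: analytic_continuous; near: x; exact: nh.
Unshelve. all: by end_near. Qed.

Lemma is_derive_mx (V : normedModType R) n m (f : V -> 'M[R]_(n, m)) x v
    (df : 'M[R]_(n, m)) :
  (forall i j, is_derive x v (fun y => f y i j) (df i j)) -> is_derive x v f df.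
Proof.
move=> h; have df' : derivable f x v by apply/derivable_mxP => i j; exact: ex_derive.
apply: DeriveDef => //; rewrite derive_mx //; apply/matrixP => i j; rewrite mxE.
exact: derive_val.
Qed.

Lemma vanalytic_mulmx n m k (f : 'rV[R]_n -> 'rV[R]_m)
    (A : 'rV[R]_n -> 'M[R]_(m, k)) p : vanalytic_at f p ->
  (forall i j, analytic_at (fun x => A x i j) p) ->
  vanalytic_at (fun x => f x *m A x) p.
Proof.
move=> hf hA j; have := @analytic_sum _ _ _ (index_enum 'I_m)
  (fun i x => f x 0 i * A x i j) p (fun i => analyticM (hf i) (hA i j)).
by congr analytic_at; apply/funext => x; rewrite mxE.
Qed.

Lemma mulmxr_continuous m k (A : 'M[R]_(m, k)) :
  continuous (mulmxr A : 'rV[R]_m -> 'rV[R]_k).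
Proof.
move=> v; apply: vanalytic_continuous; apply: vanalytic_mulmx => i *.
- exact: analytic_coord.
- exact: analytic_cst.
Qed.

Lemma differentiable_littleo (V W : normedModType R) (f : V -> W)
    (df : {linear V -> W}) x : continuous df ->
  (forall e, 0 < e -> \forall v \near (0 : V),
    `|f (v + x) - (f x + df v)| <= e * `|v|) ->
  differentiable f x.
Proof.
move=> cdf h.
have fo : f \o shift x = cst (f x) + df +o_ 0 id by apply/eqaddoP => e /h.
by apply/diff_locallyP; rewrite (diff_unique cdf fo).
Qed.

(** The differential is the matrix of the values at [p] of the quotients from [analytic_expand];
    their continuity at [p] makes the remainder small compared with the increment. *)
Lemma vanalytic_differentiable n m (f : 'rV[R]_n -> 'rV[R]_m) p :
  vanalytic_at f p -> differentiable f p.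
Proof.
move=> hf.
have /choice[h hh] : forall j, exists h : 'I_n -> 'rV[R]_n -> R,
    (forall i, analytic_at (h i) p) /\
    \forall x \near p, f x 0 j = f p 0 j + \sum_i (x 0 i - p 0 i) * h i x.
  by move=> j; have [h h1 h2] := analytic_expand (hf j); exists h.
pose A : 'M[R]_(n, m) := \matrix_(i, j) h j i p.
apply: (@differentiable_littleo 'rV[R]_n 'rV[R]_m f (mulmxr A)).
  exact: mulmxr_continuous.
move=> e e0; pose e' := e / n.+1%:R.
have e'0 : 0 < e' by rewrite divr_gt0.
have n1 : \forall x \near p, forall j, f x 0 j = f p 0 j + \sum_i (x 0 i - p 0 i) * h j i x.
  apply: (@filter_forall _ _ (fun j x => f x 0 j = f p 0 j +
    \sum_i (x 0 i - p 0 i) * h j i x) (nbhs p)) => j.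
  by have [_] := hh j.
have n2 : \forall x \near p, forall ij : 'I_n * 'I_m,
    `|h ij.2 ij.1 p - h ij.2 ij.1 x| <= e'.
  apply: (@filter_forall _ _ (fun ij x => `|h ij.2 ij.1 p - h ij.2 ij.1 x| <= e')
    (nbhs p)) => -[i j] /=.
  by have /analytic_continuous/cvgrPdist_le := (hh j).1 i; exact.
rewrite (near_shift 0 p) subr0 /= in n1.
rewrite (near_shift 0 p) subr0 /= in n2.
near=> v; apply: mx_norm_le; first by rewrite mulr_ge0 // ltW.
move=> i j; rewrite ord1 !mxE.
have -> : f (v + p) 0 j = f p 0 j + \sum_i ((v + p) 0 i - p 0 i) * h j i (v + p).
  by move: j; near: v; exact: n1.
rewrite opprD addrACA subrr add0r -sumrB.
apply: le_trans (ler_norm_sum _ _ _) _.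
apply: (@le_trans _ _ (\sum_(k < n) (e' * `|v|))).
  apply: ler_sum => k _; rewrite !mxE addrK -mulrBr normrM mulrC distrC.
  apply: ler_pM => //; last exact: le_mx_norm.
  have : forall ij : 'I_n * 'I_m, `|h ij.2 ij.1 p - h ij.2 ij.1 (v + p)| <= e'.
    by near: v; exact: n2.
  by move/(_ (k, j)).
rewrite sumr_const card_ord -mulrnAl ler_wpM2r // /e' -[leLHS]mulr_natr.
by rewrite mulrAC ler_pdivrMr // ler_wpM2l ?ler_nat // ltW.
Unshelve. all: by end_near. Qed.

(** Near [p] the entries agree with the analytic partial derivatives, differentiability being known
    at every nearby point. *)
Lemma vanalytic_jacobian n m (f : 'rV[R]_n -> 'rV[R]_m) p : vanalytic_at f p ->
  forall i j, analytic_at (fun x => 'J f x i j) p.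
Proof.
move=> hf i j; have [H aH HE] := analytic_partial i (hf j).
apply: analytic_near_eq aH; have nf := vanalytic_near hf.
near=> x.
have fx : vanalytic_at f x by near: x; exact: nf.
have dH : is_derive x (delta_mx 0 i) (fun x => f x 0 j) (H x) by near: x; exact: HE.
have df := vanalytic_differentiable fx.
have := deriveEjacobian (delta_mx 0 i) df.
rewrite -rowE derive_mx; last exact: diff_derivable.
move=> /(congr1 (fun M : 'rV[R]_m => M 0 j)); rewrite !mxE => <-.
by apply/esym; exact: derive_val.
Unshelve. all: by end_near. Qed.

End Jacobian.

(** * Analytic functions of several real arguments packed into row vectors *)

Section Rows.
Context {R : realType}.
Implicit Types (n m : nat).

Lemma near_comp (T U : topologicalType) (g : T -> U) (x : T) (P : U -> Prop) :
  {for x, continuous g} -> (\forall y \near g x, P y) -> \forall z \near x, P (g z).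
Proof. by move=> cg; apply: cg. Qed.

Lemma row3_eta (v : 'rV[R]_3) : v = row_of [:: v 0 0; v 0 1; v 0 2].
Proof.
by apply/rowP => -[[|[|[|//]]] h]; rewrite mxE /=; congr (v 0 _); apply/val_inj.
Qed.

Lemma near1P (a : R) (P : R -> Prop) :
  (\forall x \near a, P x) -> \forall v \near (row_of [:: a] : 'rV[R]_1), P ((v : 'rV[R]_1) 0 0).
Proof.
move=> aP; apply: (@near_comp _ _ (fun v : 'rV[R]_1 => v 0 0)).
  exact: coord_continuous.
by rewrite mxE.
Qed.

Lemma near3P (a b c : R) (P : R -> R -> R -> Prop) :
  near3 a b c P <->
  \forall v \near (row_of [:: a; b; c] : 'rV[R]_3), P ((v : 'rV[R]_3) 0 0) (v 0 1) (v 0 2).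
Proof.
split.
  move=> [d d0 h]; apply/near_polydisc; exists (d / 2); first by rewrite divr_gt0.
  have d2 : d / 2 < d by rewrite ltr_pdivrMr // mulr_natr mulr2n ltrDl.
  move=> v hv; apply: h; apply: le_lt_trans d2.
  - by have := hv 0; rewrite mxE.
  - by have := hv 1; rewrite mxE.
  - by have := hv 2; rewrite mxE.
move=> /near_polydisc[d d0 h]; exists d => // x y z hx hy hz.
have := h (row_of [:: x; y; z]); rewrite !mxE /=; apply.
by move=> [[|[|[|//]]] ij]; rewrite !mxE; exact: ltW.
Qed.

Lemma analytic_eq n (f g : 'rV[R]_n -> R) p : f =1 g ->
  analytic_at f p -> analytic_at g p.
Proof. by move=> /funext ->. Qed.

Section Row_analytic.
Context {n : nat} (q : 'rV[R]_n).
Implicit Types a b c d : 'rV[R]_n -> R.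

Lemma vanalytic_row1 a : analytic_at a q ->
  vanalytic_at (fun y => row_of [:: a y] : 'rV[R]_1) q.
Proof.
move=> ha [[|//] h]; apply: analytic_eq ha => y; by rewrite mxE.
Qed.

Lemma vanalytic_row2 a b : analytic_at a q -> analytic_at b q ->
  vanalytic_at (fun y => row_of [:: a y; b y] : 'rV[R]_2) q.
Proof.
move=> ha hb [[|[|//]] h].
- by apply: analytic_eq ha => y; rewrite mxE.
- by apply: analytic_eq hb => y; rewrite mxE.
Qed.

Lemma vanalytic_row3 a b c : analytic_at a q -> analytic_at b q ->
  analytic_at c q ->
  vanalytic_at (fun y => row_of [:: a y; b y; c y] : 'rV[R]_3) q.
Proof.
move=> ha hb hc [[|[|[|//]]] h].
- by apply: analytic_eq ha => y; rewrite mxE.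
- by apply: analytic_eq hb => y; rewrite mxE.
- by apply: analytic_eq hc => y; rewrite mxE.
Qed.

Lemma vanalytic_row4 a b c d : analytic_at a q -> analytic_at b q ->
  analytic_at c q -> analytic_at d q ->
  vanalytic_at (fun y => row_of [:: a y; b y; c y; d y] : 'rV[R]_4) q.
Proof.
move=> ha hb hc hd [[|[|[|[|//]]]] h].
- by apply: analytic_eq ha => y; rewrite mxE.
- by apply: analytic_eq hb => y; rewrite mxE.
- by apply: analytic_eq hc => y; rewrite mxE.
- by apply: analytic_eq hd => y; rewrite mxE.
Qed.

Definition of_row2 T (f : R -> R -> T) (v : 'rV[R]_2) : T := f (v 0 0) (v 0 1).

Lemma analytic_comp1 (f : R -> R) a :
  analytic_at (of_row1 f) (row_of [:: a q]) -> analytic_at a q ->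
  analytic_at (fun y => f (a y)) q.
Proof.
move=> hf ha; apply: analytic_eq (analytic_comp hf (vanalytic_row1 ha)) => y.
by rewrite /of_row1 mxE.
Qed.

Lemma analytic_comp2 (f : R -> R -> R) a b :
  analytic_at (of_row2 f) (row_of [:: a q; b q]) ->
  analytic_at a q -> analytic_at b q ->
  analytic_at (fun y => f (a y) (b y)) q.
Proof.
move=> hf ha hb; apply: analytic_eq (analytic_comp hf (vanalytic_row2 ha hb)) => y.
by rewrite /of_row2 !mxE.
Qed.

Lemma analytic_comp3 (f : R -> R -> R -> R) a b c :
  analytic_at (of_row3 f) (row_of [:: a q; b q; c q]) ->
  analytic_at a q -> analytic_at b q -> analytic_at c q ->
  analytic_at (fun y => f (a y) (b y) (c y)) q.
Proof.
move=> hf ha hb hc.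
apply: analytic_eq (analytic_comp hf (vanalytic_row3 ha hb hc)) => y.
by rewrite /of_row3 !mxE.
Qed.

Lemma analytic_comp4 (f : R -> R -> R -> R -> R) a b c d :
  analytic_at (of_row4 f) (row_of [:: a q; b q; c q; d q]) ->
  analytic_at a q -> analytic_at b q -> analytic_at c q -> analytic_at d q ->
  analytic_at (fun y => f (a y) (b y) (c y) (d y)) q.
Proof.
move=> hf ha hb hc hd.
apply: analytic_eq (analytic_comp hf (vanalytic_row4 ha hb hc hd)) => y.
by rewrite /of_row4 !mxE.
Qed.

Lemma analytic_dot (f g : 'rV[R]_n -> 'rV[R]_2) : vanalytic_at f q ->
  vanalytic_at g q -> analytic_at (fun y => dot (f y) (g y)) q.
Proof. by move=> hf hg; apply: analytic_sum => i; exact: analyticM. Qed.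

End Row_analytic.

End Rows.

(** * Linear algebra in the plane *)

Section PlaneGeometry.
Context {R : realType}.
Implicit Types (u v w : 'rV[R]_2).

Lemma dotE u v : dot u v = u 0 0 * v 0 0 + u 0 1 * v 0 1.
Proof.
rewrite /dot big_ord_recl big_ord1; congr (_ + u 0 _ * v 0 _); exact/val_inj.
Qed.

Lemma rot90E u : (rot90 u 0 0 = - u 0 1) * (rot90 u 0 1 = u 0 0).
Proof. by rewrite !mxE. Qed.

Lemma row2P u v : u 0 0 = v 0 0 -> u 0 1 = v 0 1 -> u = v.
Proof.
move=> h0 h1; apply/rowP => -[[|[|//]] h].
- by rewrite (_ : Ordinal h = 0) //; exact/val_inj.
- by rewrite (_ : Ordinal h = 1) //; exact/val_inj.
Qed.

Lemma dotBr u v w : dot u (v - w) = dot u v - dot u w.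
Proof. by rewrite !dotE !mxE; ring. Qed.

Lemma dotZr u (a : R) v : dot u (a *: v) = a * dot u v.
Proof. by rewrite !dotE !mxE; ring. Qed.

Lemma orthonormal_expand u v : dot u u = 1 ->
  v = dot u v *: u + dot (rot90 u) v *: rot90 u.
Proof.
rewrite !dotE !rot90E => u1.
have h : forall x : R, x = (u 0 0 * u 0 0 + u 0 1 * u 0 1) * x.
  by move=> x; rewrite u1 mul1r.
apply: row2P; rewrite !mxE /=; [rewrite {1}(h (v 0 0))|rewrite {1}(h (v 0 1))]; ring.
Qed.

(** Cauchy-Schwarz: for unit vectors, [2 + 2 <u^perp, v>] and [2 - 2 <u^perp, v>] are sums of two
    squares. *)
Lemma dot_rot90_bound u v : dot u u = 1 -> dot v v = 1 ->
  `|dot (rot90 u) v| <= 1.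
Proof.
rewrite !dotE !rot90E => u1 v1; rewrite ler_norml; apply/andP; split.
- have : 0 <= (u 0 0 + v 0 1) ^+ 2 + (u 0 1 - v 0 0) ^+ 2 by rewrite addr_ge0 ?sqr_ge0.
  nra.
- have : 0 <= (u 0 0 - v 0 1) ^+ 2 + (u 0 1 + v 0 0) ^+ 2 by rewrite addr_ge0 ?sqr_ge0.
  nra.
Qed.

(** Were the determinant [dot (rot90 u) v] zero, [v] would be a multiple of [u], hence an
    eigenvector for both [a] and [b]. *)
Lemma eigen_independent u v (A : 'M[R]_2) a b : dot u u = 1 -> dot v v = 1 ->
  u *m A = a *: u -> v *m A = b *: v -> a != b -> dot (rot90 u) v != 0.
Proof.
move=> u1 v1 uA vA ab; apply/eqP => uv0.
have vE : v = dot u v *: u by rewrite {1}(orthonormal_expand v u1) uv0 scale0r addr0.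
have : b *: v = a *: v by rewrite -vA {1}vE -scalemxAl uA scalerA mulrC -scalerA -vE.
move/eqP; rewrite -subr_eq0 -scalerBl scaler_eq0 subr_eq0 eq_sym (negbTE ab) /=.
move/eqP => v0; move: v1; rewrite v0 dotE !mxE; lra.
Qed.

Lemma det_mx22 (A : 'M[R]_2) : \det A = A 0 0 * A 1 1 - A 0 1 * A 1 0.
Proof.
rewrite (expand_det_row _ 0) big_ord_recl big_ord1 /cofactor !det_mx11 !mxE /=.
rewrite expr0 expr1 mul1r mulN1r mulrN.
have -> : lift 0 0 = 1 :> 'I_2 by exact/val_inj.
have -> : lift (1 : 'I_2) 0 = 0 :> 'I_2 by exact/val_inj.
by [].
Qed.

(** The matrix scales the eigenvector rows by [1 + t a] and [1 + t b]; on taking determinants, that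
    of the eigenvector rows cancels. *)
Lemma det_eigen u v (A : 'M[R]_2) a b t : dot u u = 1 -> dot v v = 1 ->
  u *m A = a *: u -> v *m A = b *: v -> a != b ->
  \det (1%:M + t *: A) = (1 + t * a) * (1 + t * b).
Proof.
move=> u1 v1 uA vA ab; have n0 := eigen_independent u1 v1 uA vA ab.
pose P : 'M[R]_2 := \matrix_i (if i == 0 then u else v).
pose D : 'M[R]_2 := \matrix_i (if i == 0 then (1 + t * a) *: u else (1 + t * b) *: v).
have PD : P *m (1%:M + t *: A) = D.
  apply/row_matrixP => i; rewrite row_mul !rowK.
  by case: eqP => _; rewrite mulmxDr mulmx1 -scalemxAr ?uA ?vA scalerA scalerDl scale1r.
have detP : \det P = dot (rot90 u) v.
  by rewrite det_mx22 dotE !rot90E !mxE /=; ring.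
have detD : \det D = (1 + t * a) * (1 + t * b) * \det P.
  by rewrite !det_mx22 !mxE /=; ring.
apply: (mulfI (x := \det P)); first by rewrite detP.
by rewrite -det_mulmx PD detD mulrC.
Qed.

End PlaneGeometry.

(** * Limits and power series in one variable *)

Section OneVariable.
Context {R : realType}.

Lemma cvg_near_eq (T : Type) (F : set_system T)
    {FF : Filter F} (f g : T -> R) (l : R) :
  f @ F --> l -> (\forall x \near F, f x = g x) -> g @ F --> l.
Proof.
move=> fl fg; apply: cvg_trans fl; apply: near_eq_cvg.
by apply: filterS fg => x ->.
Qed.

Lemma cvg_row1 (a : R) : (fun s => row_of [:: s] : 'rV[R]_1) @ a --> (row_of [:: a] : 'rV[R]_1).
Proof.
apply: cvg_mx => i j; rewrite ord1 mxE; under eq_fun do rewrite mxE.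
by case: j => [[|//] h] /=; exact: cvg_id.
Qed.

(** Convergence is assumed in the ordinary sense. As in Abel's lemma, boundedness of the terms at
    one point [s1] dominates the coefficients geometrically at half that radius, which makes [q]
    analytic, hence continuous. *)
Lemma series_factor_sqr (c : nat -> R) (f : R -> R) :
  (\forall s \near (0 : R), [series c k * s ^+ k.+2]_k @ \oo --> f s) ->
  exists q : R -> R, [/\ {for 0, continuous q}, q 0 = c 0%N &
    \forall s \near (0 : R), f s = s ^+ 2 * q s].
Proof.
move=> hc; have [d /= d0 hd] := (nbhs_ballP _ _).1 hc.
pose s1 := d / 2; have s10 : 0 < s1 by rewrite divr_gt0.
have hs1 : [series c k * s1 ^+ k.+2]_k @ \oo --> f s1.
  apply: hd; rewrite /ball /= sub0r normrN gtr0_norm //.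
  by rewrite /s1 ltr_pdivrMr // mulr_natr mulr2n ltrDl.
have [M [_ hM]] : bounded_fun (fun k => c k * s1 ^+ k.+2).
  by apply: cvg_seq_bounded; apply/cvg_ex; exists 0; exact: (cvg_series_cvg_0 (cvgP _ hs1)).
have {}hM k : `|c k * s1 ^+ k.+2| <= M + 1 by apply: hM => //; rewrite ltrDl.
pose r := s1 / 2; have r0 : 0 < r by rewrite divr_gt0.
pose e (k : nat) : {ffun 'I_1 -> nat} := [ffun=> k].
have me (v : 'rV[R]_1) k : monomial v (e k) = v 0 0 ^+ k.
  by rewrite /monomial big_ord1 ffunE.
have cM : asum (fun k => c k * weight r (e k)) (`|(M + 1) / s1 ^+ 2| * 2).
  apply: asum_le (asum_geometric _) => k; rewrite /weight me mxE.
  have -> : c k * r ^+ k = (c k * s1 ^+ k.+2) / s1 ^+ 2 * 2^-1 ^+ k.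
    by rewrite /r expr_div_n -exprVn !exprS; field; rewrite gt_eqF.
  rewrite [leLHS]normrM [leRHS]normrM ler_wpM2r //.
  rewrite [leLHS]normrM [leRHS]normrM ler_wpM2r //.
  by apply: le_trans (hM k) (ler_norm _).
pose q s := tsum (fun k => c k * s ^+ k).
have hq s : `|s| <= r -> hsum (fun k => c k * s ^+ k) (q s).
  move=> sr; apply: (asum_hsum (M := `|(M + 1) / s1 ^+ 2| * 2)); apply: asum_le cM => k.
  rewrite /weight me mxE !normrM ler_wpM2l // !normrX lerXn2r ?nnegrE //.
  by rewrite [leRHS]gtr0_norm.
have aq : analytic_at (of_row1 q) (row_of [:: 0]).
  apply/analytic_wiener; exists r; eexists; split=> //.
  apply: (@wiener_family _ _ _ _ _ _ _ c e) => //; first exact: cM.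
  move=> x /(_ 0); rewrite mxE subr0 => xr; have := hq _ xr.
  by congr hsum; apply/funext => k; rewrite me !mxE subr0.
exists q; split.
- have h := cvg_comp _ _ (@cvg_row1 0) (analytic_continuous aq).
  have E : of_row1 q \o (fun s => row_of [:: s]) = q.
    by apply/funext => s; rewrite /of_row1 /= mxE.
  by rewrite E /of_row1 mxE in h.
- apply: tsumE; have := @hsum_finite _ _ (fun k => c k * 0 ^+ k) [:: 0%N] isT.
  rewrite big_seq1 expr0 mulr1; apply => -[//|k] _.
  by rewrite expr0n mulr0.
- have nr : \forall s \near (0 : R), `|s| <= r.
    apply/nbhs_ballP; exists r => //= s; rewrite /ball /= sub0r normrN; exact: ltW.
  near=> s; have sr : `|s| <= r by near: s.
  have hs := hsum_series (hsumZ (s ^+ 2) (hq s sr)).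
  have c2 : [series c k * s ^+ k.+2]_k @ \oo --> f s by near: s.
  apply: cvg_unique c2 _ => //; move: hs.
  have -> : (fun k => s ^+ 2 * (c k * s ^+ k)) = (fun k => c k * s ^+ k.+2).
    by apply/funext => k; rewrite mulrCA -exprD.
  exact.
Unshelve. all: by end_near. Qed.

Lemma lipschitz_is_derive (f df : R -> R) (d B a b : R) :
  (forall x : R, `|x| <= d -> is_derive x 1 f (df x)) ->
  (forall x : R, `|x| <= d -> `|df x| <= B) ->
  `|a| <= d -> `|b| <= d -> `|f a - f b| <= B * `|a - b|.
Proof.
move=> hf hB; wlog ab : a b / a <= b.
  move=> h ad bd; have [|/ltW ba] := leP a b; first by move=> ?; exact: h.
  by rewrite distrC [X in B * X]distrC; exact: h.
move=> ad bd; have /andP[a1 a2] : - d <= a <= d by rewrite -ler_norml.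
have /andP[b1 b2] : - d <= b <= d by rewrite -ler_norml.
have hd x : x \in `[a, b] -> `|x| <= d.
  by rewrite in_itv /= ler_norml => /andP[? ?]; apply/andP; split; lra.
have hfi x : x \in `]a, b[ -> is_derive x 1 f (df x).
  by move=> /subset_itv_oo_cc/hd/hf.
have [|c /hd/hB cB] := MVT_segment ab hfi.
  apply: derivable_within_continuous => x /hd/hf h.
  exact: ex_derive.
by rewrite [leLHS]distrC => ->; rewrite normrM [`|a - b|]distrC ler_wpM2r.
Qed.

(** Multiplying the convergent quotient by [s ^+ 2], then by [s], forces the constant and the linear
    coefficient to vanish. It is applied to the second-order expansion of the determinant in [s]. *)
Lemma sqr_quotient_limit (A B L : R) (g : R -> R) g0 :
  g @ (0 : R) --> g0 ->
  (fun s => (A + s * B + s ^+ 2 * g s) / s ^+ 2) @ 0^' --> L ->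
  [/\ A = 0, B = 0 & g0 = L].
Proof.
move=> /cvg_dnbhs cg cL.
have s0 : (fun s : R => s) @ 0^' --> (0 : R) by apply: cvg_dnbhs; exact: cvg_id.
have s2 : (fun s : R => s ^+ 2) @ 0^' --> (0 : R).
  have h : (fun s : R => s * s) @ 0^' --> (0 * 0 : R) by exact: cvgM.
  by rewrite mul0r in h; apply: cvg_near_eq h _; near=> s; rewrite expr2.
have nz : \forall s \near (0 : R)^', s != 0 by exact: nbhs_dnbhs_neq.
have A0 : A = 0.
  have h1 : (fun s => A + s * B + s ^+ 2 * g s) @ 0^' --> A + 0 * B + 0 * g0.
    by apply: cvgD; [apply: cvgD; [exact: cvg_cst|apply: cvgM => //; exact: cvg_cst]
      |exact: cvgM].
  have h2 : (fun s => s ^+ 2 * ((A + s * B + s ^+ 2 * g s) / s ^+ 2)) @ 0^' --> 0 * L.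
    exact: cvgM.
  rewrite !mul0r !addr0 in h1 h2.
  apply: cvg_unique h1 _ => //; apply: cvg_near_eq h2 _.
  by near=> s; rewrite mulrCA mulfV ?mulr1 // sqrf_eq0; near: s.
have B0 : B = 0.
  have h1 : (fun s => B + s * g s) @ 0^' --> B + 0 * g0.
    by apply: cvgD; [exact: cvg_cst|exact: cvgM].
  have h2 : (fun s => s * ((A + s * B + s ^+ 2 * g s) / s ^+ 2)) @ 0^' --> 0 * L.
    exact: cvgM.
  rewrite !mul0r ?addr0 in h1 h2.
  apply: cvg_unique h1 _ => //; apply: cvg_near_eq h2 _.
  near=> s; have sn0 : s != 0 by near: s.
  by rewrite A0; field.
split=> //; apply: cvg_unique cg _ => //; apply: cvg_near_eq cL _.
near=> s; have sn0 : s != 0 by near: s.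
by rewrite A0 B0; field.
Unshelve. all: by end_near. Qed.

End OneVariable.

(** * Neighbourhoods pulled back by coordinates and analytic maps *)

Section NearCoordinates.
Context {R : realType}.

Lemma near_coord n (p : 'rV[R]_n) i (a : R) (P : R -> Prop) : p 0 i = a ->
  (\forall x \near a, P x) -> \forall v \near p, P ((v : 'rV[R]_n) 0 i).
Proof.
move=> <- h; apply: (@near_comp _ _ (fun v : 'rV[R]_n => v 0 i)) h.
exact: coord_continuous.
Qed.

Lemma near_dist (a d : R) : 0 < d -> \forall x \near a, `|x - a| < d.
Proof. by move=> d0; near=> x; rewrite distrC; near: x; exact: cvgr_dist_lt.
Unshelve. all: by end_near. Qed.

Lemma near_analytic n (f : 'rV[R]_n -> R) p a (P : R -> Prop) : f p = a ->
  analytic_at f p -> (\forall x \near a, P x) -> \forall v \near p, P (f v).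
Proof. by move=> <- hf; apply: near_comp; exact: analytic_continuous. Qed.

Lemma near_vanalytic n m (f : 'rV[R]_n -> 'rV[R]_m) p a (P : 'rV[R]_m -> Prop) :
  f p = a -> vanalytic_at f p -> (\forall x \near a, P x) ->
  \forall v \near p, P (f v).
Proof. by move=> <- hf; apply: near_comp; exact: vanalytic_continuous. Qed.

End NearCoordinates.

(** * The flow of the eigenvector field *)

Section Gas.
Context {R : realType} (G : gas_data R).
Context (hA1 : gas_A1 G) (hframe : gas_frame G) (hcurve : gas_curve G)
  (hflow : gas_flow G) (homega : gas_omega G).

Lemma near_itv xi : itv G xi -> \forall x \near xi, itv G x.
Proof. by move=> ix; apply: open_nbhs_nbhs; split => //; exact: itv_is_open. Qed.

Lemma gam_frame xi : itv G xi -> frame_dom G (gam G xi).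
Proof. by move=> /(gam_sub hcurve)[]. Qed.

Lemma flow0 xi : itv G xi -> flow G xi 0 = gam G xi.
Proof.
move=> /hflow[e e0 h]; have := h xi 0.
by rewrite subrr normr0 => /(_ e0 e0)[].
Qed.

(** The expansion of [lam1] is read at [sg = 0], where all terms of the series vanish. *)
Lemma lam1_gam xi : itv G xi -> lam1 G (gam G xi) = - om G 1 xi.
Proof.
move=> ix; have := nbhs_singleton (om_expansion homega ix).
rewrite (flow0 ix) => h.
have h2 : - om G 1 xi +
    [series om G k.+3 xi * 0 ^+ k.+2 / (k.+2)`!%:R]_k n @[n --> \oo] --> - om G 1 xi.
  have -> : (fun n => - om G 1 xi +
      [series om G k.+3 xi * 0 ^+ k.+2 / (k.+2)`!%:R]_k n) = cst (- om G 1 xi).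
    apply/funext => n; rewrite /series /= big1 ?addr0 // => k _.
    by rewrite exprS mul0r mulr0 mul0r.
  exact: cvg_cst.
exact: cvg_unique h h2.
Qed.

Lemma tauE xi : itv G xi -> tau G xi = (om G 1 xi)^-1.
Proof. by move=> ix; rewrite /tau lam1_gam // invrN opprK. Qed.

Lemma tau_gt0 xi : itv G xi -> 0 < tau G xi.
Proof. by move=> ix; rewrite tauE // invr_gt0 om1_gt0. Qed.

Lemma analytic_tau xi : itv G xi -> analytic_at (of_row1 (tau G)) (row_of [:: xi]).
Proof.
move=> ix; have o0 : of_row1 (om G 1) (row_of [:: xi]) != 0.
  by rewrite /of_row1 mxE gt_eqF // om1_gt0.
apply: analytic_near_eq (analyticV (om_analytic homega (or_introl erefl) ix) o0).
have := near1P (near_itv ix); apply: filterS => v iv.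
by rewrite /of_row1 tauE.
Qed.

(** The expansion has no linear term, the curve being made of critical points of [lam1] along [r1];
    the 2 is the factorial of the leading exponent. *)
Lemma lam1_flow xi : itv G xi -> exists q : R -> R, [/\ {for 0, continuous q},
  q 0 = om G 3 xi / 2 &
  \forall s \near (0 : R), lam1 G (flow G xi s) = - om G 1 xi + s ^+ 2 * q s].
Proof.
move=> ix.
have h : \forall s \near (0 : R),
    [series (om G k.+3 xi / (k.+2)`!%:R) * s ^+ k.+2]_k @ \oo -->
    lam1 G (flow G xi s) + om G 1 xi.
  apply: filterS (om_expansion homega ix) => s hs.
  have -> : (fun k : nat => om G k.+3 xi / (k.+2)`!%:R * s ^+ k.+2) =
      (fun k : nat => om G k.+3 xi * s ^+ k.+2 / (k.+2)`!%:R).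
    by apply/funext => k; rewrite mulrAC.
  set S := series _ in hs *.
  have -> : S = (fun n => (- om G 1 xi + S n) + om G 1 xi).
    by apply/funext => n; rewrite addrAC addNr add0r.
  by apply: cvgD => //; exact: cvg_cst.
have [q [cq q0 hq]] := series_factor_sqr h.
exists q; split => //; apply: filterS hq => s <-.
by rewrite addrCA addNr addr0.
Qed.

(** The eigenvalue is recovered as [<r1, r1 Dw>] since [r1] is a unit vector, and all the factors
    are analytic. *)
Lemma analytic_lam1 x : frame_dom G x -> analytic_at (lam1 G) x.
Proof.
move=> fx; have dx := frame_sub hframe fx.
have ar := r1_analytic hframe fx.
apply: analytic_near_eq (analytic_dot ar
  (vanalytic_mulmx ar (vanalytic_jacobian (vel_analytic hA1 dx)))).
have := open_nbhs_nbhs (conj (frame_open hframe) fx); apply: filterS => y fy.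
by rewrite (r1_eigen hframe fy) dotZr (r1_unit hframe fy) mulr1.
Qed.

Lemma analytic_lam2 x : frame_dom G x -> analytic_at (lam2 G) x.
Proof.
move=> fx; have dx := frame_sub hframe fx.
have ar := r2_analytic hframe fx.
apply: analytic_near_eq (analytic_dot ar
  (vanalytic_mulmx ar (vanalytic_jacobian (vel_analytic hA1 dx)))).
have := open_nbhs_nbhs (conj (frame_open hframe) fx); apply: filterS => y fy.
by rewrite (r2_eigen hframe fy) dotZr (r2_unit hframe fy) mulr1.
Qed.

Lemma vanalytic_gam_comp n (a : 'rV[R]_n -> R) p : itv G (a p) ->
  analytic_at a p -> vanalytic_at (fun y => gam G (a y)) p.
Proof.
move=> ia ha j; apply: (@analytic_comp1 _ _ _ (fun xi => gam G xi 0 j)) => //.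
exact: (gam_analytic hcurve ia j).
Qed.

(* [chr t xi sg] is recovered from the characteristic through [Z = 0], whose
   initial point lies on the curve; two times [t] then determine the flow. *)
Lemma vanalytic_flow xi0 phi Q : itv G xi0 -> phi_spec G xi0 phi ->
  quotient_spec G xi0 phi Q -> vanalytic_at (of_row2 (flow G)) (row_of [:: xi0; 0]).
Proof.
move=> ix [d1 d10 hphi] [d2 d20 hQ].
pose d := Num.min d1 d2; have d0 : 0 < d by rewrite lt_min d10.
set p : 'rV[R]_2 := row_of [:: xi0; 0].
have p0 : p 0 0 = xi0 by rewrite mxE.
have p1 : p 0 1 = 0 by rewrite mxE.
have fx := gam_frame ix.
(* For [Z = 0] the equation [Phi2 = 0] makes the difference of the two characteristics a multiple of
   [r1], with coefficient [Phi1 = - sg * Q]. *)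
pose c t (v : 'rV[R]_2) := (gam G (phi t (v 0 0) (v 0 1) 0)
  + t *: vel G (gam G (phi t (v 0 0) (v 0 1) 0)))
  + (v 0 1 * Q t (v 0 0) (v 0 1) 0) *: r1 G (gam G (v 0 0)).
have hc t : `|t - tau G xi0| < d -> vanalytic_at (c t) p /\
    \forall v \near p, chr G t ((v : 'rV[R]_2) 0 0) (v 0 1) = c t v.
  rewrite lt_min => /andP[td1 td2].
  have n0 d' : 0 < d' -> `|xi0 - xi0| < d' /\ `|0 - 0 : R| < d'.
    by rewrite !subrr normr0.
  have [aphi _ phi0] := hphi t xi0 0 0 td1 (n0 _ d10).1 (n0 _ d10).2 (n0 _ d10).2.
  have [aQ _] := hQ t xi0 0 0 td2 (n0 _ d20).1 (n0 _ d20).2 (n0 _ d20).2.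
  have aphi' : analytic_at (fun v : 'rV[R]_2 => phi t (v 0 0) (v 0 1) 0) p.
    apply: (@analytic_comp4 _ _ _ phi (cst t) _ _ (cst 0)); rewrite ?p0 ?p1 //.
    - exact: analytic_cst.
    - exact: analytic_coord.
    - exact: analytic_coord.
    - exact: analytic_cst.
  have aQ' : analytic_at (fun v : 'rV[R]_2 => Q t (v 0 0) (v 0 1) 0) p.
    apply: (@analytic_comp4 _ _ _ Q (cst t) _ _ (cst 0)); rewrite ?p0 ?p1 //.
    - exact: analytic_cst.
    - exact: analytic_coord.
    - exact: analytic_coord.
    - exact: analytic_cst.
  have pE : phi t (p 0 0) (p 0 1) 0 = xi0 by rewrite p0 p1.
  have agam : vanalytic_at (fun v : 'rV[R]_2 => gam G (phi t (v 0 0) (v 0 1) 0)) p.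
    by apply: vanalytic_gam_comp => //; rewrite pE.
  split.
    apply: vanalyticD.
      apply: vanalyticD => //; apply: vanalyticZ; first exact: analytic_cst.
      apply: vanalytic_comp agam; rewrite pE.
      exact/(vel_analytic hA1)/(frame_sub hframe).
    apply: vanalyticZ; first by apply: analyticM => //; exact: analytic_coord.
    apply: (@vanalytic_comp _ _ _ _ (r1 G) (fun v => gam G (v 0 0))).
      by rewrite p0; exact: r1_analytic.
    by apply: vanalytic_gam_comp; rewrite ?p0 //; exact: analytic_coord.
  have nphi_itv := near_analytic pE aphi' (near_itv ix).
  have n00 := near_coord p0 (near_dist xi0 d0).
  have n01 := near_coord p1 (near_dist 0 d0).
  have nitv := near_coord p0 (near_itv ix).
  near=> v.
  have : `|v 0 0 - xi0| < d by near: v.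
  rewrite lt_min => /andP[h01 h02].
  have : `|v 0 1 - 0| < d by near: v.
  rewrite lt_min => /andP[h11 h12].
  have [_ Phi20 phiE] := hphi t (v 0 0) (v 0 1) 0 td1 h01 h11 (n0 _ d10).2.
  have [_ QE] := hQ t (v 0 0) (v 0 1) 0 td2 h02 h12 (n0 _ d20).2.
  have iv : itv G (v 0 0) by near: v.
  have iphi : itv G (phi t (v 0 0) (v 0 1) 0) by near: v.
  have u1 := r1_unit hframe (gam_frame iv).
  have chr0 : chr G t (phi t (v 0 0) (v 0 1) 0) 0 =
      gam G (phi t (v 0 0) (v 0 1) 0) + t *: vel G (gam G (phi t (v 0 0) (v 0 1) 0)).
    by rewrite /chr flow0.
  rewrite /c -chr0 -[LHS](subrK (chr G t (phi t (v 0 0) (v 0 1) 0) 0)) addrC.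
  congr (_ + _); rewrite -opprB; set D := _ - chr G t (v 0 0) (v 0 1).
  have -> : D = Phi1 G t (v 0 0) (v 0 1) (phi t (v 0 0) (v 0 1) 0) 0 *: r1 G (gam G (v 0 0)).
    by rewrite [LHS](orthonormal_expand _ u1) -/(Phi2 _ _ _ _ _ _) Phi20 scale0r addr0.
  rewrite -scaleNr; congr (_ *: _).
  (* The quotient formula for [Q] requires [Z != sg]; when [sg = 0] both sides vanish because
     [phi t xi 0 0 = xi]. *)
  have [v10|v10] := eqVneq (v 0 1) 0.
    rewrite v10 mul0r /Phi1; move: (phiE); rewrite v10 => ->.
    by rewrite subrr dotE !mxE !mulr0 addr0 oppr0.
  by rewrite QE 1?eq_sym // sub0r; field.
pose t1 := tau G xi0; pose t2 := tau G xi0 + d / 2.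
have [|a1 h1] := hc t1; first by rewrite subrr normr0.
have [|a2 h2] := hc t2.
  rewrite addrAC subrr add0r gtr0_norm ?divr_gt0 //.
  by rewrite ltr_pdivrMr // mulr_natr mulr2n ltrDl.
have t12 : t2 - t1 != 0 by rewrite /t2 /t1 addrAC subrr add0r gt_eqF // divr_gt0.
(* The position is affine in [t], so its value at time 0 is this combination of the values at [t1]
   and [t2]. *)
apply: (@vanalytic_near_eq _ _ _ (fun v => (t2 - t1)^-1 *: (t2 *: c t1 v + (- t1) *: c t2 v))).
  near=> v.
  have <- : chr G t1 (v 0 0) (v 0 1) = c t1 v by near: v.
  have <- : chr G t2 (v 0 0) (v 0 1) = c t2 v by near: v.
  rewrite /chr /of_row2; set x := flow _ _ _; set y := vel _ _.
  by apply/rowP => j; rewrite !mxE; field.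
apply: vanalyticZ; first exact: analytic_cst.
by apply: vanalyticD; apply: vanalyticZ => //; exact: analytic_cst.
Unshelve. all: by end_near. Qed.

End Gas.

(** * Derivatives along parameterized curves *)

Section Curves.
Context {R : realType}.

Lemma is_derive_cvg (V W : normedModType R) (f : V -> W) a v l :
  is_derive a v f l ->
  (fun h : R => h^-1 *: ((f \o shift a) (h *: v) - f a)) @ 0^' --> l.
Proof.
by move=> h; rewrite -(@derive_val _ _ _ _ _ _ _ h); exact: (@ex_derive _ _ _ _ _ _ _ h).
Qed.

Lemma is_derive_coord (V : normedModType R) n m (f : V -> 'M[R]_(n, m)) a v l i j :
  is_derive a v f l -> is_derive a v (fun x => f x i j) (l i j).
Proof.
move=> h; have df : derivable f a v := @ex_derive _ _ _ _ _ _ _ h.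
apply: DeriveDef; first exact: (derivable_mxP _ _ _).1 df i j.
by rewrite -(@derive_val _ _ _ _ _ _ _ h) derive_mx // mxE.
Qed.

Lemma is_derive_dot (f : R -> 'rV[R]_2) (a : R) (l n : 'rV[R]_2) :
  is_derive a 1 f l -> is_derive a 1 (fun x => dot n (f x)) (dot n l).
Proof.
move=> /is_derive_cvg h.
have cn : {for l, continuous (dot n)}.
  apply: analytic_continuous; apply: analytic_dot => j.
  - exact: analytic_cst.
  - exact: analytic_coord.
have h2 : (fun t : R => dot n (t^-1 *: ((f \o shift a) (t *: 1) - f a))) @ 0^' --> dot n l.
  exact: (cvg_comp _ _ h cn).
have h3 : (fun t : R =>
    t^-1 *: (((fun x => dot n (f x)) \o shift a) (t *: 1) - dot n (f a))) @ 0^' --> dot n l.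
  by apply: cvg_near_eq h2 _; near=> t; rewrite dotZr dotBr.
apply: DeriveDef; first by apply/cvg_ex; exists (dot n l).
exact: cvg_lim h3.
Unshelve. all: by end_near. Qed.

Lemma is_derive_jacobian n m (f : 'rV[R]_n -> 'rV[R]_m) (g : R -> 'rV[R]_n) (a : R) l :
  is_derive a 1 g l -> vanalytic_at f (g a) ->
  is_derive a 1 (fun x => f (g x)) (l *m 'J f (g a)).
Proof.
move=> hg /vanalytic_differentiable df.
have dg : differentiable g a by apply/derivable1_diffP; exact: (@ex_derive _ _ _ _ _ _ _ hg).
have dfg : differentiable (f \o g) a by exact: differentiable_comp.
apply: DeriveDef; first exact/derivable1_diffP.
rewrite -[X in 'D_1 X a]/(f \o g) deriveE // diff_comp //= -(deriveE _ dg).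
by rewrite (@derive_val _ _ _ _ _ _ _ hg) /jacobian mul_rV_lin1.
Qed.

Lemma is_derive_analytic (f : R -> R) a : analytic_at (of_row1 f) (row_of [:: a]) ->
  exists l, is_derive a 1 f l.
Proof.
move=> /analytic_expand[h ah hE]; exists (h 0 (row_of [:: a])).
have c : (fun t : R => row_of [:: t + a] : 'rV[R]_1) @ (0 : R) --> (row_of [:: a] : 'rV[R]_1).
  have c0 : (fun t : R => t + a) @ (0 : R) --> a.
    by rewrite -[X in _ --> X]add0r; apply: cvgD; [exact: cvg_id|exact: cvg_cst].
  exact: (cvg_comp _ _ c0 (@cvg_row1 R a)).
apply: (@is_derive_secant _ _ _ _ _ _ (fun t => h 0 (row_of [:: t + a]))).
  have hE' : \forall t \near (0 : R), of_row1 f (row_of [:: t + a]) =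
      of_row1 f (row_of [:: a]) + \sum_i ((row_of [:: t + a] : 'rV[R]_1) 0 i -
        (row_of [:: a] : 'rV[R]_1) 0 i) * h i (row_of [:: t + a]) := c _ hE.
  apply: filterS hE' => t.
  by rewrite /of_row1 big_ord1 !mxE /= addrK [t *: _]mulr1.
apply: cvg_dnbhs; apply: (cvg_comp _ _ c); exact: analytic_continuous.
Qed.

Lemma is_derive_vanalytic n (f : R -> 'rV[R]_n) a :
  vanalytic_at (of_row1 f) (row_of [:: a]) -> is_derive a 1 f (derive1 f a).
Proof.
move=> hf; suff [l hl] : exists l, is_derive a 1 f l.
  by rewrite derive1E (@derive_val _ _ _ _ _ _ _ hl).
have /choice[l hl] : forall j, exists l, is_derive a 1 (fun x => f x 0 j) l.
  by move=> j; exact: (@is_derive_analytic (fun x => f x 0 j) a (hf j)).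
exists (\row_j l j); apply: is_derive_mx => i j; rewrite ord1 mxE; exact: hl.
Qed.

End Curves.

(** * The foot point as an analytic function *)

Section Path.
Context {R : realType} (G : gas_data R).
Context (hA1 : gas_A1 G) (hframe : gas_frame G) (hcurve : gas_curve G)
  (hflow : gas_flow G) (homega : gas_omega G).
Context (phi Q : R -> R -> R -> R -> R) (beta0 beta1 : R -> R -> R -> R)
  (Z : bool -> R -> R -> R -> R).

(* The substitution [t = tau xi + s^2], [v = (xi, st, s)], under which both
   roots [Z] become one analytic function, the sign being that of [s]. *)
Definition path_time (v : 'rV[R]_3) : R := tau G (v 0 0) + v 0 2 ^+ 2.
(** The root [path_Z] divided by [s], a function of its own because it is the speed that enters the
    limits. *)
Definition path_slope (v : 'rV[R]_3) : R :=
  v 0 2 * beta0 (path_time v) (v 0 0) (v 0 1) + beta1 (path_time v) (v 0 0) (v 0 1).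
Definition path_Z (v : 'rV[R]_3) : R := v 0 2 * path_slope v.
Definition path_xi (v : 'rV[R]_3) : R :=
  phi (path_time v) (v 0 0) (v 0 2 ^+ 2 * v 0 1) (path_Z v).
Definition path_X (v : 'rV[R]_3) : 'rV[R]_2 := flow G (path_xi v) (path_Z v).

Section AtPoint.
Context (xi0 st0 : R) (hxi0 : itv G xi0) (hphi : phi_spec G xi0 phi)
  (hQ : quotient_spec G xi0 phi Q)
  (hZ : root_spec G xi0 st0 Q beta0 beta1 Z).

Let v0 : 'rV[R]_3 := row_of [:: xi0; st0; 0].
(** Only [s] varies: the leading coefficients are obtained as limits along this line. *)
Let line (s : R) : 'rV[R]_3 := row_of [:: xi0; st0; s].

Let v00 : v0 0 0 = xi0. Proof. by rewrite mxE. Qed.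
Let v01 : v0 0 1 = st0. Proof. by rewrite mxE. Qed.
Let v02 : v0 0 2 = 0. Proof. by rewrite mxE. Qed.

Lemma path_time0 : path_time v0 = tau G xi0.
Proof. by rewrite /path_time v00 v02 expr0n addr0. Qed.

Lemma path_Z0 : path_Z v0 = 0.
Proof. by rewrite /path_Z v02 mul0r. Qed.

Lemma root_spec_center : [/\
  analytic_at (of_row3 beta0) (row_of [:: tau G xi0; xi0; st0]),
  analytic_at (of_row3 beta1) (row_of [:: tau G xi0; xi0; st0]) &
  beta1 (tau G xi0) xi0 st0 = Num.sqrt (c1 G xi0)].
Proof.
have [d d0 h] := hZ; have [] := h (tau G xi0) xi0 st0; rewrite ?subrr ?normr0 //.
by move=> ? ? /(_ erefl).
Qed.

Lemma phi_spec_center :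
  analytic_at (of_row4 phi) (row_of [:: tau G xi0; xi0; 0; 0]) /\
  phi (tau G xi0) xi0 0 0 = xi0.
Proof.
have [d d0 h] := hphi; have [] := h (tau G xi0) xi0 0 0; rewrite ?subrr ?normr0 //.
Qed.

Lemma path_slope0 : path_slope v0 = Num.sqrt (c1 G xi0).
Proof.
have [_ _ h] := root_spec_center.
by rewrite /path_slope path_time0 v00 v01 v02 mul0r add0r.
Qed.

Lemma path_xi0 : path_xi v0 = xi0.
Proof.
have [_ h] := phi_spec_center.
by rewrite /path_xi path_time0 path_Z0 v00 v01 v02 expr0n mul0r.
Qed.

Lemma path_X0 : path_X v0 = gam G xi0.
Proof. by rewrite /path_X path_xi0 path_Z0 (flow0 hflow). Qed.

Lemma analytic_path_time : analytic_at path_time v0.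
Proof.
apply: analyticD.
  apply: (@analytic_comp1 _ _ _ (tau G)); last exact: analytic_coord.
  by rewrite v00; exact: analytic_tau.
by apply: analyticX; exact: analytic_coord.
Qed.

Lemma analytic_path_slope : analytic_at path_slope v0.
Proof.
have [h0 h1 _] := root_spec_center.
have at_ := analytic_path_time.
apply: analyticD.
  apply: analyticM; first exact: analytic_coord.
  apply: (@analytic_comp3 _ _ _ beta0) => //; rewrite ?path_time0 ?v00 ?v01 //;
    exact: analytic_coord.
apply: (@analytic_comp3 _ _ _ beta1) => //; rewrite ?path_time0 ?v00 ?v01 //;
  exact: analytic_coord.
Qed.

Lemma analytic_path_Z : analytic_at path_Z v0.
Proof. by apply: analyticM; [exact: analytic_coord|exact: analytic_path_slope]. Qed.

Lemma analytic_path_xi : analytic_at path_xi v0.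
Proof.
have [h _] := phi_spec_center.
apply: (@analytic_comp4 _ _ _ phi path_time (fun v => v 0 0)
  (fun v => v 0 2 ^+ 2 * v 0 1) path_Z).
- by rewrite path_time0 path_Z0 v00 v01 v02 expr0n mul0r.
- exact: analytic_path_time.
- exact: analytic_coord.
- by apply: analyticM; [apply: analyticX|]; exact: analytic_coord.
- exact: analytic_path_Z.
Qed.

Lemma vanalytic_path_X : vanalytic_at path_X v0.
Proof.
move=> j; have h := vanalytic_flow hA1 hframe hcurve hflow hxi0 hphi hQ j.
apply: (@analytic_comp2 _ _ _ (fun x y => flow G x y 0 j)).
- by rewrite path_xi0 path_Z0.
- exact: analytic_path_xi.
- exact: analytic_path_Z.
Qed.

Let tau_gt0' : 0 < tau G xi0. Proof. exact: tau_gt0. Qed.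
Let tau_lam1 : 1 + tau G xi0 * lam1 G (gam G xi0) = 0.
Proof.
rewrite (tauE hflow) // (lam1_gam hflow) // mulrN mulVf ?subrr //.
by rewrite gt_eqF // om1_gt0.
Qed.
Let normal := rot90 (r1 G (gam G xi0)).

Lemma tau_lam2 : 1 + tau G xi0 * lam2 G (gam G xi0) =
  tau G xi0 * (lam2 G (gam G xi0) - lam1 G (gam G xi0)).
Proof. by move: tau_lam1 => h; rewrite -[1](addrK (tau G xi0 * lam1 G (gam G xi0))) h; ring. Qed.

Lemma lam_gap : 0 < lam2 G (gam G xi0) - lam1 G (gam G xi0).
Proof.
rewrite subr_gt0; apply: lam1_lt_lam2 => //.
by apply: (frame_sub hframe); exact: gam_frame.
Qed.

(** This is the derivative of [Phi2] in [xi'] at the centre. At time [tau] the differential of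
    [x + t w(x)] annihilates the [r1] component of the tangent and multiplies its [r2] component by
    [1 + tau lam2 > 0]; the latter component is nonzero because the curve is transversal to [r1]. *)
Lemma transversal_chr : dot normal (derive1 (gam G) xi0 +
  tau G xi0 *: (derive1 (gam G) xi0 *m 'J (vel G) (gam G xi0))) != 0.
Proof.
have fx := gam_frame hcurve hxi0; set g := derive1 (gam G) xi0.
have u1 := r1_unit hframe fx; have u2 := r2_unit hframe fx.
have E1 := r1_eigen hframe fx; have E2 := r2_eigen hframe fx.
have l12 : lam1 G (gam G xi0) != lam2 G (gam G xi0).
  by have := lam_gap; rewrite subr_gt0 => /lt_eqF ->.
have n2 := eigen_independent u1 u2 E1 E2 l12; rewrite -/normal in n2.
have ng : dot normal g != 0.
  apply/eqP => ng0; apply: (gam_transversal hcurve hxi0).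
  exists (dot (r1 G (gam G xi0)) g).
  by rewrite [LHS](orthonormal_expand _ u1) -/normal ng0 scale0r addr0.
pose b := dot normal g / dot normal (r2 G (gam G xi0)).
pose a := dot (r1 G (gam G xi0)) (g - b *: r2 G (gam G xi0)).
have gE : g = a *: r1 G (gam G xi0) + b *: r2 G (gam G xi0).
  apply/eqP; rewrite -subr_eq; apply/eqP.
  rewrite [LHS](orthonormal_expand _ u1) -/normal -/a dotBr dotZr /b.
  by rewrite divfK // subrr scale0r addr0.
have gJ : g + tau G xi0 *: (g *m 'J (vel G) (gam G xi0)) =
    (b * (1 + tau G xi0 * lam2 G (gam G xi0))) *: r2 G (gam G xi0).
  rewrite {1 2}gE mulmxDl -!scalemxAl E1 E2.
  set A := r1 _ _; set B := r2 _ _; apply/rowP => j; rewrite !mxE.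
  have -> : lam1 G (gam G xi0) = - (tau G xi0)^-1 by rewrite /tau invrN opprK invrK.
  by field; rewrite gt_eqF.
rewrite gJ dotZr tau_lam2 /b mulrAC divfK // mulf_neq0 // mulf_neq0 ?gt_eqF //.
exact: lam_gap.
Qed.

Let cvg_line : line @ (0 : R) --> v0.
Proof.
apply: cvg_mx => i j; rewrite ord1 [X in _ --> X]mxE; under eq_fun do rewrite mxE.
by case: j => [[|[|[|//]]] h] /=; [exact: cvg_cst|exact: cvg_cst|exact: cvg_id].
Qed.

Let cvg_analytic_line f : analytic_at f v0 -> f (line s) @[s --> (0 : R)] --> f v0.
Proof. by move=> hf; exact: (cvg_comp _ _ cvg_line (analytic_continuous hf)). Qed.

(** The parameters [Z] and [sigma] of the two ends of the arc of integral curve are both O(s); one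
    constant for both lets the mean value inequality be applied on a single interval. *)
Lemma slope_bound : exists2 D, 0 < D & \forall s \near (0 : R),
  `|path_Z (line s)| <= D * `|s| /\ `|s ^+ 2 * st0| <= D * `|s|.
Proof.
pose D := `|path_slope v0| + 1 + `|st0|.
have D0 : 0 < D by rewrite /D -addrA ltr_wpDl // ltr_wpDr.
exists D => //.
have h1 : \forall s \near (0 : R), `|path_slope v0 - path_slope (line s)| <= 1.
  by have /cvgrPdist_le := cvg_analytic_line analytic_path_slope; apply.
have h2 : \forall s \near (0 : R), `|s - 0| < 1 by exact: near_dist.
near=> s.
have s1 : `|s - 0| < 1 by near: s.
have sl : `|path_slope v0 - path_slope (line s)| <= 1 by near: s.
have ns := normr_ge0 s; have nst := normr_ge0 st0.
split.
  rewrite /path_Z normrM mxE /= mulrC ler_wpM2r //.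
  have : `|path_slope (line s)| <= `|path_slope v0| +
      `|path_slope v0 - path_slope (line s)|.
    by rewrite -{1}[path_slope (line s)](subKr (path_slope v0)) ler_normB.
  rewrite /D; lra.
rewrite subr0 in s1.
rewrite normrM normrX expr2 -mulrA mulrC ler_wpM2r // (le_trans (y := `|st0|)) //.
  by rewrite ler_piMl // ltW.
by rewrite /D lerDr addr_ge0.
Unshelve. all: by end_near. Qed.

(* On the integral curve [1 + t lam1 = O(s^2)] at distance [O(s)], so the motion
   normal to [r1] is of third order. *)
Lemma chr_cubic : exists C, \forall s \near (0 : R),
  `|dot normal (chr G (path_time (line s)) xi0 (path_Z (line s)))
    - dot normal (chr G (path_time (line s)) xi0 (s ^+ 2 * st0))| <= C * `|s| ^+ 3.
Proof.
have fx := gam_frame hcurve hxi0.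
have [e e0 he] := hflow hxi0.
have [q [cq q0 hq]] := lam1_flow homega hxi0.
pose K := `|q 0| + 1.
have nq : \forall x \near (0 : R), `|q x| <= K.
  have : \forall x \near (0 : R), `|q 0 - q x| <= 1 by have /cvgrPdist_le := cq; apply.
  apply: filterS => x; have : `|q x| <= `|q 0| + `|q 0 - q x|.
    by rewrite -{1}[q x](subKr (q 0)) ler_normB.
  by rewrite /K; lra.
have [dl dl0 hdl] : exists2 dl, 0 < dl & forall x, `|x| <= dl ->
    [/\ `|x| < e, lam1 G (flow G xi0 x) = - om G 1 xi0 + x ^+ 2 * q x & `|q x| <= K].
  have : \forall x \near (0 : R), [/\ `|x| < e,
      lam1 G (flow G xi0 x) = - om G 1 xi0 + x ^+ 2 * q x & `|q x| <= K].
    near=> x; split; try by near: x.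
    by rewrite -[x]subr0; near: x; exact: near_dist.
  move=> /nbhs_ballP[r /= r0 hr]; exists (r / 2); first by rewrite divr_gt0.
  move=> x xr; apply: hr; rewrite /ball /= sub0r normrN (le_lt_trans xr) //.
  by rewrite ltr_pdivrMr // mulr_natr mulr2n ltrDl.
have [D D0 hD] := slope_bound.
have o1 := om1_gt0 homega hxi0.
have tau1 : tau G xi0 * om G 1 xi0 = 1 by rewrite (tauE hflow) // mulVf // gt_eqF.
(* The first factor bounds the normal speed divided by [s ^+ 2], the second the length of the
   parameter interval divided by [|s|]. *)
exists ((om G 1 xi0 + (tau G xi0 + 1) * (D ^+ 2 * K)) * (2 * D)).
have ns1 : \forall s \near (0 : R), `|s - 0| < Num.min 1 (dl / D).
  by apply: near_dist; rewrite lt_min ltr01 divr_gt0.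
near=> s.
have : `|s - 0| < Num.min 1 (dl / D) by near: s.
rewrite subr0 lt_min ltr_pdivlMr // => /andP[s1 sD'].
have sD : D * `|s| <= dl by rewrite mulrC ltW.
have [Zb sgb] : `|path_Z (line s)| <= D * `|s| /\ `|s ^+ 2 * st0| <= D * `|s|.
  by near: s.
set T := path_time (line s).
have TE : T = tau G xi0 + s ^+ 2 by rewrite /T /path_time !mxE.
have s2 : s ^+ 2 = `|s| ^+ 2 by rewrite real_normK ?num_real.
have K0 : 0 <= K by rewrite addr_ge0.
have T0 : 0 <= T <= tau G xi0 + 1.
  rewrite TE addr_ge0 ?sqr_ge0 ?(ltW tau_gt0') // lerD2l s2.
  by rewrite expr_le1 // ltW.
(* On the arc [1 + T lam1 = - s^2 om1 + T x^2 q(x)], because [tau om1 = 1]; the bound uses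
   [|x| <= D |s|], [|q x| <= K] and [T <= tau + 1]. *)
pose B := s ^+ 2 * (om G 1 xi0 + (tau G xi0 + 1) * (D ^+ 2 * K)).
have hder (x : R) : `|x| <= D * `|s| -> is_derive x 1
    (fun y => dot normal (chr G T xi0 y))
    ((1 + T * lam1 G (flow G xi0 x)) * dot normal (r1 G (flow G xi0 x))).
  move=> xD; have [xe _ _] := hdl x (le_trans xD sD).
  have [_ ffx dfx] : [/\ flow G xi0 0 = gam G xi0, frame_dom G (flow G xi0 x) &
      is_derive x 1 (flow G xi0) (r1 G (flow G xi0 x))].
    by apply: he => //; rewrite subrr normr0.
  have avx := vel_analytic hA1 (frame_sub hframe ffx).
  have := is_deriveD dfx (is_deriveZ T (is_derive_jacobian dfx avx)).
  move=> /(is_derive_dot normal).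
  rewrite (r1_eigen hframe ffx) scalerA -{1}[r1 _ _]scale1r -scalerDl dotZr.
  exact.
have hbd (x : R) : `|x| <= D * `|s| ->
    `|(1 + T * lam1 G (flow G xi0 x)) * dot normal (r1 G (flow G xi0 x))| <= B.
  move=> xD; have [xe -> qK] := hdl x (le_trans xD sD).
  have [_ ffx _] : [/\ flow G xi0 0 = gam G xi0, frame_dom G (flow G xi0 x) &
      is_derive x 1 (flow G xi0) (r1 G (flow G xi0 x))].
    by apply: he => //; rewrite subrr normr0.
  have n1 : `|dot normal (r1 G (flow G xi0 x))| <= 1.
    by apply: dot_rot90_bound; exact: (r1_unit hframe).
  rewrite normrM -[B]mulr1 ler_pM //.
  have -> : 1 + T * (- om G 1 xi0 + x ^+ 2 * q x) =
      - (s ^+ 2 * om G 1 xi0) + T * (x ^+ 2 * q x).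
    by rewrite -{1}tau1 TE; ring.
  rewrite (le_trans (ler_normD _ _)) // normrN /B mulrDr lerD //.
    by rewrite ger0_norm // mulr_ge0 ?sqr_ge0 // ltW.
  rewrite [leRHS]mulrCA normrM [`|_ * q x|]normrM; apply: ler_pM; rewrite ?mulr_ge0 //.
    by case/andP: T0 => ? ?; rewrite ger0_norm.
  rewrite mulrA; apply: ler_pM => //.
  by rewrite normrX s2 -exprMn mulrC lerXn2r ?nnegrE // mulr_ge0 // ltW.
have := lipschitz_is_derive hder hbd Zb sgb.
move/le_trans; apply; rewrite [leRHS](_ : _ = B * (2 * D * `|s|)); last first.
  by rewrite /B s2; ring.
have sn := normr_ge0 s.
have B0 : 0 <= B.
  rewrite /B mulr_ge0 ?sqr_ge0 // addr_ge0 ?(ltW o1) // mulr_ge0 ?mulr_ge0 ?(ltW D0) //.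
  by rewrite addr_ge0 // ltW.
apply: ler_wpM2l => //; apply: le_trans (ler_normB _ _) _.
by rewrite -mulrA mulr_natl mulr2n lerD.
Unshelve. all: by end_near. Qed.

(** The equation [Phi2 = 0] balances the displacement of the foot along the curve against the cubic
    normal motion; the displacement enters with a factor [h], nonzero at the centre by
    transversality. *)
Lemma path_xi_cubic : exists C, \forall s \near (0 : R),
  `|path_xi (line s) - xi0| <= C * `|s| ^+ 3.
Proof.
pose u (w : 'rV[R]_3) := dot normal (chr G (w 0 0) (w 0 1) (w 0 2)).
pose w0 : 'rV[R]_3 := row_of [:: tau G xi0; xi0; 0].
have w01 : w0 0 1 = xi0 by rewrite mxE.
have w02 : w0 0 2 = 0 by rewrite mxE.
have fx := gam_frame hcurve hxi0.
have av := vel_analytic hA1 (frame_sub hframe fx).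
have aflow := vanalytic_flow hA1 hframe hcurve hflow hxi0 hphi hQ.
have afw : vanalytic_at (fun w : 'rV[R]_3 => flow G (w 0 1) (w 0 2)) w0.
  move=> j; apply: (@analytic_comp2 _ _ _ (fun x y => flow G x y 0 j)).
  - by rewrite w01 w02; exact: aflow.
  - exact: analytic_coord.
  - exact: analytic_coord.
have au : analytic_at u w0.
  apply: analytic_dot => [j|]; first exact: analytic_cst.
  apply: vanalyticD => //; apply: vanalyticZ; first exact: analytic_coord.
  by apply: vanalytic_comp afw; rewrite w01 w02 (flow0 hflow).
have [h ah hE] := analytic_hadamard 1 au.
(* [h w0] is the derivative of [u] along the curve. *)
have h0 : h w0 != 0.
  pose c (s : R) : 'rV[R]_3 := row_of [:: tau G xi0; s + xi0; 0].
  have c0 : (fun s : R => s + xi0) @ (0 : R) --> xi0.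
    by rewrite -[X in _ --> X]add0r; apply: cvgD; [exact: cvg_id|exact: cvg_cst].
  have cc : c @ (0 : R) --> w0.
    apply: cvg_mx => i j; rewrite ord1 [X in _ --> X]mxE; under eq_fun do rewrite mxE.
    case: j => [[|[|[|//]]] hj] /=; [exact: cvg_cst|exact: c0|exact: cvg_cst].
  have hd1 : is_derive xi0 1 (fun x => dot normal (gam G x + tau G xi0 *: vel G (gam G x)))
      (h w0).
    apply: (@is_derive_secant _ _ _ _ _ _ (fun s => h (c s))); last first.
      by apply: cvg_dnbhs; exact: (cvg_comp _ _ cc (analytic_continuous ah)).
    have hE' : \forall s \near (0 : R), u (c s) = u (setc (c s) 1 (w0 0 1)) +
      (c s 0 1 - w0 0 1) * h (c s) := cc _ hE.
    have ni : \forall s \near (0 : R), itv G (s + xi0).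
      by have := near_itv hcurve hxi0; rewrite (near_shift 0) subr0.
    near=> s.
    have is_ : itv G (s + xi0) by near: s.
    have : u (c s) = u (setc (c s) 1 (w0 0 1)) + (c s 0 1 - w0 0 1) * h (c s) by near: s.
    rewrite /u /chr !mxE /= addrK !(flow0 hflow) // => E.
    by rewrite [s *: 1]mulr1 E.
  have hd2 : is_derive xi0 1 (fun x => dot normal (gam G x + tau G xi0 *: vel G (gam G x)))
      (dot normal (derive1 (gam G) xi0 +
        tau G xi0 *: (derive1 (gam G) xi0 *m 'J (vel G) (gam G xi0)))).
    apply: is_derive_dot.
    have hg := is_derive_vanalytic (gam_analytic hcurve hxi0).
    apply: is_deriveD; apply: is_deriveZ.
    exact: is_derive_jacobian.
  rewrite -(@derive_val _ _ _ _ _ _ _ hd1) (@derive_val _ _ _ _ _ _ _ hd2).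
  exact: transversal_chr.
have [C hC] := chr_cubic.
(* Near the centre [|h|] is at least half of its value there. *)
exists (C * (2 / `|h w0|)).
pose pw (s : R) : 'rV[R]_3 :=
  row_of [:: path_time (line s); path_xi (line s); path_Z (line s)].
have cpw : pw @ (0 : R) --> w0.
  apply: cvg_mx => i j; rewrite ord1 [X in _ --> X]mxE; under eq_fun do rewrite mxE.
  case: j => [[|[|[|//]]] hj] /=.
  - by have := cvg_analytic_line analytic_path_time; rewrite path_time0; exact.
  - by have := cvg_analytic_line analytic_path_xi; rewrite path_xi0; exact.
  - by have := cvg_analytic_line analytic_path_Z; rewrite path_Z0; exact.
have hE' : \forall s \near (0 : R), u (pw s) = u (setc (pw s) 1 (w0 0 1)) +
      (pw s 0 1 - w0 0 1) * h (pw s) := cpw _ hE.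
have hh : \forall s \near (0 : R), `|h w0| / 2 <= `|h (pw s)|.
  have : \forall s \near (0 : R), `|h w0 - h (pw s)| <= `|h w0| / 2.
    have c1 := cvg_comp _ _ cpw (analytic_continuous ah).
    by have /cvgrPdist_le := c1; apply; rewrite divr_gt0 // normr_gt0.
  apply: filterS => s; have : `|h w0| <= `|h (pw s)| + `|h w0 - h (pw s)|.
    by rewrite -{1}[h w0](subrK (h (pw s))) addrC ler_normD.
  by rewrite [X in _ <= X / 2 -> _]splitr; lra.
have [d d0 hd] := hphi.
have nT : \forall s \near (0 : R), `|path_time (line s) - tau G xi0| < d.
  have c1 := cvg_analytic_line analytic_path_time; rewrite path_time0 in c1.
  exact: (c1 _ (near_dist _ d0)).
have nZ : \forall s \near (0 : R), `|path_Z (line s) - 0| < d.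
  have c1 := cvg_analytic_line analytic_path_Z; rewrite path_Z0 in c1.
  exact: (c1 _ (near_dist _ d0)).
have nsg : \forall s \near (0 : R), `|s ^+ 2 * st0 - 0| < d.
  have af : analytic_at (fun v : 'rV[R]_3 => v 0 2 ^+ 2 * v 0 1) v0.
    by apply: analyticM; [apply: analyticX|]; exact: analytic_coord.
  have c1 := cvg_analytic_line af; rewrite v02 expr0n mul0r in c1.
  have c2 : \forall s \near (0 : R), `|line s 0 2 ^+ 2 * line s 0 1 - 0| < d :=
    c1 _ (near_dist _ d0).
  by apply: filterS c2 => s; rewrite !mxE.
near=> s.
have [_ P2 _] : [/\ analytic_at (of_row4 phi)
      (row_of [:: path_time (line s); xi0; s ^+ 2 * st0; path_Z (line s)]),
    Phi2 G (path_time (line s)) xi0 (s ^+ 2 * st0) (phi (path_time (line s)) xi0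
      (s ^+ 2 * st0) (path_Z (line s))) (path_Z (line s)) = 0 &
    phi (path_time (line s)) xi0 (s ^+ 2 * st0) (s ^+ 2 * st0) = xi0].
  by apply: hd; rewrite ?subrr ?normr0 //; near: s.
have pxE : phi (path_time (line s)) xi0 (s ^+ 2 * st0) (path_Z (line s)) = path_xi (line s).
  by rewrite /path_xi !mxE.
rewrite pxE /Phi2 dotBr -/normal in P2.
have Es : u (pw s) = u (setc (pw s) 1 (w0 0 1)) + (pw s 0 1 - w0 0 1) * h (pw s).
  by near: s.
have Cs : `|dot normal (chr G (path_time (line s)) xi0 (path_Z (line s)))
    - dot normal (chr G (path_time (line s)) xi0 (s ^+ 2 * st0))| <= C * `|s| ^+ 3.
  by near: s.
have hs : `|h w0| / 2 <= `|h (pw s)| by near: s.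
rewrite /u !mxE /= in Es.
have hw : 0 < `|h w0| by rewrite normr_gt0.
have -> : C * (2 / `|h w0|) * `|s| ^+ 3 = C * `|s| ^+ 3 / (`|h w0| / 2).
  by field; rewrite normr_eq0.
rewrite ler_pdivlMr ?divr_gt0 //; apply: le_trans Cs; rewrite [leRHS]distrC.
apply: (@le_trans _ _ (`|path_xi (line s) - xi0| * `|h (pw s)|)).
  by apply: ler_wpM2l.
rewrite -normrM; set A := _ * h _; suff -> : A = dot normal
  (chr G (path_time (line s)) xi0 (s ^+ 2 * st0)) - dot normal
  (chr G (path_time (line s)) xi0 (path_Z (line s))) by [].
by rewrite -(subr0_eq P2) Es /A; ring.
Unshelve. all: by end_near. Qed.

(* Consequently the displacement along the curve does not contribute to the
   limits below. *)
Lemma path_xi_quotient k : (k <= 2)%N ->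
  ((path_xi (line s) - xi0) / s ^+ k) @[s --> 0^'] --> (0 : R).
Proof.
move=> k2; have [C hC] := path_xi_cubic.
apply/cvgr0Pnorm_le => e e0.
have n1 : \forall s \near (0 : R), `|s - 0| < Num.min 1 (e / (`|C| + 1)).
  by apply: near_dist; rewrite lt_min ltr01 divr_gt0 // ltr_wpDl.
have n1' := nbhs_dnbhs n1; have hC' := nbhs_dnbhs hC.
near=> s; have sn0 : s != 0 by near: s; exact: nbhs_dnbhs_neq.
have : `|s - 0| < Num.min 1 (e / (`|C| + 1)) by near: s.
have : `|path_xi (line s) - xi0| <= C * `|s| ^+ 3 by near: s.
set a := `|path_xi (line s) - xi0| => aC.
have C1 : 0 < `|C| + 1 by rewrite ltr_wpDl.
rewrite subr0 lt_min ltr_pdivlMr // => /andP[s1 se].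
have ns : 0 < `|s| by rewrite normr_gt0.
rewrite normrM normfV normrX ler_pdivrMr ?exprn_gt0 //.
apply: (@le_trans _ _ (`|C| * `|s| ^+ 3)).
  by rewrite (le_trans aC) // ler_wpM2r ?exprn_ge0 // ler_norm.
have -> : `|s| ^+ 3 = `|s| * (`|s| ^+ (2 - k) * `|s| ^+ k).
  by rewrite -exprD subnK // -exprS.
rewrite mulrA mulrA ler_wpM2r ?exprn_ge0 //.
apply: (@le_trans _ _ (`|C| * `|s| * 1)); last first.
  by rewrite mulr1 (le_trans _ (ltW se)) // mulrC ler_wpM2l //; lra.
by apply: ler_wpM2l; rewrite ?mulr_ge0 // exprn_ile1 // ltW.
Unshelve. all: by end_near. Qed.

Let p : 'rV[R]_2 := row_of [:: xi0; 0].
Let foot (s : R) : 'rV[R]_2 := row_of [:: path_xi (line s); path_Z (line s)].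
Let foot0 (s : R) : 'rV[R]_2 := row_of [:: xi0; path_Z (line s)].

Let cvg_foot : foot @ (0 : R) --> p.
Proof.
apply: cvg_mx => i j; rewrite ord1 [X in _ --> X]mxE; under eq_fun do rewrite mxE.
case: j => [[|[|//]] h] /=.
- by have := cvg_analytic_line analytic_path_xi; rewrite path_xi0; exact.
- by have := cvg_analytic_line analytic_path_Z; rewrite path_Z0; exact.
Qed.

Let cvg_foot0 : foot0 @ (0 : R) --> p.
Proof.
apply: cvg_mx => i j; rewrite ord1 [X in _ --> X]mxE; under eq_fun do rewrite mxE.
case: j => [[|[|//]] h] /=; first exact: cvg_cst.
by have := cvg_analytic_line analytic_path_Z; rewrite path_Z0; exact.
Qed.

(* An analytic function of the foot point splits into its value on the integral
   curve of [r1] through [gam xi0] and a negligible remainder. *)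
Lemma foot_split (f : 'rV[R]_2 -> R) : analytic_at f p ->
  exists2 h : R -> R, h @ 0^' --> h 0 &
    \forall s \near (0 : R), f (foot s) = f (foot0 s) + (path_xi (line s) - xi0) * h s.
Proof.
move=> af; have [h ah hE] := analytic_hadamard 0 af.
have foot00 : foot 0 = p by rewrite /foot -/v0 path_xi0 path_Z0.
exists (fun s => h (foot s)).
  by rewrite foot00; apply: cvg_dnbhs; exact: (cvg_comp _ _ cvg_foot (analytic_continuous ah)).
have hE' : \forall s \near (0 : R), f (foot s) = f (setc (foot s) 0 (p 0 0)) +
  (foot s 0 0 - p 0 0) * h (foot s) := @cvg_foot _ hE.
apply: filterS hE' => s ->; rewrite !mxE /=; congr (f _ + _).
by apply: row2P; rewrite !mxE.
Qed.

Let vanalytic_flow0 : vanalytic_at (of_row2 (flow G)) p.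
Proof. by have := vanalytic_flow hA1 hframe hcurve hflow hxi0 hphi hQ. Qed.

Let flow_p : of_row2 (flow G) p = gam G xi0.
Proof. by rewrite /of_row2 !mxE /= (flow0 hflow). Qed.

(** The difference quotient splits into the motion along the curve, which dies out by
    [path_xi_quotient], and [path_slope] times a quotient [m] whose value at the centre is the
    derivative of [w] along the flow line, that is [lam1 r1]. *)
Lemma velocity_limit j :
  ((vel G (path_X (line s)) 0 j - vel G (gam G xi0) 0 j) / s) @[s --> 0^'] -->
  Num.sqrt (c1 G xi0) * lam1 G (gam G xi0) * r1 G (gam G xi0) 0 j.
Proof.
have fx := gam_frame hcurve hxi0.
have av := vel_analytic hA1 (frame_sub hframe fx).
pose f (w : 'rV[R]_2) : R := vel G (of_row2 (flow G) w) 0 j.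
have af : analytic_at f p.
  apply: (@analytic_comp _ _ _ (fun x => vel G x 0 j) (of_row2 (flow G))) => //.
  by rewrite flow_p; exact: av.
have [h ch hE] := foot_split af.
have [m am mE] := analytic_hadamard 1 af.
have mp : m p = lam1 G (gam G xi0) * r1 G (gam G xi0) 0 j.
  pose c (s : R) : 'rV[R]_2 := row_of [:: xi0; s].
  have cc : c @ (0 : R) --> p.
    apply: cvg_mx => i k; rewrite ord1 [X in _ --> X]mxE; under eq_fun do rewrite mxE.
    by case: k => [[|[|//]] hk] /=; [exact: cvg_cst|exact: cvg_id].
  have hd1 : is_derive (0 : R) 1 (fun x => vel G (flow G xi0 x) 0 j : R) (m p).
    apply: (@is_derive_secant _ _ _ _ _ _ (fun s => m (c s))); last first.
      by apply: cvg_dnbhs; exact: (cvg_comp _ _ cc (analytic_continuous am)).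
    have mE' : \forall s \near (0 : R), f (c s) = f (setc (c s) 1 (p 0 1)) +
      (c s 0 1 - p 0 1) * m (c s) := cc _ mE.
    apply: filterS mE' => s.
    by rewrite /f /of_row2 !mxE /= subr0 [s *: 1]mulr1 addr0.
  have [e e0 he] := hflow hxi0.
  have [_ _ df] : [/\ flow G xi0 0 = gam G xi0, frame_dom G (flow G xi0 0) &
      is_derive (0 : R) 1 (flow G xi0) (r1 G (flow G xi0 0))].
    by apply: he; rewrite ?subrr normr0.
  rewrite (flow0 hflow) // in df.
  have av' : vanalytic_at (vel G) (flow G xi0 0) by rewrite (flow0 hflow).
  have hd2 := is_derive_coord 0 j (is_derive_jacobian df av').
  rewrite (flow0 hflow) // (r1_eigen hframe fx) mxE in hd2.
  by rewrite -(@derive_val _ _ _ _ _ _ _ hd1) (@derive_val _ _ _ _ _ _ _ hd2).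
have cm : m (foot0 s) @[s --> 0^'] --> m p.
  by apply: cvg_dnbhs; exact: (cvg_comp _ _ cvg_foot0 (analytic_continuous am)).
have csl : path_slope (line s) @[s --> 0^'] --> Num.sqrt (c1 G xi0).
  by rewrite -path_slope0; apply: cvg_dnbhs; apply: cvg_analytic_line; exact: analytic_path_slope.
have cl : ((path_xi (line s) - xi0) / s ^+ 1 * h s + path_slope (line s) * m (foot0 s))
    @[s --> 0^'] --> 0 * h 0 + Num.sqrt (c1 G xi0) * m p.
  by apply: cvgD; apply: cvgM => //; exact: path_xi_quotient.
rewrite mul0r add0r mp mulrA in cl.
apply: cvg_near_eq cl _.
have hE' := nbhs_dnbhs hE.
have mE' : \forall s \near (0 : R), f (foot0 s) = f (setc (foot0 s) 1 (p 0 1)) +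
  (foot0 s 0 1 - p 0 1) * m (foot0 s) := @cvg_foot0 _ mE.
have mE'' := nbhs_dnbhs mE'.
near=> s; have s0 : s != 0 by near: s; exact: nbhs_dnbhs_neq.
have E1 : f (foot s) = f (foot0 s) + (path_xi (line s) - xi0) * h s by near: s.
have : f (foot0 s) = f (setc (foot0 s) 1 (p 0 1)) +
  (foot0 s 0 1 - p 0 1) * m (foot0 s) by near: s.
have -> : setc (foot0 s) 1 (p 0 1) = p by apply: row2P; rewrite !mxE.
have -> : foot0 s 0 1 - p 0 1 = path_Z (line s) by rewrite !mxE subr0.
have -> : f p = vel G (gam G xi0) 0 j by rewrite /f flow_p.
move=> E2.
have -> : vel G (path_X (line s)) 0 j = f (foot s).
  by rewrite /f /of_row2 !mxE.
have ZE : path_Z (line s) = s * path_slope (line s) by rewrite /path_Z mxE.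
by rewrite E1 E2 ZE expr1; field.
Unshelve. all: by end_near. Qed.

(** The displacement of [xi] is negligible even after division by [s ^+ 2], so in the factor
    [1 + t lam1] the eigenvalue may be expanded along the integral curve through [gam xi0]; the
    factor [1 + t lam2] tends to [tau (lam2 - lam1)]. *)
Lemma det_limit :
  (\det (1%:M + path_time (line s) *: 'J (vel G) (path_X (line s))) / s ^+ 2)
    @[s --> 0^'] --> 2 * (lam2 G (gam G xi0) - lam1 G (gam G xi0)).
Proof.
have fx := gam_frame hcurve hxi0.
have [q [cq q0 hq]] := lam1_flow homega hxi0.
pose f (w : 'rV[R]_2) := lam1 G (of_row2 (flow G) w).
have af : analytic_at f p.
  apply: (@analytic_comp _ _ _ (lam1 G) (of_row2 (flow G))) => //.
  by rewrite flow_p; exact: analytic_lam1.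
pose f2 (w : 'rV[R]_2) := lam2 G (of_row2 (flow G) w).
have af2 : analytic_at f2 p.
  apply: (@analytic_comp _ _ _ (lam2 G) (of_row2 (flow G))) => //.
  by rewrite flow_p; exact: analytic_lam2.
have [h ch hE] := foot_split af.
have cT : path_time (line s) @[s --> 0^'] --> tau G xi0.
  by rewrite -path_time0; apply: cvg_dnbhs; apply: cvg_analytic_line; exact: analytic_path_time.
have csl : path_slope (line s) @[s --> 0^'] --> Num.sqrt (c1 G xi0).
  by rewrite -path_slope0; apply: cvg_dnbhs; apply: cvg_analytic_line; exact: analytic_path_slope.
have cZ : path_Z (line s) @[s --> (0 : R)] --> (0 : R).
  by have := cvg_analytic_line analytic_path_Z; rewrite path_Z0.
have cqZ : q (path_Z (line s)) @[s --> 0^'] --> om G 3 xi0 / 2.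
  by rewrite -q0; apply: cvg_dnbhs; exact: (cvg_comp _ _ cZ cq).
have cl2 : f2 (foot s) @[s --> 0^'] --> lam2 G (gam G xi0).
  have -> : lam2 G (gam G xi0) = f2 p by rewrite /f2 flow_p.
  by apply: cvg_dnbhs; exact: (cvg_comp _ _ cvg_foot (analytic_continuous af2)).
(* For small [s != 0] this expression is the quotient itself, arranged so that the only division by
   a power of [s] left is the one covered by [path_xi_quotient]. *)
have cl : ((- om G 1 xi0 + path_time (line s) *
      (path_slope (line s) * path_slope (line s) * q (path_Z (line s)))
    + path_time (line s) * ((path_xi (line s) - xi0) / s ^+ 2 * h s)) *
    (1 + path_time (line s) * f2 (foot s))) @[s --> 0^'] -->
    (- om G 1 xi0 + tau G xi0 * (Num.sqrt (c1 G xi0) * Num.sqrt (c1 G xi0) * (om G 3 xi0 / 2))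
    + tau G xi0 * (0 * h 0)) * (1 + tau G xi0 * lam2 G (gam G xi0)).
  apply: cvgM.
    apply: cvgD.
      apply: cvgD; first exact: cvg_cst.
      by apply: cvgM => //; apply: cvgM => //; exact: cvgM.
    by apply: cvgM => //; apply: cvgM => //; exact: path_xi_quotient.
  by apply: cvgD; [exact: cvg_cst|exact: cvgM].
have o1 := om1_gt0 homega hxi0; have o3 := om3_gt0 homega hxi0.
have c10 : 0 <= c1 G xi0 by rewrite /c1 divr_ge0 ?mulr_ge0 ?sqr_ge0 // ltW.
have lE : (- om G 1 xi0 + tau G xi0 * (Num.sqrt (c1 G xi0) * Num.sqrt (c1 G xi0) * (om G 3 xi0 / 2))
    + tau G xi0 * (0 * h 0)) * (1 + tau G xi0 * lam2 G (gam G xi0)) =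
    2 * (lam2 G (gam G xi0) - lam1 G (gam G xi0)).
  (* By definition of [c1], [tau * c1 * om3 / 2 = 3 * om1], so the first factor is [2 * om1]; then
     [tau * om1 = 1] eliminates [om1]. *)
  rewrite tau_lam2 -expr2 sqr_sqrtr // /c1 (tauE hflow homega) //.
  by field; rewrite !gt_eqF.
rewrite lE in cl; apply: cvg_near_eq cl _.
have hE' := nbhs_dnbhs hE.
have hqZ : \forall s \near (0 : R), lam1 G (flow G xi0 (path_Z (line s))) =
  - om G 1 xi0 + path_Z (line s) ^+ 2 * q (path_Z (line s)) := cZ _ hq.
have hqZ' := nbhs_dnbhs hqZ.
have nfr : \forall s \near (0 : R), frame_dom G (of_row2 (flow G) (foot s)).
  have n1 : \forall w \near p, frame_dom G (of_row2 (flow G) w).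
    apply: (near_vanalytic flow_p vanalytic_flow0).
    by apply: open_nbhs_nbhs; split => //; exact: frame_open.
  exact: (@cvg_foot _ n1).
have nfr' := nbhs_dnbhs nfr.
near=> s; have s0 : s != 0 by near: s; exact: nbhs_dnbhs_neq.
have E1 : f (foot s) = f (foot0 s) + (path_xi (line s) - xi0) * h s by near: s.
have E2 : lam1 G (flow G xi0 (path_Z (line s))) =
  - om G 1 xi0 + path_Z (line s) ^+ 2 * q (path_Z (line s)) by near: s.
have fr : frame_dom G (of_row2 (flow G) (foot s)) by near: s.
have XE : path_X (line s) = of_row2 (flow G) (foot s) by rewrite /of_row2 !mxE.
have l12 : lam1 G (of_row2 (flow G) (foot s)) != lam2 G (of_row2 (flow G) (foot s)).
  by rewrite lt_eqF // (lam1_lt_lam2 hA1) //; exact: (frame_sub hframe).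
rewrite XE (det_eigen _ (r1_unit hframe fr) (r2_unit hframe fr)
  (r1_eigen hframe fr) (r2_eigen hframe fr) l12).
rewrite -/(f (foot s)) -/(f2 (foot s)) E1.
have -> : f (foot0 s) = lam1 G (flow G xi0 (path_Z (line s))).
  by rewrite /f /of_row2 !mxE.
rewrite E2.
have ZE : path_Z (line s) = s * path_slope (line s) by rewrite /path_Z mxE.
have TE : path_time (line s) = tau G xi0 + s ^+ 2 by rewrite /path_time !mxE.
have tau1 : tau G xi0 * om G 1 xi0 = 1 by rewrite (tauE hflow) // mulVf // gt_eqF.
set F2 := f2 _; set qZ := q _; rewrite ZE TE; set sl := path_slope _.
set px := path_xi _.
rewrite [in RHS](_ : 1 + (tau G xi0 + s ^+ 2) *
    (- om G 1 xi0 + (s * sl) ^+ 2 * qZ + (px - xi0) * h s)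
  = - (s ^+ 2 * om G 1 xi0) + (tau G xi0 + s ^+ 2) * ((s * sl) ^+ 2 * qZ + (px - xi0) * h s)).
  by field.
by rewrite -{1}tau1; ring.
Unshelve. all: by end_near. Qed.

End AtPoint.
End Path.

(** * Main theorem *)

Section Transport.
Context {R : realType}.

Lemma analytic1_continuous (f : R -> R) a :
  analytic_at (of_row1 f) (row_of [:: a]) -> {for a, continuous f}.
Proof.
move=> /analytic_continuous cf; have := cvg_comp _ _ (@cvg_row1 R a) cf.
have -> : of_row1 f \o (fun s => row_of [:: s]) = f.
  by apply/funext => s; rewrite /of_row1 /= mxE.
by rewrite /of_row1 mxE.
Qed.

Lemma near3_shift (a b c : R) P : near3 a b c P -> exists2 d, 0 < d &
  forall a' b' c', `|a' - a| < d -> `|b' - b| < d -> `|c' - c| < d ->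
    near3 a' b' c' P.
Proof.
move=> [d d0 h]; have d2 : 0 < d / 2 by rewrite divr_gt0.
have tri (x y z : R) : `|x - y| < d / 2 -> `|y - z| < d / 2 -> `|x - z| < d.
  by move=> h1 h2; rewrite -(subrKA y) (splitr d) (le_lt_trans (ler_normD _ _)) // ltrD.
exists (d / 2) => // a' b' c' ha hb hc; exists (d / 2) => // x y z hx hy hz.
by apply: h; [exact: tri hx ha|exact: tri hy hb|exact: tri hz hc].
Qed.

(** The last two centres stay put, since [phi] and [Q] are always specified around [sg = Z = 0]. *)
Lemma near4_shift (a b c e : R) P : near4 a b c e P -> exists2 d, 0 < d &
  forall a' b', `|a' - a| < d -> `|b' - b| < d -> near4 a' b' c e P.
Proof.
move=> [d d0 h]; have d2 : 0 < d / 2 by rewrite divr_gt0.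
have dd : d / 2 < d by rewrite ltr_pdivrMr // mulr_natr mulr2n ltrDl.
have tri (x y z : R) : `|x - y| < d / 2 -> `|y - z| < d / 2 -> `|x - z| < d.
  by move=> h1 h2; rewrite -(subrKA y) (splitr d) (le_lt_trans (ler_normD _ _)) // ltrD.
exists (d / 2) => // a' b' ha hb; exists (d / 2) => // x y z u hx hy hz hu.
by apply: h; [exact: tri hx ha|exact: tri hy hb|exact: lt_trans hz dd|exact: lt_trans hu dd].
Qed.

Context (G : gas_data R) (hcurve : gas_curve G) (hflow : gas_flow G)
  (homega : gas_omega G).

(** The limits above hold at the base point of the specifications, while the leading coefficients
    are needed at every nearby [(xi, st)]. Continuity of [tau] lets the specifications be recentred
    at [tau xi]. *)
Lemma near_specs xi0 st0 phi Q beta0 beta1 Z : itv G xi0 ->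
  phi_spec G xi0 phi -> quotient_spec G xi0 phi Q ->
  root_spec G xi0 st0 Q beta0 beta1 Z ->
  \forall v \near (row_of [:: xi0; st0; 0] : 'rV[R]_3),
    [/\ itv G ((v : 'rV[R]_3) 0 0), phi_spec G (v 0 0) phi,
      quotient_spec G (v 0 0) phi Q &
      root_spec G (v 0 0) (v 0 1) Q beta0 beta1 Z].
Proof.
move=> ix /near4_shift[d1 d10 h1] /near4_shift[d2 d20 h2] /near3_shift[d3 d30 h3].
set v0 : 'rV[R]_3 := row_of [:: xi0; st0; 0].
have v00 : v0 0 0 = xi0 by rewrite mxE.
have v01 : v0 0 1 = st0 by rewrite mxE.
have nt d : 0 < d -> \forall v \near v0, `|tau G ((v : 'rV[R]_3) 0 0) - tau G xi0| < d.
  move=> d0; apply: (near_coord v00 (P := fun x => `|tau G x - tau G xi0| < d)).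
  exact: (analytic1_continuous (analytic_tau hcurve hflow homega ix) (near_dist _ d0)).
have nx d : 0 < d -> \forall v \near v0, `|(v : 'rV[R]_3) 0 0 - xi0| < d.
  by move=> d0; exact: (near_coord v00 (near_dist xi0 d0)).
near=> v; split.
- by near: v; exact: (near_coord v00 (near_itv hcurve ix)).
- by apply: h1; near: v; [exact: nt|exact: nx].
- by apply: h2; near: v; [exact: nt|exact: nx].
- apply: h3; near: v; [exact: nt|exact: nx|].
  exact: (near_coord v01 (near_dist st0 d30)).
Unshelve. all: by end_near. Qed.

End Transport.


Theorem lemma4p2 (R : realType) (G : gas_data R)
    (hA1 : gas_A1 G) (hA2 : gas_A2 G) (hframe : gas_frame G)
    (hcurve : gas_curve G) (hflow : gas_flow G) (homega : gas_omega G)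
    (xi0 st0 : R) (hxi0 : itv G xi0)
    (phi Q : R -> R -> R -> R -> R) (beta0 beta1 : R -> R -> R -> R)
    (Z : bool -> R -> R -> R -> R)
    (hphi : phi_spec G xi0 phi) (hQ : quotient_spec G xi0 phi Q)
    (hZ : root_spec G xi0 st0 Q beta0 beta1 Z) :
  exists (B1 B2 : R -> R -> R -> 'rV[R]_2) (b1 b2 : R -> R -> R -> R),
  near3 (tau G xi0) xi0 st0 (fun t xi st =>
    [/\ [/\ vanalytic_at (of_row3 B1) (row_of [:: t; xi; st]),
            vanalytic_at (of_row3 B2) (row_of [:: t; xi; st]),
            analytic_at (of_row3 b1) (row_of [:: t; xi; st]) &
            analytic_at (of_row3 b2) (row_of [:: t; xi; st])],
        (tau G xi <= t -> forall b : bool,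
           vpm G phi Z b t xi ((t - tau G xi) * st) - vel G (gam G xi)
           = (t - tau G xi) *: B1 t xi st
             + (pm b * Num.sqrt (t - tau G xi)) *: B2 t xi st),
        (tau G xi < t -> forall b : bool,
           rhopm G phi Z b t xi ((t - tau G xi) * st)
           = (t - tau G xi)^-1
             * (b1 t xi st + pm b * b2 t xi st * Num.sqrt (t - tau G xi))),
        (t = tau G xi ->
           [/\ B2 t xi st
               = (Num.sqrt (c1 G xi) * lam1 G (gam G xi)) *: r1 G (gam G xi),
               B2 t xi st
               = - (om G 1 xi ^+ 2 * Num.sqrt (6 / om G 3 xi))
                   *: r1 G (gam G xi) &
               B2 t xi st != 0]) &
        (t = tau G xi ->
           b1 t xi st
           = dens G (gam G xi) / (2 * (lam2 G (gam G xi) - lam1 G (gam G xi)))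
           /\ 0 < b1 t xi st)]).
Proof.
set v0 : 'rV[R]_3 := row_of [:: xi0; st0; 0].
have v00 : v0 0 0 = xi0 by rewrite mxE.
have v02 : v0 0 2 = 0 by rewrite mxE.
have fx0 := gam_frame hcurve hxi0.
pose X := path_X G phi beta0 beta1.
pose W j (v : 'rV[R]_3) : R := vel G (X v) 0 j.
pose Del (v : 'rV[R]_3) : R := \det (1%:M + path_time G v *: 'J (vel G) (X v)).
have aX : vanalytic_at X v0.
  exact: (vanalytic_path_X hA1 hframe hcurve hflow homega hxi0 hphi hQ hZ).
have X0 : X v0 = gam G xi0 := path_X0 hflow beta0 beta1 st0 hxi0 hphi.
have av : vanalytic_at (vel G) (X v0).
  by rewrite X0; exact: (vel_analytic hA1 (frame_sub hframe fx0)).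
have aT := analytic_path_time hcurve hflow homega st0 hxi0.
have aW j : analytic_at (W j) v0.
  exact: (@analytic_comp _ _ _ (fun x => vel G x 0 j) X).
have aDel : analytic_at Del v0.
  have aJ i j : analytic_at (fun v => 'J (vel G) (X v) i j) v0.
    by apply: (@analytic_comp _ _ _ (fun x => 'J (vel G) x i j) X) => //; exact: vanalytic_jacobian.
  have aA i j : analytic_at (fun v => (1%:M + path_time G v *: 'J (vel G) (X v)) i j) v0.
    apply: analytic_eq (analyticD (analytic_cst ((1%:M : 'M[R]_2) i j) v0)
      (analyticM aT (aJ i j))) => v.
    by rewrite !mxE.
  apply: analytic_eq (analyticB (analyticM (aA 0 0) (aA 1 1)) (analyticM (aA 0 1) (aA 1 0))) => v.
  by rewrite /Del det_mx22.
(* A factor [s] is split off before sorting by parity, so that the velocity difference becomes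
   [s (E + s O)] with [E] and [O] functions of [s^2]. *)
have /choice[H hH] : forall j, exists H, analytic_at H v0 /\
    \forall v \near v0, W j v = W j (setc v 2 0) + v 0 2 * H v.
  move=> j; have [H aH HE] := analytic_hadamard 2 (aW j); exists H; split => //.
  by apply: filterS HE => v; rewrite v02 subr0.
have /choice[E hE] : forall j, exists E, exists O,
    [/\ analytic_at E v0, analytic_at O v0 &
    \forall v \near v0, H j v = E (setc v 2 (v 0 2 ^+ 2))
      + v 0 2 * O (setc v 2 (v 0 2 ^+ 2))].
  by move=> j; apply: analytic_even_odd v02 _; exact: (hH j).1.
move: hE => /choice[Od hEO].
(* Two successive divided differences in [s]: [Del] becomes [s^2 D2] as soon as [Del] and [D1] are
   known to vanish at [s = 0]. *)
have [D1 aD1 D1E] := analytic_hadamard 2 aDel.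
have [D2 aD2 D2E] := analytic_hadamard 2 aD1.
rewrite v02 in D1E D2E.
have nspec := near_specs hcurve hflow homega hxi0 hphi hQ hZ.
(* What has to hold at the points of the plane [s = 0], at each of them near [v0] and not just at
   [v0]. *)
pose ctr (v : 'rV[R]_3) : Prop := [/\ X v = gam G (v 0 0),
      forall j, H j v = Num.sqrt (c1 G (v 0 0)) * lam1 G (gam G (v 0 0)) * r1 G (gam G (v 0 0)) 0 j,
      Del v = 0, D1 v = 0 &
      D2 v = 2 * (lam2 G (gam G (v 0 0)) - lam1 G (gam G (v 0 0)))].
have center (v : 'rV[R]_3) : v 0 2 = 0 ->
    [/\ itv G (v 0 0), phi_spec G (v 0 0) phi, quotient_spec G (v 0 0) phi Q &
      root_spec G (v 0 0) (v 0 1) Q beta0 beta1 Z] ->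
    (forall j, \forall w \near v, W j w = W j (setc w 2 0) + w 0 2 * H j w) ->
    (forall j, analytic_at (H j) v) ->
    (\forall w \near v, Del w = Del (setc w 2 0) + (w 0 2 - 0) * D1 w) ->
    (\forall w \near v, D1 w = D1 (setc w 2 0) + (w 0 2 - 0) * D2 w) ->
    analytic_at D2 v ->
    ctr v.
  move=> v2 [iv hphi' hQ' hZ'] WE aHv DE DE' aD2v.
  pose line s : 'rV[R]_3 := row_of [:: v 0 0; v 0 1; s].
  have lineE s : line s = setc v 2 s by rewrite setc2E.
  have line0 : line 0 = v by rewrite lineE -v2 setc_id.
  have cline : line @ (0 : R) --> v.
    rewrite -[X in _ --> X]line0.
    apply: cvg_mx => i j; rewrite ord1 [X in _ --> X]mxE; under eq_fun do rewrite mxE.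
    by case: j => [[|[|[|//]]] hj] /=; [exact: cvg_cst|exact: cvg_cst|exact: cvg_id].
  have XE : X v = gam G (v 0 0).
    by rewrite -[in LHS]line0; exact: (path_X0 hflow beta0 beta1 (v 0 1) iv hphi').
  have line2 s : setc (line s) 2 0 = v by rewrite lineE setc_setc -v2 setc_id.
  have l02 s : line s 0 2 = s by rewrite mxE.
  have cD2 : D2 (line s) @[s --> (0 : R)] --> D2 v.
    exact: (cvg_comp _ _ cline (analytic_continuous aD2v)).
  have cD := @det_limit _ _ hA1 hframe hcurve hflow homega _ _ _ _ _ _ _ iv hphi' hQ' hZ'.
  have [] : [/\ Del v = 0, D1 v = 0 &
      D2 v = 2 * (lam2 G (gam G (v 0 0)) - lam1 G (gam G (v 0 0)))].
    (* Finiteness of the limit of [Del / s^2] kills the two lower coefficients and identifies [D2 v]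
       with the limit. *)
    apply: (sqr_quotient_limit cD2); apply: cvg_near_eq cD _.
    have F1 : \forall s \near (0 : R), Del (line s) = Del (setc (line s) 2 0) +
      (line s 0 2 - 0) * D1 (line s) := cline _ DE.
    have F2 : \forall s \near (0 : R), D1 (line s) = D1 (setc (line s) 2 0) +
      (line s 0 2 - 0) * D2 (line s) := cline _ DE'.
    have F1' := nbhs_dnbhs F1; have F2' := nbhs_dnbhs F2.
    near=> s.
    have G1 : Del (line s) = Del (setc (line s) 2 0) + (line s 0 2 - 0) * D1 (line s) by near: s.
    have G2 : D1 (line s) = D1 (setc (line s) 2 0) + (line s 0 2 - 0) * D2 (line s) by near: s.
    rewrite -/(Del (line s)) G1 G2 line2 l02 subr0; congr (_ / _); ring.
  move=> Dv D1v D2v.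
  split => // [j].
  have cH : H j (line s) @[s --> 0^'] --> H j v.
    by apply: cvg_dnbhs; exact: (cvg_comp _ _ cline (analytic_continuous (aHv j))).
  have cV := @velocity_limit _ _ hA1 hframe hcurve hflow homega _ _ _ _ _ _ _ iv hphi' hQ' hZ' j.
  apply: cvg_unique cH _ => //; apply: cvg_near_eq cV _.
  have WE' : \forall s \near (0 : R), W j (line s) = W j (setc (line s) 2 0) +
    line s 0 2 * H j (line s) := cline _ (WE j).
  have WE'' := nbhs_dnbhs WE'.
  near=> s; have s0 : s != 0 by near: s; exact: nbhs_dnbhs_neq.
  have : W j (line s) = W j (setc (line s) 2 0) + line s 0 2 * H j (line s) by near: s.
  rewrite line2 l02 {2}/W XE {1}/W => ->.
  by rewrite addrAC subrr add0r mulrAC mulfV // mul1r.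
have center0 : X v0 = gam G xi0 /\ D2 v0 = 2 * (lam2 G (gam G xi0) - lam1 G (gam G xi0)).
  have [-> _ _ _ ->] := center v0 v02 (nbhs_singleton nspec)
    (fun j => (hH j).2) (fun j => (hH j).1) D1E D2E aD2.
  by rewrite v00.
have gap := lam_gap hA1 hframe hcurve.
have D20 : D2 v0 != 0 by rewrite center0.2 gt_eqF // mulr_gt0 // gap.
(* The density is [M / s^2]; the even and odd parts of [M] provide [b1] and [b2]. *)
pose M (v : 'rV[R]_3) : R := dens G (X v) * (D2 v)^-1.
have aM : analytic_at M v0.
  apply: analyticM; last exact: analyticV.
  apply: (@analytic_comp _ _ _ (dens G) X) => //; rewrite X0.
  exact: (dens_analytic hA1 (frame_sub hframe fx0)).
have [Em [Om [aEm aOm ME]]] := analytic_even_odd v02 aM.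
have nW : \forall v \near v0, forall j, W j v = W j (setc v 2 0) + v 0 2 * H j v.
  apply: (@filter_forall _ _ (fun j v => W j v = W j (setc v 2 0) + v 0 2 * H j v)
    (nbhs v0)) => j; exact: (hH j).2.
have nH : \forall v \near v0, forall j, H j v = E j (setc v 2 (v 0 2 ^+ 2))
      + v 0 2 * Od j (setc v 2 (v 0 2 ^+ 2)).
  apply: (@filter_forall _ _ (fun j v => H j v = E j (setc v 2 (v 0 2 ^+ 2))
      + v 0 2 * Od j (setc v 2 (v 0 2 ^+ 2))) (nbhs v0)) => j.
  by have [] := hEO j.
have naH : \forall v \near v0, forall j, analytic_at (H j) v.
  apply: (@filter_forall _ _ (fun j v => analytic_at (H j) v) (nbhs v0)) => j.
  exact: analytic_near (hH j).1.
(* [center] asks for the identities on a neighbourhood of the point where it is applied, not merely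
   at that point. *)
have nWW := near_join nW; have nDD := near_join D1E; have nDD' := near_join D2E.
have naD2 := analytic_near aD2.
have ncenter : \forall v \near v0, (v : 'rV[R]_3) 0 2 = 0 -> ctr v.
  near=> v => v2; apply: center => //; last 1 first.
  - by near: v.
  - by near: v.
  - move=> j; have h : \forall w \near v, forall j, W j w = W j (setc w 2 0) + w 0 2 * H j w.
      by near: v.
    by apply: filterS h => w; apply.
  - by near: v.
  - by near: v.
  - by near: v.
(* The expansion at [v] starts from its projection on [s = 0], which must lie in the neighbourhood
   where [ctr] is known. *)
have csetc : (fun v : 'rV[R]_3 => setc v 2 0) @ v0 --> v0.
  have := vanalytic_continuous (@vanalytic_setc _ _ 2 _ _ (analytic_cst 0 v0)).
  by rewrite /prop_for /continuous_at -[X in setc v0 2 X]v02 setc_id.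
have ncenter' : \forall v \near v0, setc v 2 0 0 2 = 0 ->
    ctr (setc v 2 0)
  := csetc _ ncenter.
pose off (v : 'rV[R]_3) : Prop := [/\
    forall j, vel G (X v) 0 j - vel G (gam G (v 0 0)) 0 j = v 0 2 *
      (E j (setc v 2 (v 0 2 ^+ 2)) + v 0 2 * Od j (setc v 2 (v 0 2 ^+ 2))),
    Del v = v 0 2 ^+ 2 * D2 v, D2 v != 0 &
    M v = Em (setc v 2 (v 0 2 ^+ 2)) + v 0 2 * Om (setc v 2 (v 0 2 ^+ 2))].
have nP : \forall v \near v0, off v.
  have nD20 : \forall v \near v0, D2 v != 0.
    apply: (near_analytic (erefl (D2 v0)) aD2 (P := fun x => x != 0)).
    by apply: open_nbhs_nbhs; split => //; exact: open_neq.
  near=> v.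
  have s0 : setc v 2 0 0 0 = v 0 0 by rewrite mxE.
  have [Xc _ Dc D1c _] : ctr (setc v 2 0).
    have : setc v 2 0 0 2 = 0 by rewrite mxE.
    by near: v.
  split; last 3 first.
  - have : Del v = Del (setc v 2 0) + (v 0 2 - 0) * D1 v by near: v.
    have -> : D1 v = D1 (setc v 2 0) + (v 0 2 - 0) * D2 v by near: v.
    by rewrite Dc D1c => ->; ring.
  - by near: v.
  - by near: v.
  move=> j; have hW : forall j, W j v = W j (setc v 2 0) + v 0 2 * H j v by near: v.
  have <- : H j v = E j (setc v 2 (v 0 2 ^+ 2)) + v 0 2 * Od j (setc v 2 (v 0 2 ^+ 2)).
    by move: j; near: v.
  have := hW j; rewrite {2}/W Xc s0 /W => ->.
  by rewrite addrAC subrr add0r.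
pose lead (v : 'rV[R]_3) : Prop := v 0 2 = 0 -> [/\
    forall j, E j v = Num.sqrt (c1 G (v 0 0)) * lam1 G (gam G (v 0 0)) * r1 G (gam G (v 0 0)) 0 j &
    Em v = dens G (gam G (v 0 0)) / (2 * (lam2 G (gam G (v 0 0)) - lam1 G (gam G (v 0 0))))].
have nPc : \forall v \near v0, lead v.
  near=> v => v2.
  have sv : setc v 2 (v 0 2 ^+ 2) = v by rewrite v2 expr2 mul0r -{2}(setc_id v 2) v2.
  have [Xc Hc _ _ D2c] : ctr v.
    by move: v2; near: v.
  split.
    move=> j; rewrite -Hc.
    have : forall j, H j v = E j (setc v 2 (v 0 2 ^+ 2)) + v 0 2 * Od j (setc v 2 (v 0 2 ^+ 2)).
      by near: v.
    by move=> ->; rewrite sv v2 mul0r addr0.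
  rewrite -D2c -Xc -/(M v).
  have -> : M v = Em (setc v 2 (v 0 2 ^+ 2)) + v 0 2 * Om (setc v 2 (v 0 2 ^+ 2)) by near: v.
  by rewrite sv v2 mul0r addr0.
pose w0 : 'rV[R]_3 := row_of [:: tau G xi0; xi0; st0].
have w00 : w0 0 0 = tau G xi0 by rewrite mxE.
have w01 : w0 0 1 = xi0 by rewrite mxE.
have w02 : w0 0 2 = st0 by rewrite mxE.
pose gap_t (w : 'rV[R]_3) : R := w 0 0 - tau G (w 0 1).
have agap : analytic_at gap_t w0.
  apply: analyticB; first exact: analytic_coord.
  apply: (@analytic_comp1 _ _ _ (tau G)); last exact: analytic_coord.
  by rewrite w01; exact: analytic_tau.
have gap_t0 : gap_t w0 = 0 by rewrite /gap_t w00 w01 subrr.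
(* Back to [(t, xi, st)]: [la] puts [t - tau xi], the square of [s], in the third slot and is
   analytic, so the coefficients are composed with it. *)
pose la (w : 'rV[R]_3) : 'rV[R]_3 := row_of [:: w 0 1; w 0 2; gap_t w].
have ala : vanalytic_at la w0.
  by apply: vanalytic_row3 => //; exact: analytic_coord.
have la0 : la w0 = v0 by rewrite /la w01 w02 gap_t0.
(* [ka] puts the signed root [s] there instead. It is continuous at [w0], which suffices to pull
   back identities; as [Num.sqrt] is 0 on negative numbers, it stays close to [v0] also for
   [t < tau xi]. *)
pose ka (b : bool) (w : 'rV[R]_3) : 'rV[R]_3 :=
  row_of [:: w 0 1; w 0 2; pm b * Num.sqrt (gap_t w)].
have cka b : ka b @ w0 --> v0.
  have csq : pm b * Num.sqrt (gap_t w) @[w --> w0] --> (0 : R).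
    have c1 := cvg_comp _ _ (analytic_continuous agap) (@sqrt_continuous R (gap_t w0)).
    have c2 : pm b * Num.sqrt (gap_t w) @[w --> w0] --> pm b * Num.sqrt (gap_t w0).
      apply: (@cvgM _ _ (nbhs w0) (nbhs_filter w0)); last exact: c1.
      exact: (@cvg_cst _ _ _ (nbhs w0) (nbhs_filter w0)).
    by rewrite gap_t0 sqrtr0 mulr0 in c2; exact: c2.
  have c01 : (fun w : 'rV[R]_3 => w 0 1) @ w0 --> w0 0 1.
    exact: analytic_continuous (analytic_coord 1 w0).
  have c02 : (fun w : 'rV[R]_3 => w 0 2) @ w0 --> w0 0 2.
    exact: analytic_continuous (analytic_coord 2 w0).
  rewrite w01 in c01; rewrite w02 in c02.
  apply: (@cvg_mx _ _ (nbhs w0) (nbhs_filter w0)) => i j.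
  rewrite ord1 [X in _ --> X]mxE; under eq_fun do rewrite mxE.
  case: j => [[|[|[|//]]] hj] /=; last exact: csq.
  - exact: c01.
  - exact: c02.
have nPk : \forall w \near w0, forall b, off (ka b w).
  by apply: (@filter_forall _ _ (fun b w => off (ka b w)) (nbhs w0)) => b; exact: (cka b _ nP).
have nlead : \forall w \near w0, lead (la w) := near_vanalytic la0 ala nPc.
have nroot := (near3P _ _ _ _).1 hZ.
(* The factor [s] in front of the velocity difference exchanges the parities: the odd part [Od] gets
   [s^2] and becomes [B1], the even part [E] gets [s] and becomes [B2]. *)
exists (fun t xi st => \row_j Od j (row_of [:: xi; st; t - tau G xi])).
exists (fun t xi st => \row_j E j (row_of [:: xi; st; t - tau G xi])).
exists (fun t xi st => Em (row_of [:: xi; st; t - tau G xi])).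
exists (fun t xi st => Om (row_of [:: xi; st; t - tau G xi])).
have ala_comp f : analytic_at f v0 -> \forall w \near w0, analytic_at (fun w => f (la w)) w.
  by move=> af; apply: analytic_near; apply: analytic_comp ala; rewrite la0.
have nEa : \forall w \near w0, forall j, analytic_at (fun w => E j (la w)) w.
  apply: (@filter_forall _ _ (fun j w => analytic_at (fun w => E j (la w)) w) (nbhs w0)) => j.
  by apply: ala_comp; have [] := hEO j.
have nOa : \forall w \near w0, forall j, analytic_at (fun w => Od j (la w)) w.
  apply: (@filter_forall _ _ (fun j w => analytic_at (fun w => Od j (la w)) w) (nbhs w0)) => j.
  by apply: ala_comp; have [] := hEO j.
apply/near3P; near=> w; rewrite -(row3_eta w).
have laE : la w = row_of [:: w 0 1; w 0 2; w 0 0 - tau G (w 0 1)] by [].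
have iw : itv G (w 0 1).
  by near: w; exact: (near_coord w01 (near_itv hcurve hxi0)).
have ka_off : forall b, off (ka b w) by near: w.
have la_lead : lead (la w) by near: w.
have sq (a : R) (b : bool) : 0 <= a -> (pm b * Num.sqrt a) ^+ 2 = a.
  by move=> a0; rewrite exprMn sqr_sqrtr // /pm; case: b; rewrite ?sqrrN expr1n mul1r.
have ka2 b : ka b w 0 2 = pm b * Num.sqrt (w 0 0 - tau G (w 0 1)) by rewrite mxE.
have ka0 b : ka b w 0 0 = w 0 1 by rewrite mxE.
have ka1 b : ka b w 0 1 = w 0 2 by rewrite mxE.
have kla b : tau G (w 0 1) <= w 0 0 -> setc (ka b w) 2 (ka b w 0 2 ^+ 2) = la w.
  by move=> tw; rewrite setc2E ka0 ka1 ka2 sq // subr_ge0.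
have [_ _ _ Zw] : [/\ analytic_at (of_row3 beta0) (row_of [:: w 0 0; w 0 1; w 0 2]),
    analytic_at (of_row3 beta1) (row_of [:: w 0 0; w 0 1; w 0 2]),
    w 0 0 = tau G (w 0 1) -> beta1 (w 0 0) (w 0 1) (w 0 2) = Num.sqrt (c1 G (w 0 1)) &
    tau G (w 0 1) <= w 0 0 -> forall b, let sg := (w 0 0 - tau G (w 0 1)) * w 0 2 in
      Q (w 0 0) (w 0 1) sg (Z b (w 0 0) (w 0 1) sg) = 0 /\
      Z b (w 0 0) (w 0 1) sg = (w 0 0 - tau G (w 0 1)) * beta0 (w 0 0) (w 0 1) (w 0 2)
        + pm b * Num.sqrt (w 0 0 - tau G (w 0 1)) * beta1 (w 0 0) (w 0 1) (w 0 2)].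
  by near: w.
have kaT b : tau G (w 0 1) <= w 0 0 -> path_time G (ka b w) = w 0 0.
  by move=> tw; rewrite /path_time ka0 ka2 sq ?subr_ge0 // addrC subrK.
have XE b : tau G (w 0 1) <= w 0 0 ->
    Xpm G phi Z b (w 0 0) (w 0 1) ((w 0 0 - tau G (w 0 1)) * w 0 2) = X (ka b w).
  move=> tw; have [_ Zb] := Zw tw b.
  have ZE : Z b (w 0 0) (w 0 1) ((w 0 0 - tau G (w 0 1)) * w 0 2) = path_Z G beta0 beta1 (ka b w).
    rewrite Zb /path_Z /path_slope (kaT b tw) ka0 ka1 ka2.
    have := sq (w 0 0 - tau G (w 0 1)) b; rewrite subr_ge0 => /(_ tw) {1}<-; ring.
  rewrite /Xpm ZE /X /path_X /path_xi (kaT b tw) ka0 ka1.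
  by rewrite ka2 sq // subr_ge0.
have o1 := om1_gt0 homega iw; have o3 := om3_gt0 homega iw.
have la00 : la w 0 0 = w 0 1 by rewrite mxE.
have la02 : w 0 0 = tau G (w 0 1) -> la w 0 2 = 0 by move=> tw; rewrite mxE /= /gap_t tw subrr.
split.
- split.
  + move=> j; have : forall j, analytic_at (fun w => Od j (la w)) w by near: w.
    by move=> /(_ j); apply: analytic_eq => y; rewrite /of_row3 mxE.
  + move=> j; have : forall j, analytic_at (fun w => E j (la w)) w by near: w.
    by move=> /(_ j); apply: analytic_eq => y; rewrite /of_row3 mxE.
  + by near: w; exact: ala_comp.
  + by near: w; exact: ala_comp.
- move=> tw b; have [kv _ _ _] := ka_off b.
  apply/rowP => j; rewrite !mxE /vpm (XE b tw) -laE.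
  have := kv j; rewrite (kla b tw) ka0 => ->.
  by rewrite -[in X in _ = X + _](sq _ b (_ : 0 <= w 0 0 - tau G (w 0 1))) ?subr_ge0 // -ka2; ring.
- move=> tw b; have [_ kD kD2 kM] := ka_off b.
  rewrite /rhopm (XE b (ltW tw)) -laE.
  have -> : \det (1%:M + w 0 0 *: 'J (vel G) (X (ka b w))) = Del (ka b w).
    by rewrite /Del (kaT b (ltW tw)).
  rewrite kD; have := kM; rewrite (kla b (ltW tw)) {1}/M => kM'.
  rewrite invfM mulrCA mulrA -mulrA kM' ka2 sq ?subr_ge0 ?(ltW tw) //.
  by congr (_ * (_ + _)); rewrite mulrAC.
- move=> tw; have [hE _] := la_lead (la02 tw).
  have B2E : \row_j E j (la w) =
      (Num.sqrt (c1 G (w 0 1)) * lam1 G (gam G (w 0 1))) *: r1 G (gam G (w 0 1)).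
    by apply/rowP => j; rewrite !mxE hE la00.
  (* One factor [om1] comes out of the square root of [c1], the other is [- lam1]. *)
  have cE : Num.sqrt (c1 G (w 0 1)) * lam1 G (gam G (w 0 1)) =
      - (om G 1 (w 0 1) ^+ 2 * Num.sqrt (6 / om G 3 (w 0 1))).
    rewrite (lam1_gam hflow homega iw) /c1 mulrAC [_ * om G 1 _ ^+ 2]mulrC.
    by rewrite sqrtrM ?sqr_ge0 // sqrtr_sqr (gtr0_norm o1); ring.
  rewrite -laE; split => //; first by rewrite B2E cE.
  rewrite B2E cE scaler_eq0 negb_or oppr_eq0 mulf_neq0 /=.
  + apply/eqP => r0; have := r1_unit hframe (gam_frame hcurve iw).
    by rewrite r0 dotE !mxE; lra.
  + by rewrite expf_neq0 // gt_eqF.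
  + by rewrite gt_eqF // sqrtr_gt0 divr_gt0.
- move=> tw; have [_ hE] := la_lead (la02 tw).
  rewrite -laE hE la00; split => //; rewrite divr_gt0 ?mulr_gt0 ?gap //.
  by apply: (dens_gt0 hA1); exact: (frame_sub hframe (gam_frame hcurve iw)).
Unshelve. all: by end_near. Qed.
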